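(* Let $K$ be a field of characteristic zero, let $l\ge 2$, $S=K[x_1,\dots,x_l]$, and let $\mathcal{A}=\{H_1,\dots,H_n\}$ be a central hyperplane arrangement in $K^l$ with Jacobian ideal $J(\mathcal{A})\subseteq S$. Then $\mathcal{A}$ is free if and only if either $\mathrm{rgin}(J(\mathcal{A}))=S$, or the minimal monomial generators of $\mathrm{rgin}(J(\mathcal{A}))$ include $x_1^{n-1}$ and some positive power of $x_2$, and none of the minimal monomial generators is divisible by any of $x_3,\dots,x_l$. More precisely, if $\mathcal{A}$ is free, then either $\mathrm{rgin}(J(\mathcal{A}))=S$ or $\mathrm{rgin}(J(\mathcal{A}))$ is minimally generated by $$x_1^{n-1},\; x_1^{n-2}x_2^{\lambda_1},\; \dots,\; x_2^{\lambda_{n-1}}$$ for some integers $1\le\lambda_1<\lambda_2<\cdots<\lambda_{n-1}$ such that $\lambda_{i+1}-\lambda_i\in\{1,2\}$ for all $1\le i\le n-2$.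
   Context: A central hyperplane arrangement in $K^l$ is a finite set $\mathcal{A}=\{H_1,\dots,H_n\}$ of distinct hyperplanes through the origin; write $H_i=\alpha_i^{-1}(0)$ with $\alpha_i\in S=K[x_1,\dots,x_l]$ a linear form, and $Q(\mathcal{A})=\prod_{i=1}^n\alpha_i$. The Jacobian ideal $J(\mathcal{A})$ is the ideal of $S$ generated by $Q(\mathcal{A})$ and all its partial derivatives. Let $D(\mathcal{A})=\{\delta=\sum_i f_i\partial_{x_i}\mid f_i\in S,\ \delta(\alpha_j)\in\langle\alpha_j\rangle \text{ for all } j\}$; $\mathcal{A}$ is free if $D(\mathcal{A})$ is a free $S$-module. For a homogeneous ideal $I\subseteq S$, $\mathrm{rgin}(I)$ is the generic initial ideal of $I$ with respect to the degree reverse lexicographic order with $x_1>x_2>\dots>x_l$: the monomial ideal equal to $\mathrm{LT}(g(I))$ for all $g$ in a nonempty Zariski open subset of $\mathrm{GL}(l,K)$ acting by linear changes of coordinates. *)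

(* Defs.v *)
From HB Require Import structures.
From mathcomp Require Import all_boot all_order all_algebra.
From mathcomp Require Export multinomials.mpoly.

Set Implicit Arguments.
Unset Strict Implicit.
Unset Printing Implicit Defensive.

Import GRing.Theory.
Local Open Scope ring_scope.

(* The variables x_1, ..., x_l are 'X_i with i : 'I_l, numbered from 0. *)

Section Algebra.

Definition ideal_span (S : comNzRingType) (G : S -> Prop) (f : S) : Prop :=
  exists s : seq (S * S),
    (forall p, p \in s -> G p.2) /\ f = \sum_(p <- s) p.1 * p.2.

(* B is an arbitrary set of vectors, not assumed finite. *)
Definition is_basis (S : nzRingType) (V : lmodType S) (D B : V -> Prop) : Prop :=
  (forall s : seq V, uniq s -> (forall v, v \in s -> B v) ->
     forall c : V -> S, \sum_(v <- s) c v *: v = 0 ->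
       forall v, v \in s -> c v = 0) /\
  (forall d : V, D d <->
     exists (s : seq V) (c : V -> S),
       (forall v, v \in s -> B v) /\ d = \sum_(v <- s) c v *: v).

Definition is_free_module (S : nzRingType) (V : lmodType S) (D : V -> Prop) :=
  exists B : V -> Prop, is_basis D B.

End Algebra.

Section Arrangements.
Variables (K : fieldType) (l n : nat).
Local Notation S := {mpoly K[l]}.

Definition central_arrangement (H : 'I_n -> {vspace 'rV[K]_l}) : Prop :=
  injective H /\ forall i, \dim (H i) = l.-1.

Definition defining_forms (H : 'I_n -> {vspace 'rV[K]_l}) (alpha : 'I_n -> S) :=
  forall i, alpha i \is 1.-homog /\
    forall v : 'rV[K]_l, v \in H i <-> (alpha i).@[fun j => v 0 j] = 0.

Definition defining_poly (alpha : 'I_n -> S) : S := \prod_(i < n) alpha i.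

Definition jacobian_ideal (alpha : 'I_n -> S) : S -> Prop :=
  let Q := defining_poly alpha in
  ideal_span (fun f => f = Q \/ exists i : 'I_l, f = Q^`M(i)).

(* The row vector (f_1, ..., f_l) stands for the derivation sum_i f_i d/dx_i. *)
Definition derivation (d : 'rV[S]_l) (p : S) : S :=
  \sum_(i < l) d 0 i * p^`M(i).

Definition log_derivations (alpha : 'I_n -> S) (d : 'rV[S]_l) : Prop :=
  forall j, ideal_span (eq (alpha j)) (derivation d (alpha j)).

Definition free_arrangement (alpha : 'I_n -> S) : Prop :=
  is_free_module (log_derivations alpha).

End Arrangements.

Section GenericInitialIdeal.
Variables (K : fieldType) (l : nat).
Local Notation S := {mpoly K[l]}.

(* The order provided by mpoly.v on 'X_{1..l}, although advertised there as
   degrevlex, compares exponents lexicographically from the first variable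
   (deglex): it puts x_1 x_3 above x_2 ^ 2.  Hence the definition below, in
   which m1 is smaller than m2 when, in equal degrees, the last nonzero entry
   of m2 - m1 is negative. *)
Definition degrevlex_lt (m1 m2 : 'X_{1..l}) : bool :=
  (mdeg m1 < mdeg m2)%N ||
  ((mdeg m1 == mdeg m2) &&
   [exists i : 'I_l, (m2 i < m1 i)%N &&
      [forall j : 'I_l, (i < j)%N ==> (m1 j == m2 j)]]).

Definition leading_monomial (f : S) (m : 'X_{1..l}) : Prop :=
  m \in msupp f /\
  forall m', m' \in msupp f -> m' = m \/ degrevlex_lt m' m.

Definition initial_ideal (I : S -> Prop) : S -> Prop :=
  ideal_span (fun t => exists f m,
    [/\ I f, leading_monomial f m & t = f@_m *: 'X_[m]]).

Definition change_coords (g : 'M[K]_l) (f : S) : S :=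
  f \mPo [tuple \sum_(j < l) g i j *: 'X_j | i < l].

Definition change_coords_ideal (g : 'M[K]_l) (I : S -> Prop) (f : S) : Prop :=
  exists2 f', I f' & f = change_coords g f'.

Definition zariski_open_GL (U : 'M[K]_l -> Prop) : Prop :=
  exists P : {mpoly K[l * l]} -> Prop, forall g,
    U g <-> g \in unitmx /\ exists2 p, P p & p.@[fun k => mxvec g 0 k] <> 0.

Definition is_rgin (I R : S -> Prop) : Prop :=
  exists U : 'M[K]_l -> Prop,
    [/\ zariski_open_GL U, exists g, U g &
        forall g, U g ->
          forall f, R f <-> initial_ideal (change_coords_ideal g I) f].

(* Meaningful for monomial ideals R. *)
Definition min_mon_gen (R : S -> Prop) (m : 'X_{1..l}) : Prop :=
  R 'X_[m] /\ forall m', R 'X_[m'] -> (m' <= m)%MM -> m' = m.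

Definition minimally_generated_by (R : S -> Prop) (M : 'X_{1..l} -> Prop) :=
  (forall f, R f <-> ideal_span (fun t => exists2 m, M m & t = 'X_[m]) f) /\
  (forall m, min_mon_gen R m <-> M m).

End GenericInitialIdeal.

(* x_1 ^ a * x_2 ^ b, for l >= 2 *)
Definition mon12 (l a b : nat) : 'X_{1..l} :=
  [multinom nth 0%N [:: a; b] i | i < l].

(* Main.v *)
(* Write g for the gradient of Q in generic coordinates and J for the ideal its
   entries span; N denotes the syzygies of g, and D(A) is the direct sum of N
   and the Euler derivation.  Everything goes through the condition (L_k) that
   each syzygy of g modulo a_k = (x_{k+1}, ..., x_l) lifts to a syzygy of g,
   which amounts to saying that J meets a_k in a_k J.

   If D(A) is free, then (L_2): on the plane x_3 = ... = x_l = 0 the ideal J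
   contains a power of x_2 and a form prime to x_2, since Q restricts to a
   product of pairwise non-proportional forms.  For f = <h, g> in J and u a
   syzygy modulo a_2, f u - <u, g> h lies in N, so modulo a_2 both multiples of
   u are combinations of a basis of D(A); this basis stays independent, and u
   itself is such a combination.  Induction on the degree gives (L_k) for
   k >= 2, and then, in degrevlex, a leading monomial divisible by x_j with
   j >= 3 maximal remains one after division by x_j.  Conversely, if the
   leading monomials are generated in x_1 and x_2, reduction shows (L_k) for
   k >= 2, and a greedily chosen family of syzygies modulo a_2 lifts to a basis
   of N.

   On the plane, the degree-d part of J becomes a space W_d of polynomials in
   t = x_2 / x_1, and x_1^(d-e) x_2^e is a leading monomial iff some element of
   W_d vanishes to order exactly e at t = 0.  Shearing the coordinates moves
   the point 0, and in characteristic zero a Wronskian argument shows that the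
   orders fill an interval [0, k_d).  Since J is generated in degree n - 1,
   k_(d+1) = k_d + 1 forces the same growth ever after, whence the gaps of
   lambda are at most 2. *)

(* Genericity enters through lines of matrices: an open set of coordinate changes that contains g
   contains g + t d for all t outside the roots of one polynomial that is nonzero at t = 0. This is
   used twice. A line from a point of U towards a matrix in general position for the forms yields a
   g with both properties. The line of shears g (1 + x E_21) shows that W_d has the same orders of
   vanishing at almost every point x as at 0, so the Wronskian bound, valid at almost every point,
   applies at 0.

   The power of x_2 in J modulo a_2 has this origin: on the plane, Q and its derivative along x_1
   both come from J and have no common root at x_2 = 1, so a Bezout identity holds there, and it is
   made homogeneous with powers of x_2.

   Independence of the greedy family is tested along the sequence x_2, x_1 acting on N modulo a_2,
   and then x_3, ..., x_l are cancelled one at a time. Since long families of rows over a domain are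
   dependent, the greedy choice has to stop.

   For n = 0 the gradient of Q = 1 vanishes although J = S, so that case is separated before the
   gradient is used. *)
From Stdlib Require Import Classical_Prop.
From HB Require Import structures.
Require Import Defs.
From mathcomp Require Import all_boot all_order all_algebra zify.
Set Implicit Arguments.
Unset Strict Implicit.
Unset Printing Implicit Defensive.
Import GRing.Theory.
Local Open Scope ring_scope.

(** * Restriction to coordinate planes *)

Section Restriction.
Variables (K : fieldType) (l : nat).
Local Notation S := {mpoly K[l]}.
Implicit Types (p q f h : S) (m : 'X_{1..l}) (i j : 'I_l) (d e k : nat).

Lemma msupp_homog d p m : p \is d.-homog -> m \in msupp p -> mdeg m = d.
Proof. by move=> /dhomogP hp /hp. Qed.

Lemma mcoeff_homog0 d p m : p \is d.-homog -> mdeg m != d -> p@_m = 0.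
Proof. exact: dhomog_nemf_coeff. Qed.

Lemma pihomog_eq0 d p : (msize p <= d)%N -> pihomog mdeg d p = 0.
Proof.
move=> hp; rewrite pihomogE big_seq_cond big_pred0 // => m.
apply/negP => /andP [/msize_mdeg_lt hm /eqP hd].
by move: hm; rewrite hd ltnNge hp.
Qed.

Lemma pihomogMr d e p q : q \is e.-homog ->
  pihomog mdeg d (p * q) = if (e <= d)%N then pihomog mdeg (d - e) p * q else 0.
Proof.
move=> hq; rewrite {1}(pihomog_partitionE (leqnn (mmeasure mdeg p))).
rewrite mulr_suml raddf_sum /=.
have H c : pihomog mdeg d (pihomog mdeg c p * q) =
    if (c + e == d)%N then pihomog mdeg c p * q else 0.
  have h : pihomog mdeg c p * q \is (c + e).-homog.
    by apply: dhomogM hq; exact: pihomogP.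
  by case: eqP => [<-|/eqP ne]; [apply: pihomog_dE | apply: pihomog_ne0 ne h].
under eq_bigr do rewrite H.
case: leqP => le_ed; last first.
  apply: big1 => c _; case: eqP => // hc.
  by move: le_ed; rewrite -hc ltnNge leq_addl.
case: (ltnP (d - e) (mmeasure mdeg p)) => hlt.
  rewrite (bigD1 (Ordinal hlt)) //= subnK // eqxx big1 ?addr0 // => c hc.
  case: eqP => // hd; case/eqP: hc; apply/val_inj => /=.
  by rewrite -hd addnK.
rewrite (@pihomog_eq0 (d - e)) // mul0r.
apply: big1 => c _; case: eqP => // hd.
by move: (ltn_ord c); rewrite ltnNge -(addnK e c) hd hlt.
Qed.

Lemma homog_coeff0 p : p \is 0.-homog -> p = (p@_0)%:MP.
Proof.
move=> hp; apply/mpolyP => m; rewrite mcoeffC.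
case: eqP => [->|/eqP hm]; first by rewrite mulr1.
by rewrite mulr0 (mcoeff_homog0 hp) // mdeg_eq0.
Qed.

(** Subtraction of exponents truncates at 0, so this is division by ['X_i] only when every monomial
    of [p] contains that variable. *)
Definition Xquo i p : S := \sum_(m <- msupp p) p@_m *: 'X_[m - U_(i)].

Lemma Xquo_homog d i p : p \is d.-homog ->
  (forall m, m \in msupp p -> m i != 0%N) -> Xquo i p \is d.-1.-homog.
Proof.
move=> hd hp; rewrite /Xquo big_seq; apply: rpred_sum => m hm; apply: rpredZ.
rewrite dhomogX; have := msupp_homog hd hm.
by rewrite -{1}(@submK _ U_(i) m) ?lep1mP ?hp // mdegD mdeg1 addn1 => <-.
Qed.

Lemma mul_Xquo i p : (forall m, m \in msupp p -> m i != 0%N) -> p = 'X_i * Xquo i p.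
Proof.
move=> hp; rewrite {1}[p]mpolyE mulr_sumr !big_seq; apply: eq_bigr => m hm.
by rewrite -scalerAr -mpolyXD addmC submK // lep1mP hp.
Qed.

Definition low k m := [forall i : 'I_l, (k <= i)%N ==> (m i == 0%N)].

Lemma lowP k m : reflect (forall i, (k <= i)%N -> m i = 0%N) (low k m).
Proof.
apply: (iffP forallP) => H i; first by move=> hi; apply/eqP/(implyP (H i)).
by apply/implyP => hi; rewrite H.
Qed.

Lemma lowD k m1 m2 : low k (m1 + m2) = low k m1 && low k m2.
Proof.
apply/lowP/andP => [H|[/lowP H1 /lowP H2] i hi]; last first.
  by rewrite mnmDE H1 ?H2.
by split; apply/lowP => i hi; have := H i hi; rewrite mnmDE;
   move/eqP; rewrite addn_eq0 => /andP [/eqP ? /eqP].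
Qed.

Lemma low_mono k e m : (k <= e)%N -> low k m -> low e m.
Proof. by move=> hke /lowP H; apply/lowP => i hi; apply: H (leq_trans hke hi). Qed.

Lemma low1 k i : low k U_(i) = (i < k)%N.
Proof.
apply/lowP/idP => [H|hi j hj].
  by rewrite ltnNge; apply/negP => /H; rewrite mnm1E eqxx.
by rewrite mnm1E; case: eqP => // eij; move: hi; rewrite eij ltnNge hj.
Qed.

(** The quotient of S by a_k is modelled by an idempotent endomorphism of S, so that congruences
    modulo a_k become equations [restr k p = restr k q]. *)
Definition restr k : S -> S :=
  @comp_mpoly l K l [tuple if (i < k)%N then 'X_i else 0 | i < l].
HB.instance Definition _ k := GRing.RMorphism.copy (restr k)
  (@comp_mpoly l K l [tuple if (i < k)%N then 'X_i else 0 | i < l]).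
HB.instance Definition _ k := GRing.Linear.copy (restr k)
  (@comp_mpoly l K l [tuple if (i < k)%N then 'X_i else 0 | i < l]).

Lemma restrXm k m : restr k 'X_[m] = if low k m then 'X_[m] else 0.
Proof.
rewrite /restr comp_mpolyX; case: (boolP (low k m)) => [/lowP H|].
  rewrite [RHS]mpolyXE_id; apply: eq_bigr => i _; rewrite tnth_mktuple.
  by case: ltnP => // hi; rewrite H // !expr0.
rewrite negb_forall => /existsP [i]; rewrite negb_imply => /andP [hi hm].
rewrite (bigD1 i) //= tnth_mktuple ltnNge hi /=.
by rewrite expr0n (negbTE hm) mul0r.
Qed.

Lemma mcoeff_restr k p m : (restr k p)@_m = if low k m then p@_m else 0.
Proof.
rewrite [p in RHS]mpolyE {1}[p]mpolyE [restr k _]linear_sum !linear_sum.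
case: ifP => hm; last first.
  apply: big1 => m' _; rewrite linearZ /= restrXm mcoeffZ.
  case: ifP => hm'; last by rewrite mcoeff0 mulr0.
  by rewrite mcoeffX; case: eqP => [e|_]; rewrite ?mulr0 //; rewrite -e hm' in hm.
apply: eq_bigr => m' _; rewrite linearZ /= restrXm !mcoeffZ.
case: ifP => // hm'; rewrite mcoeff0 mcoeffX; case: eqP => // e.
by rewrite e hm in hm'.
Qed.

Lemma restrX k i : restr k 'X_i = if (i < k)%N then 'X_i else 0.
Proof. by rewrite restrXm low1. Qed.

Lemma restr_restr k e p : restr k (restr e p) = restr (minn k e) p.
Proof.
apply/mpolyP => m; rewrite !mcoeff_restr.
have -> : low (minn k e) m = low k m && low e m.
  apply/idP/andP => [H|[/lowP H1 /lowP H2]].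
    by split; apply: low_mono H; rewrite ?geq_minl ?geq_minr.
  by apply/lowP => i; rewrite geq_min => /orP [/H1|/H2].
by case: (low k m); case: (low e m).
Qed.

Lemma restr_id k p : restr k (restr k p) = restr k p.
Proof. by rewrite restr_restr minnn. Qed.

Lemma restr_all p : restr l p = p.
Proof.
apply/mpolyP => m; rewrite mcoeff_restr; case: lowP => // H; case: H => i.
by rewrite leqNgt ltn_ord.
Qed.

Lemma restr_homog k d p : p \is d.-homog -> restr k p \is d.-homog.
Proof.
move=> hp; apply/dhomogP => m; rewrite mcoeff_msupp mcoeff_restr.
by case: ifP => _; rewrite ?eqxx // -mcoeff_msupp => /(msupp_homog hp).
Qed.

Lemma mcoeff_pihomog d p m :
  (pihomog mdeg d p)@_m = if mdeg m == d then p@_m else 0.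
Proof.
rewrite pihomogE [p in RHS]mpolyE !linear_sum /= big_mkcond /=.
case: eqP => [hm|hm]; [apply: eq_bigr|apply: big1] => m' _;
  case: eqP => hm'; rewrite ?mcoeffZ ?mcoeffX //; case: eqP => [e|]; rewrite ?mulr0 //.
  by move: hm'; rewrite e.
by case: hm; rewrite -e.
Qed.

Lemma restr_pihomog k d p : restr k (pihomog mdeg d p) = pihomog mdeg d (restr k p).
Proof.
apply/mpolyP => m; rewrite mcoeff_restr !mcoeff_pihomog mcoeff_restr.
by case: ifP; case: ifP.
Qed.

Lemma restrXMl k i p : (i < k)%N -> restr k ('X_i * p) = 'X_i * restr k p.
Proof. by move=> hi; rewrite rmorphM /= restrX hi. Qed.

Lemma restr_supp k (hk : (k < l)%N) p : restr k p = 0 ->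
  forall m, m \in msupp (restr k.+1 p) -> m (Ordinal hk) != 0%N.
Proof.
move=> hp m; rewrite mcoeff_msupp mcoeff_restr; case: lowP => [H|]; rewrite ?eqxx //.
move=> hm; apply/negP => /eqP hm0.
suff : (restr k p)@_m = p@_m by rewrite hp mcoeff0 => e; rewrite -e eqxx in hm.
rewrite mcoeff_restr ifT //; apply/lowP => i; rewrite leq_eqVlt => /orP [/eqP e|].
  by rewrite -hm0; congr (m _); apply/val_inj.
exact: H.
Qed.

(** The ideal a_k is generated by a_(k+1) and x_(k+1), which is ['X_(Ordinal hk)]. The inductions on
    [k] below divide by a variable in this way. *)
Lemma restr_quo k (hk : (k < l)%N) p : restr k p = 0 ->
  restr k.+1 p = restr k.+1 ('X_(Ordinal hk) * Xquo (Ordinal hk) (restr k.+1 p)).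
Proof. by move=> hp; rewrite -mul_Xquo ?restr_id //; apply: restr_supp. Qed.

Lemma restr_quo_homog k (hk : (k < l)%N) d p : restr k p = 0 -> p \is d.-homog ->
  Xquo (Ordinal hk) (restr k.+1 p) \is d.-1.-homog.
Proof. by move=> hp hd; apply: Xquo_homog (restr_homog _ hd) _; apply: restr_supp. Qed.

Lemma mpolyX_neq0 m : 'X_[m] != 0 :> S.
Proof. by apply/eqP => /(congr1 (mcoeff m)); rewrite mcoeffX eqxx mcoeff0 => /eqP; rewrite oner_eq0. Qed.

Lemma mulXI m : injective ( *%R ('X_[m] : S)).
Proof. exact: (mulfI (mpolyX_neq0 m)). Qed.

End Restriction.

(** * Degree reverse lexicographic order *)

Section Degrevlex.
Variables (K : fieldType) (l : nat).
Local Notation S := {mpoly K[l]}.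
Implicit Types (p q f h : S) (m w : 'X_{1..l}) (i j : 'I_l) (d e k : nat).

Lemma drlP m1 m2 : reflect
  ((mdeg m1 < mdeg m2)%N \/
   mdeg m1 = mdeg m2 /\
   exists2 i : 'I_l, (m2 i < m1 i)%N & forall j : 'I_l, (i < j)%N -> m1 j = m2 j)
  (degrevlex_lt m1 m2).
Proof.
apply: (iffP orP) => -[h|]; [by left| |by left|].
  case/andP => /eqP h /existsP [i /andP [hi /forallP hj]]; right; split=> //.
  by exists i => // j hij; apply/eqP/(implyP (hj j)).
case=> h [i hi hj]; right; rewrite h eqxx; apply/existsP; exists i.
by rewrite hi; apply/forallP => j; apply/implyP => hij; rewrite hj.
Qed.

Lemma drl_irr m : degrevlex_lt m m = false.
Proof. by apply/drlP => -[|[_ [i]]]; rewrite ltnn. Qed.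

Lemma drl_trans m2 m1 m3 :
  degrevlex_lt m1 m2 -> degrevlex_lt m2 m3 -> degrevlex_lt m1 m3.
Proof.
move=> /drlP [h1|[h1 [i hi hi']]] /drlP [h2|[h2 [j hj hj']]]; apply/drlP.
- by left; apply: ltn_trans h2.
- by left; rewrite -h2.
- by left; rewrite h1.
right; split; first by rewrite h1.
case: (ltngtP i j) => hij.
- exists j; first by rewrite hi'.
  by move=> k hk; rewrite hi' ?hj' // (ltn_trans hij).
- exists i; first by rewrite -hj'.
  by move=> k hk; rewrite hi' ?hj' // (ltn_trans hij).
have e := val_inj hij; subst j; exists i; first exact: ltn_trans hi.
by move=> k hk; rewrite hi' ?hj'.
Qed.

Lemma drl_total m1 m2 : [\/ m1 = m2, degrevlex_lt m1 m2 | degrevlex_lt m2 m1].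
Proof.
case: (m1 =P m2) => [|ne]; first by constructor 1.
case: (ltngtP (mdeg m1) (mdeg m2)) => h.
- by constructor 2; apply/drlP; left.
- by constructor 3; apply/drlP; left.
have [i hi] : exists i : 'I_l, m1 i != m2 i.
  apply/existsP; apply: contra_notT ne; rewrite negb_exists => /forallP H.
  by apply/mnmP => i; apply/eqP/negPn/H.
have [j hj hmax] := @arg_maxnP _ i (fun i => m1 i != m2 i) (fun i : 'I_l => val i) hi.
have hj' (k : 'I_l) : (j < k)%N -> m1 k = m2 k.
  by move=> hk; apply/eqP/negPn/negP => /hmax hle; move: hk; rewrite ltnNge => /negP; apply; exact: hle.
move: hj; rewrite neq_ltn => /orP [hj|hj].
- constructor 3; apply/drlP; right; split => //; exists j => // k /hj' -> //.
- constructor 2; apply/drlP; right; split => //; exists j => // k /hj' -> //.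
Qed.

Lemma drl_add w m1 m2 : degrevlex_lt m1 m2 -> degrevlex_lt (w + m1) (w + m2).
Proof.
move=> /drlP [h|[h [i hi hj]]]; apply/drlP; rewrite !mdegD.
  by left; rewrite ltn_add2l.
right; split; first by rewrite h.
exists i; first by rewrite !mnmDE ltn_add2l.
by move=> j /hj; rewrite !mnmDE => ->.
Qed.

Lemma leading_monomial_exists f : f != 0 -> exists m, leading_monomial f m.
Proof.
rewrite -msupp_eq0 /leading_monomial; elim: (msupp f) => // a s IH _.
case: (s =P [::]) => [->|/eqP /IH [m [hm hs]]].
  by exists a; split=> [|m']; rewrite mem_seq1 ?eqxx // => /eqP; left.
case: (drl_total a m) => [e|lt_am|lt_ma].
- exists m; rewrite inE hm orbT; split=> // m'; rewrite inE e.
  by case/orP => [/eqP|/hs]; [left|].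
- exists m; rewrite inE hm orbT; split=> // m'; rewrite inE.
  by case/orP => [/eqP ->|/hs]; [right|].
exists a; rewrite inE eqxx; split=> // m'; rewrite inE.
case/orP => [/eqP|/hs []]; [by left|by move=> ->; right|].
by move=> h; right; apply: drl_trans lt_ma.
Qed.

Lemma leading_monomialP f m : leading_monomial f m <->
  f@_m != 0 /\ forall m', degrevlex_lt m m' -> f@_m' = 0.
Proof.
rewrite /leading_monomial; split=> -[h1 h2]; split; rewrite ?mcoeff_msupp // in h1 *.
  move=> m' hm'; apply/eqP; rewrite mcoeff_eq0; apply/negP => /h2 [e|lt].
    by rewrite e drl_irr in hm'.
  by have := drl_trans hm' lt; rewrite drl_irr.
move=> m'; rewrite mcoeff_msupp => hm'.
by case: (drl_total m' m) => [e|lt|/h2 e]; [left|right|rewrite e eqxx in hm'].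
Qed.

Lemma mcoeffXM w f m : ('X_[w] * f)@_(w + m) = f@_m.
Proof. by rewrite mulrC mcoeffMX. Qed.

Lemma mcoeffXM0 w f m : ~~ (w <= m)%MM -> ('X_[w] * f)@_m = 0.
Proof.
move=> h; apply/eqP; rewrite mcoeff_eq0; apply/negP => /msuppM_le.
case/allpairsP => -[a b] /= [/mem_msuppXP <- _ e].
by move: h; rewrite e lem_addr.
Qed.

Lemma leading_monomialM w f m :
  leading_monomial f m -> leading_monomial ('X_[w] * f) (w + m).
Proof.
move=> [h1 h2]; split; first by rewrite mcoeff_msupp mcoeffXM -mcoeff_msupp.
move=> m'; case: (boolP (w <= m')%MM) => hw; last first.
  by rewrite mcoeff_msupp mcoeffXM0 ?eqxx.
rewrite -(submK hw) addmC mcoeff_msupp mcoeffXM -mcoeff_msupp => /h2 [->|].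
  by left.
by move=> lt; right; apply: drl_add.
Qed.

Lemma leading_monomial_pihomog f m : leading_monomial f m ->
  leading_monomial (pihomog mdeg (mdeg m) f) m.
Proof.
move=> /leading_monomialP [h1 h2]; apply/leading_monomialP.
split=> [|m' /h2]; rewrite mcoeff_pihomog; first by rewrite eqxx.
by case: ifP.
Qed.

(** Only finitely many monomials have degree at most [d]; the recursion runs on the number of those
    below [m]. *)
Lemma drl_wf d (P : 'X_{1..l} -> Prop) :
  (forall m, mdeg m = d ->
     (forall m', mdeg m' = d -> degrevlex_lt m' m -> P m') -> P m) ->
  forall m, mdeg m = d -> P m.
Proof.
move=> step m; pose r m := #|[pred x : 'X_{1..l < d.+1} | degrevlex_lt x m]|.
have [n] := ubnP (r m); elim: n m => // n IH m hr hm; apply: step => // m' hm' lt.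
apply: IH => //; rewrite ltnS in hr; apply: leq_trans hr; apply: proper_card.
apply/properP; split.
  by apply/subsetP => x; rewrite !inE => h; apply: drl_trans lt.
have hb : (mdeg m' < d.+1)%N by rewrite hm'.
by exists (BMultinom hb); rewrite !inE //= drl_irr.
Qed.

Section Ideals.
Variable I : S -> Prop.
Hypothesis IM : forall h f, I f -> I (h * f).

(** Some summand of the combination must contain [m]. Its generator is a term whose monomial divides
    [m], and multiplying the element of [I] behind it by the quotient moves the leading monomial to
    [m]. *)
Lemma initial_idealX m :
  initial_ideal I 'X_[m] <-> exists2 f, I f & leading_monomial f m.
Proof.
split=> [[s [hs e]]|[f hf hm]]; last first.
  exists [:: ((f@_m)^-1%:MP, f@_m *: 'X_[m])]; split.
    by move=> p; rewrite mem_seq1 => /eqP -> /=; exists f, m.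
  rewrite big_seq1 /= mul_mpolyC scalerA mulVf ?scale1r //.
  by case: hm; rewrite mcoeff_msupp.
have : ('X_[m] : S)@_m != 0 by rewrite mcoeffX eqxx oner_eq0.
rewrite e raddf_sum /=.
case: (boolP (has (fun u => (u.1 * u.2)@_m != 0) s)) => [/hasP [u hu hum] _|].
  have [f [m0 [hf hm0 ep]]] := hs u hu.
  have le_m0m : (m0 <= m)%MM.
    apply/negPn/negP => hn; move: hum.
    by rewrite ep -scalerAr mulrC -mul_mpolyC mcoeffCM mcoeffXM0 // mulr0 eqxx.
  exists ('X_[m - m0] * f); first exact: IM.
  by rewrite -{2}(submK le_m0m); apply: leading_monomialM.
move=> /hasPn h; rewrite big1_seq ?eqxx // => u /andP [_ /h /negPn /eqP] //.
Qed.

End Ideals.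

End Degrevlex.

(** * Lifting syzygies *)

(** This property is what the reverse lexicographic order is chosen for. The last place where the
    exponents differ is the last variable of [m2], absent from [m1], and the larger exponent there
    makes [m2] the smaller monomial. *)
Lemma drl_low l k (m1 m2 : 'X_{1..l}) :
  mdeg m1 = mdeg m2 -> low k m1 -> ~~ low k m2 -> degrevlex_lt m2 m1.
Proof.
move=> hd /lowP h1 h2; case: (drl_total m1 m2) => // [e|].
  by case/negP: h2; rewrite -e; apply/lowP.
move=> /drlP [|[_ [i hi hj]]]; first by rewrite hd ltnn.
case/negP: h2; apply/lowP => j hkj; rewrite -hj ?h1 //; apply: leq_trans hkj.
by rewrite ltnNge; apply/negP => hki; rewrite h1 in hi.
Qed.

Section Syzygies.
Variables (K : fieldType) (l n e : nat).
Local Notation S := {mpoly K[l]}.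
Local Notation V := 'rV[S]_n.
Variable g : V.
Hypothesis g_homog : forall i, g 0 i \is e.-homog.
Implicit Types (p q f h : S) (m : 'X_{1..l}) (d k : nat) (u v w : V).

Definition dot u : S := \sum_i u 0 i * g 0 i.
Definition homog_row d u := forall i, u 0 i \is d.-homog.
Definition restr_row k u : V := map_mx (restr k) u.
Definition pihomog_row d u : V := map_mx (pihomog mdeg d) u.

Lemma dot0 : dot 0 = 0.
Proof. by rewrite /dot big1 // => i _; rewrite mxE mul0r. Qed.

Lemma dotD u v : dot (u + v) = dot u + dot v.
Proof. by rewrite -big_split; apply: eq_bigr => i _; rewrite mxE mulrDl. Qed.

Lemma dotZ h u : dot (h *: u) = h * dot u.
Proof. by rewrite mulr_sumr; apply: eq_bigr => i _; rewrite mxE mulrA. Qed.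

Lemma dotB u v : dot (u - v) = dot u - dot v.
Proof. by rewrite -scaleN1r dotD dotZ mulN1r. Qed.

Lemma dot_sum (I : Type) (r : seq I) (F : I -> V) :
  dot (\sum_(i <- r) F i) = \sum_(i <- r) dot (F i).
Proof. by apply: (big_morph dot dotD dot0). Qed.

Lemma restr_row0 k : restr_row k 0 = 0.
Proof. by apply/matrixP => i j; rewrite !mxE rmorph0. Qed.

Lemma restr_rowD k u v : restr_row k (u + v) = restr_row k u + restr_row k v.
Proof. by apply/matrixP => i j; rewrite !mxE rmorphD. Qed.

Lemma restr_rowZ k h u : restr_row k (h *: u) = restr k h *: restr_row k u.
Proof. by apply/matrixP => i j; rewrite !mxE rmorphM. Qed.

Lemma restr_rowB k u v : restr_row k (u - v) = restr_row k u - restr_row k v.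
Proof. by apply/matrixP => i j; rewrite !mxE rmorphB. Qed.

Lemma restr_row_all u : restr_row l u = u.
Proof. by apply/matrixP => i j; rewrite !mxE restr_all. Qed.

Lemma restr_row_le k1 k2 u v : (k1 <= k2)%N ->
  restr_row k2 u = restr_row k2 v -> restr_row k1 u = restr_row k1 v.
Proof.
move=> hk /matrixP H; apply/matrixP => i j; have := congr1 (restr k1) (H i j).
by rewrite !mxE !restr_restr (minn_idPl hk).
Qed.

Lemma restr_dot k u v :
  restr_row k u = restr_row k v -> restr k (dot u) = restr k (dot v).
Proof.
move=> /matrixP H; rewrite /dot [LHS]rmorph_sum [RHS]rmorph_sum.
by apply: eq_bigr => i _; have := H 0 i; rewrite !mxE !rmorphM /= => ->.
Qed.

Lemma homog_rowD d u v : homog_row d u -> homog_row d v -> homog_row d (u + v).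
Proof. by move=> hu hv i; rewrite mxE rpredD. Qed.

Lemma homog_rowB d u v : homog_row d u -> homog_row d v -> homog_row d (u - v).
Proof. by move=> hu hv i; rewrite !mxE rpredB. Qed.

Lemma homog_rowZ c d h u :
  h \is c.-homog -> homog_row d u -> homog_row (c + d) (h *: u).
Proof. by move=> hh hu i; rewrite mxE dhomogM. Qed.

Lemma pihomog_row_homog d u : homog_row d (pihomog_row d u).
Proof. by move=> i; rewrite mxE pihomogP. Qed.

Lemma pihomog_row_id d u : homog_row d u -> pihomog_row d u = u.
Proof.
by move=> hu; apply/matrixP => i j; rewrite !mxE ord1 pihomog_dE.
Qed.

Lemma pihomog_rowD d u v : pihomog_row d (u + v) = pihomog_row d u + pihomog_row d v.
Proof. by apply/matrixP => i j; rewrite !mxE raddfD. Qed.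

Lemma restr_pihomog_row k d u :
  restr_row k (pihomog_row d u) = pihomog_row d (restr_row k u).
Proof. by apply/matrixP => i j; rewrite !mxE restr_pihomog. Qed.

Lemma pihomog_rowZr d c h v : homog_row c v ->
  pihomog_row d (h *: v) =
  if (c <= d)%N then pihomog mdeg (d - c) h *: v else 0.
Proof.
move=> hv; apply/matrixP => i j; rewrite !mxE ord1 (pihomogMr _ _ (hv j)).
by case: ifP => _; rewrite mxE.
Qed.

Lemma pihomog_rowZl d c h v : h \is c.-homog ->
  pihomog_row d (h *: v) =
  if (c <= d)%N then h *: pihomog_row (d - c) v else 0.
Proof.
move=> hh; apply/matrixP => i j; rewrite !mxE mulrC (pihomogMr _ _ hh).
by case: ifP => _; rewrite !mxE // mulrC.
Qed.

Lemma pihomog_row_sum u : exists N, u = \sum_(d < N) pihomog_row d u.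
Proof.
exists (\max_(j < n) msize (u (0 : 'I_1)%R j)); apply/matrixP => i j.
rewrite summxE ord1 {1}(pihomog_partitionE (leq_bigmax (F := fun j => msize (u 0 j)) j)).
by apply: eq_bigr => d _; rewrite mxE.
Qed.

Lemma pihomog_dot d u :
  pihomog mdeg d (dot u) = if (e <= d)%N then dot (pihomog_row (d - e) u) else 0.
Proof.
rewrite /dot raddf_sum /=; case: ifP => hd; [|rewrite big1 // => i _];
  [apply: eq_bigr => i _|]; by rewrite (pihomogMr _ _ (g_homog i)) hd ?mxE.
Qed.

Lemma dot_homog d u : homog_row d u -> dot u \is (d + e).-homog.
Proof. by move=> hu; apply: rpred_sum => i _; apply: dhomogM. Qed.

Lemma syz_pihomog d u : dot u = 0 -> dot (pihomog_row d u) = 0.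
Proof.
move=> h; have := pihomog_dot (d + e) u; rewrite h raddf0 leq_addl addnK.
by move=> <-.
Qed.

Definition quo_row k (hk : (k < l)%N) u : V :=
  map_mx (fun p => Xquo (Ordinal hk) (restr k.+1 p)) u.

Lemma restr_quo_row k (hk : (k < l)%N) u : restr_row k u = 0 ->
  restr_row k.+1 u = restr_row k.+1 ('X_(Ordinal hk) *: quo_row hk u).
Proof.
move=> /matrixP H; apply/matrixP => i j; rewrite !mxE -restr_quo //.
by have := H i j; rewrite !mxE.
Qed.

Lemma quo_row_homog k (hk : (k < l)%N) d u : restr_row k u = 0 ->
  homog_row d u -> homog_row d.-1 (quo_row hk u).
Proof.
move=> /matrixP H hu i; rewrite mxE; apply: restr_quo_homog => //.
by have := H 0 i; rewrite !mxE.
Qed.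

Lemma restr_homog0 k p : p \is 0.-homog -> restr k p = p.
Proof. by move=> /homog_coeff0 ->; rewrite /restr comp_mpolyC. Qed.

Lemma restr_row_homog0 k u : homog_row 0 u -> restr_row k u = u.
Proof.
by move=> hu; apply/matrixP => i j; rewrite !mxE ord1 restr_homog0.
Qed.

(** The condition (L_k) of the overview. The grading permits induction on the degree of [u];
    [syz_lift_nonhomog] removes it. *)
Definition syz_lift k := forall d u, homog_row d u -> restr k (dot u) = 0 ->
  exists v, [/\ homog_row d v, dot v = 0 & restr_row k v = restr_row k u].

(** All entries of [g] have the same degree, so the homogeneous components of a syzygy modulo a_k
    are again syzygies modulo a_k and can be lifted separately. *)
Lemma syz_lift_nonhomog k u : syz_lift k -> restr k (dot u) = 0 ->
  exists2 v, dot v = 0 & restr_row k v = restr_row k u.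
Proof.
move=> hk h; have [N eN] := pihomog_row_sum u.
have H d : exists v, dot v = 0 /\ restr_row k v = restr_row k (pihomog_row d u).
  have [||v [_ h1 h2]] := hk d (pihomog_row d u).
  - exact: pihomog_row_homog.
  - have := pihomog_dot (d + e) u; rewrite leq_addl addnK => <-.
    by rewrite restr_pihomog h raddf0.
  by exists v.
suff [v [h1 h2]] : exists v, dot v = 0 /\
    restr_row k v = restr_row k (\sum_(d < N) pihomog_row d u).
  by exists v; rewrite // h2 -eN.
elim: {eN} N => [|N [v [h1 h2]]]; first by exists 0; rewrite big_ord0 dot0.
have [w [h3 h4]] := H N; exists (v + w); rewrite dotD h1 h3 addr0; split=> //.
by rewrite big_ord_recr /= !restr_rowD h2 h4.
Qed.

(** Lift [u] modulo a_k to a syzygy [v]. Modulo a_(k+1) the difference [u - v] is x_(k+1) times a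
    row [w]; cancelling x_(k+1) shows that [w] is a syzygy modulo a_(k+1), of smaller degree, and it
    lifts by induction. *)
Lemma syz_lift_step k : (k < l)%N -> syz_lift k -> syz_lift k.+1.
Proof.
move=> hkl hk; elim=> [|d IH] u hu h.
all: have h' : restr k (dot u) = 0
  by rewrite -(minn_idPl (leqnSn k)) -restr_restr h rmorph0.
all: have [v [hv h1 h2]] := hk _ u hu h'.
  (* In degree 0 the entries are constants, so agreement modulo a_k is equality. *)
  exists v; split=> //; congr restr_row.
  by rewrite -(restr_row_homog0 k hv) h2 (restr_row_homog0 k hu).
have huv : restr_row k (u - v) = 0 by rewrite restr_rowB h2 subrr.
pose w := quo_row hkl (u - v); have ew := restr_quo_row hkl huv.
have hw : homog_row d w by apply: quo_row_homog huv (homog_rowB hu hv).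
have [|w' [hw' h3 h4]] := IH w hw.
  apply: (@mulXI _ _ U_(Ordinal hkl)); rewrite mulr0 -restrXMl // -dotZ.
  by rewrite -(restr_dot ew) dotB h1 subr0.
exists (v + 'X_(Ordinal hkl) *: w'); split.
- apply: homog_rowD => //; apply: (@homog_rowZ 1%N); rewrite // dhomogX.
  by apply/eqP; exact: mdeg1.
- by rewrite dotD dotZ h1 h3 mulr0 addr0.
rewrite restr_rowD restr_rowZ h4 -restr_rowZ -ew restr_rowB addrC subrK //.
Qed.

Lemma syz_lift_ge k0 k : (k0 <= k)%N -> (k <= l)%N -> syz_lift k0 -> syz_lift k.
Proof.
elim: k => [|k IH]; first by rewrite leqn0 => /eqP ->.
rewrite leq_eqVlt => /orP [/eqP -> //|hk] hkl h.
by apply: syz_lift_step => //; apply: IH => //; apply: ltnW.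
Qed.

Definition lead_mon m := exists u, leading_monomial (dot u) m.

Lemma lead_mon_homog m : lead_mon m -> (e <= mdeg m)%N /\
  exists2 u, homog_row (mdeg m - e) u & leading_monomial (dot u) m.
Proof.
move=> [u /leading_monomial_pihomog]; rewrite pihomog_dot.
case: ifP => he; last by move=> []; rewrite msupp0.
move=> h; split=> //; exists (pihomog_row (mdeg m - e) u) => //.
exact: pihomog_row_homog.
Qed.

(** Here x_(j+1) is the last variable of the leading monomial of [f = dot u], so by [drl_low] all of
    [f] lies in a_j. Correcting [u] by a lifted syzygy turns it into x_(j+1) [w] modulo a_(j+1), and
    there [dot w] is f / x_(j+1). *)
Lemma lead_mon_quo m (j : 'I_l) :
  syz_lift j -> lead_mon m -> m j != 0%N -> low j.+1 m -> lead_mon (m - U_(j)).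
Proof.
move=> hj /lead_mon_homog [hd [u hu hm]] hmj hlow.
have /leading_monomialP [hm1 hm2] := hm.
have hnl : ~~ low j m by apply/negP => /lowP /(_ j (leqnn _)) h; rewrite h in hmj.
have hf0 : restr j (dot u) = 0.
  apply/mpolyP => m'; rewrite mcoeff_restr mcoeff0; case: ifP => // hl.
  case: (mdeg m' =P mdeg m) => [hmm|/eqP hmm]; last first.
    by apply: (mcoeff_homog0 (dot_homog hu)); rewrite subnK.
  by apply: hm2; apply: (@drl_low _ j).
have [v [hv h1 h2]] := hj _ u hu hf0.
have huv : restr_row j (u - v) = 0 by rewrite restr_rowB h2 subrr.
pose w := quo_row (ltn_ord j) (u - v); have ew := restr_quo_row (ltn_ord j) huv.
have ej : Ordinal (ltn_ord j) = j by apply: val_inj.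
have hw : homog_row (mdeg m - e).-1 w by apply: quo_row_homog huv (homog_rowB hu hv).
have E m' : low j.+1 m' -> (dot w)@_m' = (dot u)@_(U_(j) + m').
  move=> hl; have := restr_dot ew; rewrite dotB h1 subr0 dotZ restrXMl // ej.
  move/(congr1 (mcoeff (U_(j) + m'))); rewrite mcoeff_restr mcoeffXM mcoeff_restr hl.
  by rewrite lowD low1 ltnS leqnn hl => <-.
have em : (U_(j) + (m - U_(j)) = m)%MM by rewrite addmC submK // lep1mP.
have hl1 : low j.+1 (m - U_(j)).
  by move: hlow; rewrite -{1}em lowD => /andP [].
have c1 : (dot w)@_(m - U_(j)) != 0 by rewrite E // em.
exists w; apply/leading_monomialP; split=> // m' lt.
have hdw : forall m1 : 'X_{1..l}, (dot w)@_m1 != 0 -> mdeg m1 = ((mdeg m - e).-1 + e)%N.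
  by move=> m1; rewrite -mcoeff_msupp => /(msupp_homog (dot_homog hw)).
(* [dot w] is known only modulo a_(j+1). Its other monomials have the same degree and are smaller by
   [drl_low], so they cannot lead. *)
case: (boolP (low j.+1 m')) => hl.
  by rewrite E //; apply: hm2; rewrite -{1}em; apply: drl_add.
apply/eqP/negPn/negP => c2.
have := @drl_low _ j.+1 (m - U_(j))%MM m'; rewrite (hdw _ c1) (hdw _ c2).
move=> /(_ erefl hl1 hl) lt'; have := drl_trans lt lt'; by rewrite drl_irr.
Qed.

Lemma lead_mon_low k0 m : (forall k, (k0 <= k <= l)%N -> syz_lift k) ->
  lead_mon m -> exists m0, [/\ (m0 <= m)%MM, low k0 m0 & lead_mon m0].
Proof.
move=> H; have [N] := ubnP (mdeg m); elim: N m => // N IH m hN hm.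
case: (boolP (low k0 m)) => [hl|]; first by exists m; rewrite lepm_refl.
rewrite negb_forall => /existsP [i]; rewrite negb_imply => /andP [hi hmi].
have [j hj hmax] := @arg_maxnP _ i (fun i => m i != 0%N) (fun i : 'I_l => val i) hmi.
have kj : (k0 <= j)%N by apply: leq_trans hi _; apply: hmax.
have [||m0 [h1 h2 h3]] := IH (m - U_(j))%MM.
- rewrite -ltnS; apply: leq_trans hN; rewrite ltnS.
  by rewrite -{2}(@submK _ U_(j) m) ?lep1mP // mdegD mdeg1 addn1.
- apply: lead_mon_quo => //; first by apply: H; rewrite kj ltnW.
  apply/lowP => i' hi'; apply/eqP/negPn/negP => /hmax hle.
  by move: hi'; rewrite ltnNge => /negP; apply; exact: hle.
by exists m0; split=> //; apply: lepm_trans h1 (lem_subr _ _).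
Qed.

(** When [f = dot u] lies in a_k, each leading monomial met in the reduction lies in a_k, while its
    divisor [m0] avoids those variables; hence the multiplier lies in a_k. The reduction thus writes
    [f] as [dot u'] with [u'] zero modulo a_k, and [u - u'] is the lift. *)
Lemma low_lead_syz_lift k0 k :
  (forall m, lead_mon m -> exists m0, [/\ (m0 <= m)%MM, low k0 m0 & lead_mon m0]) ->
  (k0 <= k)%N -> syz_lift k.
Proof.
move=> H hk0 d u hu hf.
suff [u' [hu' h1 h2]] : exists u', [/\ homog_row d u', dot u' = dot u & restr_row k u' = 0].
  exists (u - u'); split; first exact: homog_rowB.
    by rewrite dotB h1 subrr.
  by rewrite restr_rowB h2 subr0.
pose P m := forall u, homog_row d u -> restr k (dot u) = 0 -> leading_monomial (dot u) m ->
  exists u', [/\ homog_row d u', dot u' = dot u & restr_row k u' = 0].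
have key : forall m, mdeg m = (d + e)%N -> P m.
  apply: drl_wf => m hm IH {}u {}hu {}hf hlm.
  have /leading_monomialP [hm1 hm2] := hlm.
  have [|m0 [le0 low0 lead0]] := H m; first by exists u.
  have [he [u0 hu0 hm0]] := lead_mon_homog lead0.
  have /leading_monomialP [hm01 hm02] := hm0.
  pose a := (dot u)@_m / (dot u0)@_m0; pose b : S := a *: 'X_[m - m0].
  have hb : restr k b = 0.
    rewrite /b linearZ /= restrXm ifF ?scaler0 //; apply/negP => hl.
    move: hm1; suff : (restr k (dot u))@_m = (dot u)@_m by rewrite hf mcoeff0 => <-; rewrite eqxx.
    by rewrite mcoeff_restr -(submK le0) lowD hl (low_mono hk0 low0).
  have hbu : homog_row d (b *: u0).
    have -> : d = (mdeg (m - m0) + (mdeg m0 - e))%N.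
      apply: (@addIn e); rewrite -hm -addnA subnK // -mdegD submK //.
    by apply: homog_rowZ => //; apply: dhomogZ; rewrite dhomogX.
  pose u1 := u - b *: u0.
  have hu1 : homog_row d u1 by apply: homog_rowB.
  have ru1 : restr_row k u1 = restr_row k u.
    by rewrite restr_rowB restr_rowZ hb scale0r subr0.
  have hf1 : restr k (dot u1) = 0 by rewrite (restr_dot ru1).
  have [u' [h1 h2 h3]] : exists u', [/\ homog_row d u', dot u' = dot u1 & restr_row k u' = 0].
    case: (dot u1 =P 0) => [->|/eqP /leading_monomial_exists [m' lm']].
      exists 0; split; [|exact: dot0|exact: restr_row0].
      by move=> i; rewrite mxE; apply: dhomog0.
    have dm' : mdeg m' = (d + e)%N by case: (lm') => /(msupp_homog (dot_homog hu1)).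
    apply: (IH m') => //.
    case/leading_monomialP: lm' => c1 c2.
    have Z m1 : (dot u1)@_m1 = (dot u)@_m1 - a * ('X_[m - m0] * dot u0)@_m1.
      by rewrite dotB dotZ mcoeffB /b -scalerAl mcoeffZ.
    case: (drl_total m' m) => // [e1|lt].
      case/negP: c1; rewrite e1 Z -{2}(submK le0) mcoeffXM -mulrA mulVf // mulr1.
      by rewrite subrr.
    case/negP: c1; rewrite Z hm2 // sub0r oppr_eq0.
    have /leading_monomialP [_ lm2] := leading_monomialM (m - m0) hm0.
    by rewrite lm2 ?mulr0 // submK.
  exists (u' + b *: u0); split; first exact: homog_rowD.
    by rewrite dotD h2 dotB dotZ subrK.
  by rewrite restr_rowD h3 restr_rowZ hb scale0r addr0.
case: (dot u =P 0) => [->|/eqP /leading_monomial_exists [m lm]].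
  exists 0; split; [|exact: dot0|exact: restr_row0].
  by move=> i; rewrite mxE; apply: dhomog0.
by apply: (key m) => //; case: lm => /(msupp_homog (dot_homog hu)).
Qed.

End Syzygies.

(** * Greedy bases of syzygies *)

(** Padding [A] with zero columns makes it square of determinant 0, and over a domain such a matrix
    has a nonzero kernel vector. *)
Lemma lin_dependent (R : idomainType) (p n : nat) (A : 'M[R]_(p, n)) :
  (n < p)%N -> exists2 v : 'rV_p, v != 0 & v *m A = 0.
Proof.
move=> lt_np.
pose B : 'M[R]_p := \matrix_(i, j) if insub (val j) is Some j' then A i j' else 0.
have [|v v0 vB] := @det0P _ _ B _.
  rewrite (expand_det_col _ (Ordinal lt_np)) big1 // => i _.
  by rewrite mxE insubN /= ?ltnn // mul0r.
exists v => //; apply/matrixP => i j; rewrite mxE [RHS]mxE.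
have := congr1 (fun M : 'M_(_, _) => M i (widen_ord (ltnW lt_np) j)) vB.
rewrite !mxE => E; rewrite -[RHS]E; apply: eq_bigr => k _; rewrite mxE.
by case: insubP => [j' _ e|]; [congr (_ * A _ _); apply: val_inj|rewrite /= ltn_ord].
Qed.

Lemma least_nat (P : nat -> Prop) : (exists n, P n) ->
  exists2 n, P n & forall m, (m < n)%N -> ~ P m.
Proof.
case=> n; have [N] := ubnP n; elim: N n => // N IH n hN hP.
case: (classic (exists2 m, (m < n)%N & P m)) => [[m lt hm]|H].
  by apply: (IH m) => //; apply: leq_trans lt _; rewrite -ltnS.
by exists n => // m lt hm; apply: H; exists m.
Qed.

Section FreeSyzygies.
Variables (K : fieldType) (l n e : nat).
Local Notation S := {mpoly K[l]}.
Local Notation V := 'rV[S]_n.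
Variable g : V.
Hypothesis g_homog : forall i, g 0 i \is e.-homog.
Hypothesis l_ge2 : (2 <= l)%N.
Hypothesis lift : forall k, (2 <= k <= l)%N -> syz_lift g k.
Implicit Types (p q f h : S) (m : 'X_{1..l}) (d k : nat) (u v w : V).
Implicit Types (s : seq V) (c : nat -> S).

Let lt0l : (0 < l)%N := ltnW l_ge2.
Let i0 : 'I_l := Ordinal lt0l.
Let i1 : 'I_l := Ordinal l_ge2.

Definition comb c s : V := \sum_(i < size s) c i *: nth 0 s i.

Lemma comb_rcons c s v : comb c (rcons s v) = comb c s + c (size s) *: v.
Proof.
rewrite /comb size_rcons big_ord_recr /= nth_rcons ltnn eqxx.
by under eq_bigr => i _ do rewrite nth_rcons ltn_ord.
Qed.

Lemma eq_comb c1 c2 s : (forall i, (i < size s)%N -> c1 i = c2 i) -> comb c1 s = comb c2 s.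
Proof. by move=> H; apply: eq_bigr => i _; rewrite H. Qed.

Lemma combD c1 c2 s : comb c1 s + comb c2 s = comb (fun i => c1 i + c2 i) s.
Proof. by rewrite -big_split; apply: eq_bigr => i _; rewrite scalerDl. Qed.

Lemma combZ h c s : h *: comb c s = comb (fun i => h * c i) s.
Proof. by rewrite scaler_sumr; apply: eq_bigr => i _; rewrite scalerA. Qed.

Lemma restr_comb k c1 c2 s :
  (forall i, (i < size s)%N -> restr k (c1 i) = restr k (c2 i)) ->
  restr_row k (comb c1 s) = restr_row k (comb c2 s).
Proof.
move=> H; rewrite /comb !(big_morph _ (restr_rowD k) (@restr_row0 _ _ _ k)).
by apply: eq_bigr => i _; rewrite !restr_rowZ H.
Qed.

Definition spanned k s v := exists c, restr_row k v = restr_row k (comb c s).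

Lemma spannedD k s u v : spanned k s u -> spanned k s v -> spanned k s (u + v).
Proof.
by move=> [c1 h1] [c2 h2]; exists (fun i => c1 i + c2 i); rewrite -combD !restr_rowD h1 h2.
Qed.

Lemma spannedZ k s h v : spanned k s v -> spanned k s (h *: v).
Proof.
by move=> [c hc]; exists (fun i => h * c i); rewrite -combZ !restr_rowZ hc.
Qed.

Lemma spanned0 k s : spanned k s 0.
Proof.
exists (fun=> 0); congr restr_row; rewrite /comb big1 // => i _.
by rewrite scale0r.
Qed.

(* Built greedily, each element is of least degree among the syzygies that
   are not, modulo x_3, ..., x_l, combinations of the previous ones. *)
Inductive greedy : seq V -> Prop :=
| greedy_nil : greedy [::]
| greedy_rcons s d v : greedy s -> homog_row d v -> dot g v = 0 ->
    ~ spanned 2 s v ->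
    (forall d' w, (d' < d)%N -> homog_row d' w -> dot g w = 0 -> spanned 2 s w) ->
    greedy (rcons s v).

Lemma greedy_syz s c : greedy s -> dot g (comb c s) = 0.
Proof.
elim=> [|{}s d v _ IH _ hv _ _]; first by rewrite /comb big_ord0 dot0.
by rewrite comb_rcons dotD dotZ IH hv mulr0 addr0.
Qed.

Lemma greedy_pihomog s c d : greedy s -> exists c', pihomog_row d (comb c s) = comb c' s.
Proof.
elim=> [|{}s d' v _ [c' IH] hv _ _ _].
  by exists c; rewrite /comb big_ord0; apply/matrixP => i j; rewrite !mxE raddf0.
pose a := if (d' <= d)%N then pihomog mdeg (d - d') (c (size s)) else 0.
exists (fun i => if i == size s then a else c' i).
rewrite !comb_rcons eqxx pihomog_rowD IH (pihomog_rowZr _ _ hv).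
congr (_ + _); last by rewrite /a; case: ifP; rewrite ?scale0r.
by apply: eq_comb => i hi; rewrite ltn_eqF.
Qed.

(** With N the module of syzygies, [inX01] and [inX1] stand for (x_1, x_2) N and x_2 N, both read
    modulo a_2. The next lemmas show the greedy family independent over K modulo the first, over
    K[x_1] modulo the second, and finally over K[x_1, x_2] in N modulo a_2. *)
Definition inX01 v := exists w w', [/\ dot g w = 0, dot g w' = 0 &
  restr_row 2 v = restr_row 2 ('X_i0 *: w + 'X_i1 *: w')].
Definition inX1 v := exists2 w, dot g w = 0 & restr_row 2 v = restr_row 2 ('X_i1 *: w).

Lemma restr0E p : restr 0 p = (p@_0)%:MP.
Proof.
apply/mpolyP => m; rewrite mcoeff_restr mcoeffC; case: lowP => [H|H].
  have -> : m = 0%MM by apply/mnmP => i; rewrite H // mnm0E.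
  by rewrite eqxx mulr1.
case: eqP => [e1|]; last by rewrite mulr0.
by case: H => i _; rewrite e1 mnm0E.
Qed.

(** Let [a] be the constant term of the last coefficient. In the component of degree [d] of the
    relation, the right side involves only syzygies of degree below [d], which are spanned by
    minimality of [d]; so [a *: v] is spanned by the earlier elements and [a = 0]. *)
Lemma greedy_step0 s c : greedy s -> inX01 (comb c s) ->
  forall i, (i < size s)%N -> restr 0 (c i) = 0.
Proof.
move=> hs; elim: hs c => [|{}s d v hs IH hv v0 nsp least] c //.
rewrite comb_rcons => -[w [w' [w0 w'0 ew]]].
have H0 : restr 0 (c (size s)) = 0.
  rewrite restr0E; set a := (c (size s))@_0.
  have [->|ha] := eqVneq a 0; first by rewrite mpolyC0.
  case: nsp.
  suff : spanned 2 s (a%:MP *: v).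
    move=> /(spannedZ (a^-1)%:MP); rewrite scalerA -mpolyCM mulVf // mpolyC1.
    by rewrite scale1r.
  have : spanned 2 s (pihomog_row d ('X_i0 *: w + 'X_i1 *: w')).
    have X i x : dot g x = 0 -> spanned 2 s (pihomog_row d ('X_i *: x)).
      move=> hx; rewrite (@pihomog_rowZl _ _ _ _ 1%N); last by rewrite dhomogX; apply/eqP/mdeg1.
      case: ifP => hd; last exact: spanned0.
      apply: spannedZ; apply: (least (d - 1)%N).
      - by rewrite ltn_subrL hd.
      - exact: pihomog_row_homog.
      - exact: (syz_pihomog g_homog).
    by rewrite pihomog_rowD; apply: spannedD; apply: X.
  have [c' ec'] := greedy_pihomog c d hs.
  move=> [c'' ec'']; move/(congr1 (pihomog_row d)): ew.
  rewrite -!restr_pihomog_row ec'' pihomog_rowD (pihomog_rowZr _ _ hv) leqnn subnn ec'.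
  rewrite (homog_coeff0 (pihomogP _ _ _)) mcoeff_pihomog mdeg0 eqxx -/a.
  rewrite restr_rowD => ea; exists (fun i => c'' i - c' i).
  rewrite (_ : comb _ s = comb c'' s - comb c' s).
    by rewrite restr_rowB -ea addrAC subrr add0r.
  by rewrite -scaleN1r combZ combD; apply: eq_comb => i _; rewrite mulN1r.
move=> i; rewrite size_rcons ltnS leq_eqVlt => /orP [/eqP ->|hi] //.
apply: (IH c) => //.
(* Without constant term the last coefficient is x_1 [h] + x_2 [h'] modulo a_2, so its term can be
   moved to the right side and the induction on the family applies. *)
have e1 := restr_quo lt0l H0; set h := Xquo _ _ in e1.
have e1' : restr 1 (c (size s) - 'X_i0 * h) = 0 by rewrite rmorphB /= e1 subrr.
have := restr_quo l_ge2 e1'; set h' := Xquo _ _ => e2.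
exists (w - h *: v), (w' - h' *: v).
split; [by rewrite dotB dotZ v0 w0 mulr0 subrr|by rewrite dotB dotZ v0 w'0 mulr0 subrr|].
have e3 : restr 2 (c (size s)) = restr 2 ('X_i0 * h + 'X_i1 * h').
  by rewrite rmorphD /= -e2 -rmorphD /= addrC subrK.
rewrite -(addrK (c (size s) *: v) (comb c s)) restr_rowB ew restr_rowZ e3.
rewrite -restr_rowZ -restr_rowB; congr restr_row.
by rewrite !scalerBr !scalerA scalerDl opprD addrACA.
Qed.

(* Division by a variable that is a nonzerodivisor on the quotient: the
   multipliers lose a degree at each step. *)
Lemma descend k (hk : (k < l)%N) s (A : V -> Prop) :
  (forall c, A (comb c s) -> forall i, (i < size s)%N -> restr k (c i) = 0) ->
  (forall c c', A (comb c s) ->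
     (forall i, (i < size s)%N -> restr k.+1 (c i) = restr k.+1 ('X_(Ordinal hk) * c' i)) ->
     A (comb c' s)) ->
  forall c, A (comb c s) -> forall i, (i < size s)%N -> restr k.+1 (c i) = 0.
Proof.
move=> H0 HA c.
have [M] : exists M, forall i, (i < size s)%N -> (msize (restr k.+1 (c i)) <= M)%N.
  exists (\max_(i < size s) msize (restr k.+1 (c i)))%N => i hi.
  exact: (leq_bigmax (F := fun i : 'I_(size s) => msize (restr k.+1 (c i))) (Ordinal hi)).
elim: M c => [|M IH] c hM hc i hi.
  by apply/eqP; rewrite -msize_poly_eq0 -leqn0 hM.
pose c' j := Xquo (Ordinal hk) (restr k.+1 (c j)).
have ec' j : (j < size s)%N -> restr k.+1 (c j) = restr k.+1 ('X_(Ordinal hk) * c' j).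
  by move=> hj; apply: restr_quo; apply: H0 hj.
rewrite ec' // restrXMl //; apply/eqP; rewrite mulf_eq0 (negbTE (mpolyX_neq0 _ _)) /=.
apply/eqP; apply: (IH c') => // [j hj|]; last exact: HA hc ec'.
case: (eqVneq (restr k.+1 (c' j)) 0) => [->|nz]; first by rewrite msize0.
have := hM j hj; rewrite ec' // restrXMl // msizeM ?mpolyX_neq0 //.
by rewrite msizeX mdeg1.
Qed.

Lemma inX1_inX01 v : inX1 v -> inX01 v.
Proof.
move=> [w hw ew]; exists 0, w; split=> //; first by rewrite dot0.
by rewrite scaler0 add0r.
Qed.

Lemma restr_row_scaleXI k (i : 'I_l) u v : (i < k)%N ->
  restr_row k ('X_i *: u) = restr_row k ('X_i *: v) -> restr_row k u = restr_row k v.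
Proof.
move=> hi /matrixP H; apply/matrixP => a b; have := H a b.
by rewrite !mxE !restrXMl // => /mulXI.
Qed.

(** What has to be shown is that x_1 can be cancelled modulo x_2 N. If x_1 times a syzygy is a
    multiple of x_2 modulo a_2, the syzygy is itself x_2 [z] modulo a_2; this [z] is only a syzygy
    modulo a_2, and (L_2) replaces it by a true one. *)
Lemma greedy_step1 s c : greedy s -> inX1 (comb c s) ->
  forall i, (i < size s)%N -> restr 1 (c i) = 0.
Proof.
move=> hs; apply: (@descend 0 lt0l _ inX1).
  by move=> {}c /inX1_inX01; apply: greedy_step0.
rewrite -/i0 => {}c c' [w w0 ew] ec.
have ec1 i : (i < size s)%N -> restr 1 (c i - 'X_i0 * c' i) = 0.
  by move=> hi; rewrite rmorphB /= ec // subrr.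
pose c'' i := Xquo i1 (restr 2 (c i - 'X_i0 * c' i)).
have E : restr_row 2 ('X_i0 *: comb c' s) = restr_row 2 ('X_i1 *: (w - comb c'' s)).
  have E1 : restr_row 2 (comb c s) = restr_row 2 ('X_i0 *: comb c' s + 'X_i1 *: comb c'' s).
    rewrite !combZ combD; apply: restr_comb => i hi.
    have := restr_quo l_ge2 (ec1 i hi); rewrite -/i1 -/(c'' i) => e2.
    by rewrite rmorphD /= -e2 -rmorphD /= addrC subrK.
  rewrite -(addrK ('X_i1 *: comb c'' s) ('X_i0 *: comb c' s)) restr_rowB -E1 ew.
  by rewrite -restr_rowB -scalerBr.
have d0 : dot g (comb c' s) = 0 by apply: greedy_syz.
have R1 : restr_row 1 (comb c' s) = 0.
  have := restr_row_le (isT : (1 <= 2)%N) E.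
  rewrite restr_rowZ [RHS]restr_rowZ !restrX /= scale0r => /matrixP H.
  by apply/matrixP => a b; have := H a b; rewrite !mxE => /eqP;
    rewrite mulf_eq0 (negbTE (mpolyX_neq0 _ _)) => /eqP.
have eq := restr_quo_row l_ge2 R1; rewrite -/i1 in eq; set z := quo_row _ _ in eq.
have lift2 : syz_lift g 2 by apply: lift; rewrite l_ge2.
have dz : restr 2 (dot g z) = 0.
  apply: (@mulXI _ _ U_(i1)); rewrite mulr0 -restrXMl // -dotZ -(restr_dot g eq) d0.
  by rewrite rmorph0.
have [z' hz' ez'] := syz_lift_nonhomog g_homog lift2 dz.
by exists z' => //; rewrite eq !restr_rowZ ez'.
Qed.

Lemma greedy_indep s c k : (2 <= k <= l)%N -> greedy s -> restr_row k (comb c s) = 0 ->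
  forall i, (i < size s)%N -> restr k (c i) = 0.
Proof.
move=> /andP [hk hkl] hs; elim: k hk hkl c => // k IH; rewrite leq_eqVlt.
have HA (hkl : (k < l)%N) c c' : restr_row k.+1 (comb c s) = 0 ->
     (forall i, (i < size s)%N -> restr k.+1 (c i) = restr k.+1 ('X_(Ordinal hkl) * c' i)) ->
     restr_row k.+1 (comb c' s) = 0.
  move=> h0 /restr_comb; rewrite h0 -combZ => h.
  rewrite -(restr_row0 K l n k.+1); apply: (@restr_row_scaleXI _ (Ordinal hkl)) => //.
  by rewrite scaler0 restr_row0 -h.
case/orP => [/eqP [ek]|hk] hkl c;
  apply: (@descend k hkl s (fun v => restr_row k.+1 v = 0) _ (HA hkl)) => {}c hc.
  subst k; apply: greedy_step1 => //; exists 0; rewrite ?dot0 //.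
  by rewrite hc scaler0 restr_row0.
apply: IH => //; first exact: ltnW.
by rewrite (restr_row_le (k2 := k.+1) (v := 0)) ?restr_row0.
Qed.

(** This bound is what makes the greedy choice terminate: independence at [k = l] is plain
    independence over S. *)
Lemma greedy_size s : greedy s -> (size s <= n)%N.
Proof.
move=> hs; rewrite leqNgt; apply/negP => lt.
have [v v0 hv] := lin_dependent (\matrix_(i < size s) nth 0 s i) lt.
pose c i := if insub i is Some j then v 0 j else 0 : S.
have hc (i : 'I_(size s)) : c i = v 0 i by rewrite /c insubT //= => hi; congr (v _ _); apply: val_inj.
have e0 : comb c s = 0.
  rewrite -hv; apply/matrixP => a b; rewrite /comb summxE !mxE ord1.
  by apply: eq_bigr => i _; rewrite !mxE hc.
case/negP: v0; apply/eqP/matrixP => a i; rewrite ord1 mxE -hc.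
by rewrite -(restr_all (c i)) (@greedy_indep s c l) ?l_ge2 ?leqnn // e0 restr_row0.
Qed.

Lemma greedy_exists : exists2 s, greedy s &
  forall d v, homog_row d v -> dot g v = 0 -> spanned 2 s v.
Proof.
suff H r : exists2 s, greedy s & size s = r \/
    forall d v, homog_row d v -> dot g v = 0 -> spanned 2 s v.
  have [s hs [e1|]] := H n.+1; last by exists s.
  by have := greedy_size hs; rewrite e1 ltnn.
elim: r => [|r [s hs [e1|]]]; first by exists [::]; [constructor|left].
  case: (classic (exists d v, [/\ homog_row d v, dot g v = 0 & ~ spanned 2 s v])) => H.
    have [d [v [h1 h2 h3]] hmin] := least_nat H.
    exists (rcons s v); last by left; rewrite size_rcons e1.
    apply: (greedy_rcons (d := d)) => // d' w lt h4 h5; apply: NNPP => h6.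
    by apply: (hmin d' lt); exists w.
  exists s => //; right => d v h1 h2; apply: NNPP => h3; apply: H.
  by exists d, v.
by exists s => //; right.
Qed.

(** A graded Nakayama argument: after subtracting a combination valid modulo a_k, the remainder is
    x_(k+1) [w] modulo a_(k+1). By (L_(k+1)) [w] may be taken to be a syzygy, and its degree is
    smaller. *)
Lemma greedy_spans s : greedy s ->
  (forall d v, homog_row d v -> dot g v = 0 -> spanned 2 s v) ->
  forall k d v, (2 <= k <= l)%N -> homog_row d v -> dot g v = 0 -> spanned k s v.
Proof.
move=> hs H2 k d v /andP [hk hkl]; elim: k hk hkl d v => // k IH; rewrite leq_eqVlt.
case/orP => [/eqP [<-]|hk] hkl; first by move=> d v; apply: H2.
have {}IH d v : homog_row d v -> dot g v = 0 ->
    exists2 c, homog_row d (comb c s) & restr_row k v = restr_row k (comb c s).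
  move=> hv v0; have [c0 ec0] := IH hk (ltnW hkl) _ v hv v0.
  have [c ec] := greedy_pihomog c0 d hs; exists c.
    by rewrite -ec; apply: pihomog_row_homog.
  by rewrite -ec restr_pihomog_row -ec0 -restr_pihomog_row pihomog_row_id.
elim=> [|d IHd] v hv v0; have [c hc ec1] := IH _ v hv v0.
  by exists c; rewrite -(restr_row_homog0 k hv) ec1 (restr_row_homog0 k hc).
have hu : homog_row d.+1 (v - comb c s) by apply: homog_rowB.
have u0 : dot g (v - comb c s) = 0 by rewrite dotB v0 greedy_syz // subrr.
have ru : restr_row k (v - comb c s) = 0 by rewrite restr_rowB ec1 subrr.
have ew := restr_quo_row hkl ru; have hw := quo_row_homog hkl ru hu.
set w := quo_row _ _ in ew hw.
have dw : restr k.+1 (dot g w) = 0.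
  apply: (@mulXI _ _ U_(Ordinal hkl)); rewrite mulr0 -restrXMl // -dotZ.
  by rewrite -(restr_dot g ew) u0 rmorph0.
have lk : syz_lift g k.+1 by apply: lift; rewrite hkl ltnW.
have [w' [hw' w'0 ew']] := lk d w hw dw.
have [c' ec'] := spannedZ 'X_(Ordinal hkl) (IHd w' hw' w'0).
exists (fun i => c i + c' i); rewrite -combD restr_rowD -ec'.
by rewrite restr_rowZ ew' -restr_rowZ -ew restr_rowB addrC subrK.
Qed.

Lemma syz_free : exists r (T : 'M[S]_(r, n)),
  (forall c : 'rV_r, c *m T = 0 -> c = 0) /\
  (forall v, dot g v = 0 <-> exists c : 'rV_r, v = c *m T).
Proof.
have [s hs H2] := greedy_exists.
have T0 (c : nat -> S) : comb c s = (\row_i c i) *m (\matrix_(i < size s) nth 0 s i).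
  apply/matrixP => a b; rewrite /comb summxE !mxE ord1.
  by apply: eq_bigr => i _; rewrite !mxE.
exists (size s), (\matrix_(i < size s) nth 0 s i).
pose x (c : 'rV[S]_(size s)) (i : nat) : S := if insub i is Some j then c 0 j else 0.
have rowE (b : 'rV[S]_(size s)) : b = \row_i x b i.
  apply/matrixP => a j; rewrite ord1 mxE /x insubT //= => hj.
  by congr (b _ _); apply: val_inj.
split=> [c|v].
  rewrite {1}(rowE c) -T0 => h.
  rewrite (rowE c); apply/matrixP => a i; rewrite ord1 mxE [RHS]mxE.
  rewrite -(restr_all (x c i)).
  have h' : restr_row l (comb (x c) s) = 0 by rewrite h restr_row0.
  by apply: (greedy_indep _ hs h') => //; rewrite l_ge2 leqnn.
split=> [v0|[c ->]]; last by rewrite (rowE c) -T0; apply: greedy_syz.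
suff [c ec] : exists c, v = comb c s by exists (\row_i c i); rewrite -T0.
have [N eN] := pihomog_row_sum v; rewrite {1}eN; elim: N {eN} => [|N [c ec]].
  by exists (fun=> 0); rewrite big_ord0 /comb big1 // => i _; rewrite scale0r.
have ll : (2 <= l <= l)%N by rewrite l_ge2 leqnn.
have v0' := syz_pihomog g_homog N v0.
have [c' ec'] := greedy_spans hs H2 ll (pihomog_row_homog N v) v0'.
exists (fun i => c i + c' i); rewrite big_ord_recr /= ec -combD.
by rewrite -(restr_row_all (pihomog_row N v)) ec' restr_row_all.
Qed.

End FreeSyzygies.

(** * Free modules and matrices *)

Section FreeModules.
Variables (R : idomainType) (n : nat).
Implicit Types (D B : 'rV[R]_n -> Prop) (s : seq 'rV[R]_n).

Lemma independent_size B s :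
  (forall s : seq 'rV[R]_n, uniq s -> (forall v, v \in s -> B v) ->
     forall c : 'rV[R]_n -> R, \sum_(v <- s) c v *: v = 0 ->
       forall v, v \in s -> c v = 0) ->
  uniq s -> (forall v, v \in s -> B v) -> (size s <= n)%N.
Proof.
move=> ind us sB; rewrite leqNgt; apply/negP => lt.
have [b b0 hb] := lin_dependent (\matrix_(i < size s) nth 0 s i) lt.
pose c v := if insub (index v s) is Some j then b 0 j else 0 : R.
have cE (i : 'I_(size s)) : c (nth 0 s i) = b 0 i.
  by rewrite /c index_uniq // insubT //= => hi; congr (b _ _); apply: val_inj.
case/negP: b0; apply/eqP/matrixP => a i; rewrite ord1 mxE -cE.
apply: (ind s us sB) => //; last exact: mem_nth.
rewrite (big_nth 0) big_mkord; apply: etrans hb; rewrite mulmx_sum_row.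
by apply: eq_bigr => i' _; rewrite cE rowK.
Qed.

(** Independence bounds the size of finite subfamilies of the basis, so a largest one is the whole
    basis. Zero rows fill the matrix up to a square one, which keeps the row span and makes
    determinants available. *)
Lemma free_module_matrix D : is_free_module D ->
  exists T : 'M[R]_n, forall d, D d <-> exists c : 'rV_n, d = c *m T.
Proof.
move=> [B [ind span]].
pose good s := uniq s /\ (forall v, v \in s -> B v).
have [s [us sB] smax] : exists2 s, good s & forall s', good s' -> (size s' <= size s)%N.
  have [|k [s [hs es]] kmin] := @least_nat (fun k => exists s, good s /\ (n - size s)%N = k).
    by exists n, [::]; rewrite subn0.
  exists s => // s' hs'; rewrite leqNgt; apply/negP => lt.
  apply: (kmin (n - size s')%N); last by exists s'.
  rewrite -es ltn_sub2l //; case: hs' => u' b'.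
  exact: leq_trans lt (independent_size ind u' b').
have hn := independent_size ind us sB.
pose T : 'M[R]_n := \matrix_(i < n) nth 0 s i.
have sT v : v \in s -> exists c : 'rV_n, v = c *m T.
  move=> hv; have hi : (index v s < n)%N by apply: leq_trans hn; rewrite index_mem.
  exists (delta_mx 0 (Ordinal hi)); rewrite -rowE rowK nth_index //.
exists T => d; split.
  move/span => [s' [c [hs' ->]]].
  elim: s' hs' => [|v s' IH] hs'; first by exists 0; rewrite big_nil mul0mx.
  have [|b eb] := IH; first by move=> w hw; apply: hs'; rewrite inE hw orbT.
  have hv : v \in s.
    apply/negPn/negP => hv; have := smax (v :: s); rewrite /= ltnn => /(_ _) H.
    suff : false by []; apply: H; split; first by rewrite /= hv.
    by move=> w; rewrite inE => /orP [/eqP ->|/sB //]; apply: hs'; rewrite inE eqxx.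
  have [b' eb'] := sT v hv; exists (c v *: b' + b).
  by rewrite big_cons eb mulmxDl -scalemxAl -eb'.
move=> [c ->]; apply/span.
pose x i := if insub i is Some j then c 0 j else 0 : R.
exists s, (fun v => x (index v s)); split=> //.
rewrite (big_nth 0) mulmx_sum_row.
rewrite (eq_bigr (fun i : 'I_n => x i *: nth 0 s i)); last first.
  by move=> i _; rewrite rowK /x insubT //= => hi; congr (c _ _ *: _); apply: val_inj.
rewrite -(big_mkord predT (fun i => x i *: nth 0 s i)) (big_cat_nat _ hn) //=.
rewrite [X in _ + X]big_nat_cond [X in _ + X]big1 ?addr0; last first.
  by move=> i /andP [/andP [hi _] _]; rewrite nth_default ?scaler0.
by rewrite !big_nat; apply: eq_bigr => i /andP [_ hi]; rewrite index_uniq.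
Qed.

Lemma matrix_free_module r (T : 'M[R]_(r, n)) D :
  (forall c : 'rV_r, c *m T = 0 -> c = 0) ->
  (forall d, D d <-> exists c : 'rV_r, d = c *m T) -> is_free_module D.
Proof.
move=> ind span; exists (fun v => exists i, v = row i T).
have row_inj : injective (fun i => row i T).
  move=> i j; rewrite /= !rowE => e1.
  have := ind (delta_mx 0 i - delta_mx 0 j); rewrite mulmxBl e1 subrr => /(_ erefl).
  move=> /matrixP /(_ 0 i); rewrite !mxE !eqxx /=; case: (i =P j) => // _.
  by rewrite subr0 => /eqP; rewrite oner_eq0.
split=> [s us sB c h v hv|d].
  pose cc : 'rV_r := \row_i if row i T \in s then c (row i T) else 0.
  have cc0 : cc = 0.
    apply: ind; rewrite -h mulmx_sum_row.
    have P : perm_eq s [seq row i T | i <- enum 'I_r & row i T \in s].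
      apply: uniq_perm => //.
        by rewrite map_inj_uniq // filter_uniq // enum_uniq.
      move=> w; apply/idP/mapP => [hw|[i]]; last by rewrite mem_filter => /andP [hi _] ->.
      have [i ei] := sB w hw; exists i => //.
      by rewrite mem_filter mem_enum -ei hw.
    rewrite (perm_big _ P) big_map big_filter big_enum_cond [RHS]big_mkcond /=.
    apply: eq_bigr => i _; rewrite mxE; case: ifP => // _; by rewrite scale0r.
  have [i ei] := sB v hv; have := congr1 (fun M : 'rV_r => M 0 i) cc0.
  by rewrite !mxE -ei hv.
split=> [/span [c ->]|[s [c [hs ->]]]].
  pose x v := if [pick i | row i T == v] is Some i then c 0 i else 0 : R.
  exists [seq row i T | i <- enum 'I_r], x; split.
    by move=> v /mapP [i _ ->]; exists i.
  rewrite mulmx_sum_row big_map big_enum /=; apply: eq_bigr => i _.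
  rewrite /x; case: pickP => [j /eqP /row_inj -> //|/(_ i)].
  by rewrite eqxx.
apply/span; elim: s hs => [|v s IH] hs; first by exists 0; rewrite big_nil mul0mx.
have [|b eb] := IH; first by move=> w hw; apply: hs; rewrite inE hw orbT.
have [|i ei] := hs v; first by rewrite inE eqxx.
by exists (c v *: delta_mx 0 i + b); rewrite big_cons mulmxDl -scalemxAl -rowE -ei eb.
Qed.

End FreeModules.

(** * From generators of D(A) to the lifting of syzygies modulo a_2 *)

Section LiftFromMatrix.
Variables (K : fieldType) (l n e : nat).
Local Notation S := {mpoly K[l]}.
Local Notation V := 'rV[S]_n.
Variable g : V.
Hypothesis g_homog : forall i, g 0 i \is e.-homog.
Hypothesis l_ge2 : (2 <= l)%N.
Let i1 : 'I_l := Ordinal l_ge2.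

(** [restr 1 f != 0] says that x_2 does not divide [f] modulo a_2. As x_2 is prime there, its powers
    pass to [b] one at a time. *)
Lemma Xn_dvd N (a b f : S) : restr 1 f != 0 -> restr 2 b = b ->
  'X_i1 ^+ N * a = f * b -> exists2 c, b = 'X_i1 ^+ N * c & restr 2 c = c.
Proof.
move=> hf; elim: N b => [|N IH] b hb E; first by exists b; rewrite // expr0 mul1r.
have hb1 : restr 1 b = 0.
  have := congr1 (restr 1) E; rewrite !rmorphM /= rmorphXn /= restrX /= expr0n mul0r.
  by move/esym/eqP; rewrite mulf_eq0 (negbTE hf) => /eqP.
have := restr_quo l_ge2 hb1; rewrite hb restrXMl // -/i1; set c := restr 2 _ => ec.
have [|| c' ec' hc'] := IH c.
- by rewrite /c restr_id.
- by apply: (@mulXI _ _ U_(i1)); rewrite mulrA -exprS E ec mulrCA.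
by exists c' => //; rewrite ec ec' mulrA -exprS.
Qed.

Lemma scaleXnI N (u v : V) : 'X_i1 ^+ N *: u = 'X_i1 ^+ N *: v -> u = v.
Proof.
move=> /matrixP H; apply/matrixP => a b; have := H a b; rewrite !mxE.
by apply: mulfI; apply: expf_neq0; apply: mpolyX_neq0.
Qed.

Lemma nonhomog_syz_lift k :
  (forall u, restr k (dot g u) = 0 -> exists2 v, dot g v = 0 & restr_row k v = restr_row k u) ->
  syz_lift g k.
Proof.
move=> H d u hu h; have [v v0 ev] := H u h; exists (pihomog_row d v); split.
- exact: pihomog_row_homog.
- exact: (syz_pihomog g_homog).
by rewrite restr_pihomog_row ev -restr_pihomog_row pihomog_row_id.
Qed.

Variables (T : 'M[S]_n) (q : S) (theta h1 h2 : V) (N : nat).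
Hypothesis T_log : forall c : 'rV_n, exists h, dot g (c *m T) = h * q.
Hypothesis log_T : forall u h, dot g u = h * q -> exists c : 'rV_n, u = c *m T.
Hypothesis theta_q : dot g theta = q.
Hypothesis q_neq0 : restr 2 q != 0.
Hypothesis h1_neq0 : restr 1 (dot g h1) != 0.
Hypothesis h2_Xn : restr 2 (dot g h2) = 'X_i1 ^+ N.

(* Modulo x_3, ..., x_l: for f in the ideal, f u is a combination of the rows
   of T, because f u - <u, g> h is a syzygy when f = <h, g>.  Two coprime such
   f then give u itself, as T stays injective. *)
Lemma matrix_syz_lift : syz_lift g 2.
Proof.
(* Pairing [q *: delta_mx 0 i] with [g] gives a multiple of [q], so this row is a combination of the
   rows of [T]. Hence some matrix times [T] equals [q%:M], and since [restr 2 q] is nonzero the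
   determinant of [T] survives restriction. *)
have inj (c : V) : c *m map_mx (restr 2) T = 0 -> c = 0.
  have rows i : exists c : V, q *: delta_mx 0 i = c *m T.
    apply: (log_T (h := g 0 i)); rewrite dotZ mulrC; congr (_ * _).
    rewrite /dot (bigD1 i) //= !mxE !eqxx mul1r big1 ?addr0 // => j ji.
    by rewrite mxE eqxx (negbTE ji) mul0r.
  have [C hC] := fin_all_exists rows.
  move=> hc; apply/eqP/negPn/negP => c0.
  have dT : \det (map_mx (restr 2) T) = 0 by apply/eqP/det0P; exists c.
  have eC : (\matrix_i C i) *m T = q%:M.
    by apply/row_matrixP => i; rewrite row_mul rowK -hC [RHS]rowE mul_mx_scalar.
  have := congr1 (fun M => \det (map_mx (restr 2) M)) eC.
  rewrite map_mxM det_mulmx dT mulr0 map_scalar_mx det_scalar => /esym/eqP.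
  by rewrite expf_eq0 (negbTE q_neq0) andbF.
apply: nonhomog_syz_lift => u hu.
have key h : exists r : V, restr 2 (dot g h) *: restr_row 2 u = restr_row 2 r *m map_mx (restr 2) T.
  have [|r er] := @log_T (dot g h *: u - dot g u *: h) 0.
    by rewrite dotB !dotZ mulrC subrr mul0r.
  exists r; rewrite -map_mxM -/(restr_row 2 _) -er restr_rowB !restr_rowZ hu.
  by rewrite scale0r subr0.
have [r1 e1] := key h1; have [r2 e2] := key h2; rewrite h2_Xn in e2.
have E : 'X_i1 ^+ N *: restr_row 2 r1 = restr 2 (dot g h1) *: restr_row 2 r2.
  apply/eqP; rewrite -subr_eq0; apply/eqP; apply: inj.
  by rewrite mulmxBl -!scalemxAl -e1 -e2 !scalerA mulrC subrr.
have D j : exists c, restr_row 2 r2 0 j = 'X_i1 ^+ N * c /\ restr 2 c = c.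
  have [|||c ec hc] := @Xn_dvd N (restr_row 2 r1 0 j) (restr_row 2 r2 0 j) (restr 2 (dot g h1)).
  - by rewrite restr_restr.
  - by rewrite mxE restr_id.
  - by have := congr1 (fun M : V => M 0 j) E; rewrite !mxE.
  by exists c.
have [C hC] := fin_all_exists D; pose r := \row_j C j : V.
have er2 : restr_row 2 r2 = 'X_i1 ^+ N *: r.
  by apply/matrixP => a j; rewrite ord1 [RHS]mxE; have [-> _] := hC j; rewrite mxE.
have er : restr_row 2 r = r.
  by apply/matrixP => a j; rewrite ord1 !mxE; have [_ ->] := hC j.
have eu : restr_row 2 u = restr_row 2 (r *m T).
  rewrite {2}/restr_row map_mxM -/(restr_row 2 r) er.
  apply: (@scaleXnI N); rewrite e2 er2 scalemxAl //.
(* [r *m T] restricts to [u] but is only logarithmic: its product with [g] is [h * q]. That product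
   vanishes modulo a_2 and [q] does not, so [h] does, and subtracting [h *: theta] yields a syzygy
   with the same restriction. *)
have [h eh] := T_log r.
have h0 : restr 2 h = 0.
  have := restr_dot g eu; rewrite hu eh rmorphM /= => /esym/eqP.
  by rewrite mulf_eq0 (negbTE q_neq0) orbF => /eqP.
exists (r *m T - h *: theta); first by rewrite dotB dotZ eh theta_q subrr.
by rewrite restr_rowB restr_rowZ h0 scale0r subr0 -eu.
Qed.

End LiftFromMatrix.

(** * Linear forms and linear changes of coordinates *)

Section MpolyMorphisms.
Variables (K : fieldType) (l : nat).
Local Notation S := {mpoly K[l]}.

Lemma mpoly_rmorph_eq (A : comNzRingType) (f h : {rmorphism S -> A}) :
  (forall c, f c%:MP = h c%:MP) -> (forall i, f 'X_i = h 'X_i) -> f =1 h.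
Proof.
move=> eC eX p; rewrite [p]mpolyE !rmorph_sum; apply: eq_bigr => m _.
rewrite -mul_mpolyC !rmorphM eC; congr (_ * _).
rewrite mpolyXE_id !rmorph_prod; apply: eq_bigr => i _.
by rewrite !rmorphXn /= eX.
Qed.

Definition mdvd (p f : S) := exists c, f = c * p.

Lemma mdvd0 p : mdvd p 0. Proof. by exists 0; rewrite mul0r. Qed.
Lemma mdvdD p f h : mdvd p f -> mdvd p h -> mdvd p (f + h).
Proof. by move=> [a ->] [b ->]; exists (a + b); rewrite mulrDl. Qed.
Lemma mdvdMl p f h : mdvd p f -> mdvd p (h * f).
Proof. by move=> [a ->]; exists (h * a); rewrite mulrA. Qed.
Lemma mdvdMr p f h : mdvd p f -> mdvd p (f * h).
Proof. by rewrite mulrC; apply: mdvdMl. Qed.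
Lemma mdvdB p f h : mdvd p f -> mdvd p h -> mdvd p (f - h).
Proof. by move=> hf hh; apply: mdvdD => //; rewrite -mulN1r; apply: mdvdMl. Qed.

Lemma mdvd_sum p (I : Type) (r : seq I) (P : pred I) F :
  (forall i, P i -> mdvd p (F i)) -> mdvd p (\sum_(i <- r | P i) F i).
Proof. by move=> H; apply: (big_ind (mdvd p)) => //; [apply: mdvd0|apply: mdvdD]. Qed.

Lemma ideal_span_mdvd p f : ideal_span (eq p) f <-> mdvd p f.
Proof.
split=> [[s [hs ->]]|[c ->]].
  rewrite big_seq; apply: mdvd_sum => x /hs <-; by exists x.1.
exists [:: (c, p)]; split; last by rewrite big_seq1.
by move=> x; rewrite mem_seq1 => /eqP ->.
Qed.

Lemma mdeg_eq1_U (m : 'X_{1..l}) : mdeg m = 1%N -> exists i, m = U_(i)%MM.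
Proof. by move/eqP/mdeg1P => [i /eqP ->]; exists i. Qed.

Lemma linear_formE (p : S) : p \is 1.-homog -> p = \sum_i p@_U_(i) *: 'X_i.
Proof.
move=> hp; apply/mpolyP => m; rewrite linear_sum /=.
case: (mdeg m =P 1%N) => [/mdeg_eq1_U [i ->]|/eqP hm].
  rewrite (bigD1 i) //= mcoeffZ mcoeffXU eqxx mulr1 big1 ?addr0 // => j ji.
  by rewrite mcoeffZ mcoeffXU (negbTE ji) mulr0.
rewrite (mcoeff_homog0 hp) // big1 // => i _; rewrite mcoeffZ mcoeffX.
by case: eqP => [e|]; rewrite ?mulr0 //; rewrite -e mdeg1 in hm.
Qed.

Lemma linear_form_neq0 (p : S) : p \is 1.-homog -> p != 0 -> exists i, p@_U_(i) != 0.
Proof.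
move=> hp p0; apply/existsP; apply: contraNT p0; rewrite negb_exists => /forallP H.
rewrite (linear_formE hp) big1 // => i _; have := H i; rewrite negbK => /eqP ->.
by rewrite scale0r.
Qed.

(** With [a] the nonzero coefficient of x_j in [p], the substitution x_j -> x_j - p / a kills [p]
    and is the identity modulo [p]. Its kernel is therefore generated by [p], and its target is a
    domain. *)
Lemma linear_form_prime (p f h : S) : p \is 1.-homog -> p != 0 ->
  mdvd p (f * h) -> mdvd p f \/ mdvd p h.
Proof.
move=> hp p0; have [j hj] := linear_form_neq0 hp p0; set a := p@_U_(j) in hj.
pose tp := [tuple 'X_i - (if i == j then a^-1 *: p else 0) | i < l].
pose sg (x : S) : S := x \mPo tp.
have sgX i : sg 'X_i = 'X_i - (if i == j then a^-1 *: p else 0).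
  by rewrite /sg comp_mpolyXU -tnth_nth tnth_mktuple.
have sgM x y : sg (x * y) = sg x * sg y by rewrite /sg rmorphM.
have sgD x y : sg (x + y) = sg x + sg y by rewrite /sg rmorphD.
have dM x y : mdvd p (x - sg x) -> mdvd p (y - sg y) -> mdvd p (x * y - sg (x * y)).
  move=> hx hy; have -> : x * y - sg (x * y) = (x - sg x) * y + sg x * (y - sg y).
    by rewrite sgM mulrBl mulrBr addrA subrK.
  by apply: mdvdD; [apply: mdvdMr|apply: mdvdMl].
have dC c : mdvd p (c%:MP - sg c%:MP) by rewrite /sg comp_mpolyC subrr; apply: mdvd0.
have dX i : mdvd p ('X_i - sg 'X_i).
  rewrite sgX opprB addrC subrK; case: eqP => _; last exact: mdvd0.
  by exists (a^-1)%:MP; rewrite mul_mpolyC.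
have d x : mdvd p (x - sg x).
  rewrite [x]mpolyE; apply: (big_ind (fun x => mdvd p (x - sg x))) => [||m _].
  - by rewrite /sg comp_mpoly0 subrr; apply: mdvd0.
  - by move=> y z hy hz; rewrite sgD opprD addrACA; apply: mdvdD.
  rewrite -mul_mpolyC; apply: (dM) => //; rewrite mpolyXE_id.
  apply: (big_ind (fun x => mdvd p (x - sg x))) => [||i _] //.
  - exact: (dC 1).
  elim: (m i) => [|k IH]; first exact: (dC 1).
  by rewrite exprS; apply: dM.
have sgp : sg p = 0.
  rewrite {1}(linear_formE hp) /sg linear_sum /=.
  transitivity (\sum_i p@_U_(i) *: ('X_i - (if i == j then a^-1 *: p else 0))).
    by apply: eq_bigr => i _; rewrite linearZ /= -/(sg 'X_i) sgX.
  under eq_bigr do rewrite scalerBr.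
  rewrite big_split /= -linear_formE // sumrN (bigD1 j) //= eqxx scalerA mulfV //.
  rewrite scale1r big1 ?addr0 ?subrr // => i ij; by rewrite (negbTE ij) scaler0.
have K0 x : sg x = 0 -> mdvd p x by move=> h0; have := d x; rewrite h0 subr0.
move=> [c ec]; have : sg f * sg h = 0 by rewrite -sgM ec sgM sgp mulr0.
by move/eqP; rewrite mulf_eq0 => /orP [/eqP /K0|/eqP /K0]; [left|right].
Qed.

Lemma linear_form_prime_prod (p : S) (I : eqType) (r : seq I) (P : pred I) F :
  p \is 1.-homog -> p != 0 -> (forall i, P i -> ~ mdvd p (F i)) ->
  ~ mdvd p (\prod_(i <- r | P i) F i).
Proof.
move=> hp p0 H; apply: (big_ind (fun x => ~ mdvd p x)) => //.
  move=> [c ec]; have [i hi] := linear_form_neq0 hp p0.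
  have := congr1 (comp_mpoly [tuple (0 : S) | i < l]) ec.
  rewrite rmorph1 rmorphM /= [X in _ * X](_ : _ = 0) ?mulr0 => [/eqP|].
    by rewrite oner_eq0.
  rewrite (linear_formE hp) linear_sum big1 //= => k _.
  by rewrite linearZ /= comp_mpolyXU -tnth_nth tnth_mktuple scaler0.
by move=> x y hx hy /(linear_form_prime hp p0) [].
Qed.

Variable g : 'M[K]_l.
Local Notation phi := (change_coords g).
HB.instance Definition _ := GRing.RMorphism.copy phi
  (@comp_mpoly l K l [tuple \sum_(j < l) g i j *: 'X_j | i < l]).
HB.instance Definition _ := GRing.Linear.copy phi
  (@comp_mpoly l K l [tuple \sum_(j < l) g i j *: 'X_j | i < l]).

Lemma change_coordsX i : phi 'X_i = \sum_j g i j *: 'X_j.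
Proof. by rewrite /change_coords comp_mpolyXU -tnth_nth tnth_mktuple. Qed.

Lemma change_coordsC c : phi c%:MP = c%:MP.
Proof. by rewrite /change_coords comp_mpolyC. Qed.

Lemma change_coords_homog d p : p \is d.-homog -> phi p \is d.-homog.
Proof.
move=> hp; rewrite [p]mpolyE [phi _]linear_sum big_seq; apply: rpred_sum => m hm.
rewrite linearZ /=; apply: rpredZ; rewrite -(msupp_homog hp hm) mpolyXE_id rmorph_prod /=.
rewrite mdegE; apply: (big_ind2 (fun p (k : nat) => p \is k.-homog)) => [||i _].
- exact: dhomog1.
- by move=> p1 k1 p2 k2; apply: dhomogM.
rewrite rmorphXn /=; rewrite -{2}(mul1n (m i)); apply: dhomogMn.
rewrite change_coordsX; apply: rpred_sum => j _; apply: rpredZ.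
by rewrite dhomogX; apply/eqP; exact: mdeg1.
Qed.

End MpolyMorphisms.

Lemma change_coords_comp (K : fieldType) l (g h : 'M[K]_l) (f : {mpoly K[l]}) :
  change_coords h (change_coords g f) = change_coords (g *m h) f.
Proof.
move: f; apply: (mpoly_rmorph_eq (f := change_coords h \o change_coords g)) => [c|i] /=.
  by rewrite !change_coordsC.
rewrite !change_coordsX linear_sum /=.
under eq_bigr => j _ do rewrite linearZ /= change_coordsX scaler_sumr.
rewrite exchange_big; apply: eq_bigr => k _; rewrite mxE scaler_suml.
by apply: eq_bigr => j _; rewrite scalerA.
Qed.

Lemma change_coords1 (K : fieldType) l (f : {mpoly K[l]}) : change_coords 1%:M f = f.
Proof.
move: f; apply: (mpoly_rmorph_eq (f := change_coords 1%:M) (h := idfun)) => [c|i] /=.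
  by rewrite change_coordsC.
rewrite change_coordsX (bigD1 i) //= mxE eqxx scale1r big1 ?addr0 // => j ji.
by rewrite mxE eq_sym (negbTE ji) scale0r.
Qed.

Lemma change_coordsK (K : fieldType) l (g : 'M[K]_l) : g \in unitmx ->
  cancel (change_coords g) (change_coords (invmx g)).
Proof. by move=> hg f; rewrite change_coords_comp mulmxV // change_coords1. Qed.

Lemma change_coordsVK (K : fieldType) l (g : 'M[K]_l) : g \in unitmx ->
  cancel (change_coords (invmx g)) (change_coords g).
Proof. by move=> hg f; rewrite change_coords_comp mulVmx // change_coords1. Qed.

(** * Logarithmic derivations *)

Section Leibniz.
Variables (K : fieldType) (l : nat).
Local Notation S := {mpoly K[l]}.
Implicit Types (d : 'rV[S]_l) (p q : S).

Lemma derivationM d p q : derivation d (p * q) = derivation d p * q + p * derivation d q.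
Proof.
rewrite /derivation mulr_suml mulr_sumr -big_split; apply: eq_bigr => i _.
by rewrite mderivM mulrDr /= !mulrA [p * _]mulrC.
Qed.

Lemma derivation1 d : derivation d 1 = 0.
Proof. by rewrite /derivation big1 // => i _; rewrite -mpolyC1 mderivC mulr0. Qed.

Lemma derivation_prod d n (F : 'I_n -> S) :
  derivation d (\prod_i F i) = \sum_i derivation d (F i) * \prod_(j | j != i) F j.
Proof.
suff H (r : seq 'I_n) : uniq r -> derivation d (\prod_(i <- r) F i) =
    \sum_(i <- r) derivation d (F i) * \prod_(j <- r | j != i) F j.
  by rewrite H // index_enum_uniq.
elim: r => [|a r IH]; first by rewrite !big_nil derivation1.
move=> /andP [ar ur]; rewrite !big_cons derivationM IH // eqxx /=.
congr (_ * _ + _).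
  rewrite big_seq [RHS]big_seq_cond; apply: eq_bigl => i.
  by case: (boolP (i \in r)) => // ir; rewrite andTb; apply/esym; apply: contraNneq ar => <-.
rewrite mulr_sumr !big_seq; apply: eq_bigr => i ir.
rewrite big_cons ifT; last by apply: contraNneq ar => ->.
by rewrite mulrCA.
Qed.

Lemma derivation_linear_form d p : p \is 1.-homog ->
  derivation d p = \sum_i p@_U_(i) *: d 0 i.
Proof.
move=> hp; apply: eq_bigr => i _; rewrite -mul_mpolyC mulrC; congr (_ * _).
apply/mpolyP => m; rewrite mcoeff_mderiv mcoeffC; case: eqP => [->|/eqP hm].
  by rewrite add0m mnm0E mulr1.
rewrite mulr0 (mcoeff_homog0 hp) ?mul0rn // mdegD mdeg1 addn1 eqSS mdeg_eq0.
by [].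
Qed.

Definition gradient p : 'rV[S]_l := \row_i p^`M(i).

Lemma derivation_dot d p : derivation d p = dot (gradient p) d.
Proof. by apply: eq_bigr => i _; rewrite mxE. Qed.

Definition euler : 'rV[S]_l := \row_i 'X_i.

Lemma mderiv_homog p k (i : 'I_l) : p \is k.-homog -> p^`M(i) \is k.-1.-homog.
Proof.
move=> hp; apply/dhomogP => m; rewrite mcoeff_msupp mcoeff_mderiv => h.
have : (m + U_(i))%MM \in msupp p.
  by rewrite mcoeff_msupp; apply: contraNneq h => ->; rewrite mul0rn.
by move/(msupp_homog hp); rewrite mdegD mdeg1 addn1 => <-.
Qed.

End Leibniz.

Section Arrangement.
Variables (K : fieldType) (charK : [pchar K] =i pred0).
Variables (l : nat) (l_ge2 : (2 <= l)%N) (n : nat).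
Variables (H : 'I_n -> {vspace 'rV[K]_l}) (arrH : central_arrangement H).
Variables (alpha : 'I_n -> {mpoly K[l]}) (defH : defining_forms H alpha).
Local Notation S := {mpoly K[l]}.
Let Q : S := defining_poly alpha.

Lemma alpha_homog i : alpha i \is 1.-homog.
Proof. by case: (defH i). Qed.

Lemma alpha_neq0 i : alpha i != 0.
Proof.
apply/eqP => a0; have [_ dimH] := arrH; have := dimH i.
have -> : H i = fullv.
  apply/vspaceP => v; rewrite memvf; have [_ h] := defH i; apply/h.
  by rewrite a0 meval0.
rewrite dimvf /dim /= mul1n => e1; have := ltn_predL l.
by rewrite -e1 ltnn (ltnW l_ge2).
Qed.

Lemma alpha_not_dvd i j : i != j -> ~ mdvd (alpha j) (alpha i).
Proof.
move=> ij [c ec]; have [Hinj dimH] := arrH; case/eqP: ij; apply: Hinj.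
apply/esym/eqP; rewrite eqEdim !dimH leqnn andbT; apply/subvP => v.
have [_ hi] := defH i; have [_ hj] := defH j.
by move=> /hj vj; apply/hi; rewrite ec mevalM vj mulr0.
Qed.

Lemma derivation_Q d :
  derivation d Q = \sum_i derivation d (alpha i) * \prod_(j | j != i) alpha j.
Proof. exact: derivation_prod. Qed.

(** Modulo [alpha j] the Leibniz rule leaves one summand of the derivative of Q, the derivative of
    [alpha j] times the product of the other forms. The prime [alpha j] divides none of these. *)
Lemma log_derivationsP d :
  log_derivations alpha d <-> exists h, derivation d Q = h * Q.
Proof.
split=> [hd|hd j].
  have [c hc] : exists c : 'I_n -> S, forall i, derivation d (alpha i) = c i * alpha i.
    apply: (@fin_all_exists _ _ (fun i x => derivation d (alpha i) = x * alpha i)) => i.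
    by apply/ideal_span_mdvd/hd.
  exists (\sum_i c i); rewrite derivation_Q mulr_suml; apply: eq_bigr => i _.
  by rewrite hc -mulrA /Q /defining_poly [in RHS](bigD1 i).
apply/ideal_span_mdvd.
have hp := alpha_homog j; have p0 := alpha_neq0 j.
have dQ : mdvd (alpha j) Q.
  by rewrite /Q /defining_poly (bigD1 j) //=; apply: mdvdMr; exists 1; rewrite mul1r.
have : mdvd (alpha j) (derivation d (alpha j) * \prod_(i | i != j) alpha i).
  have -> : derivation d (alpha j) * \prod_(i | i != j) alpha i = derivation d Q -
      \sum_(i | i != j) derivation d (alpha i) * \prod_(k | k != i) alpha k.
    by rewrite derivation_Q [in RHS](bigD1 j) //= addrK.
  apply: mdvdB; first by case: hd => h ->; apply: mdvdMl.
  apply: mdvd_sum => i ij; apply: mdvdMl; rewrite (bigD1 j) 1?eq_sym //=.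
  by apply: mdvdMr; exists 1; rewrite mul1r.
case/(linear_form_prime hp p0) => // /linear_form_prime_prod; case=> //.
by move=> i ij; apply: alpha_not_dvd.
Qed.

Lemma Q_homog : Q \is n.-homog.
Proof.
suff : Q \is (\sum_(i < n) 1)%N.-homog by rewrite sum1_card card_ord.
rewrite /Q /defining_poly.
apply: (big_ind2 (fun p (k : nat) => p \is k.-homog)) => [||i _].
- exact: dhomog1.
- by move=> p1 k1 p2 k2; apply: dhomogM.
exact: alpha_homog.
Qed.

Lemma derivation_euler : derivation (euler K l) Q = n%:R * Q.
Proof.
rewrite derivation_Q; transitivity (\sum_(i < n) Q); last by rewrite sumr_const card_ord mulr_natl.
apply: eq_bigr => i _; rewrite /Q /defining_poly [in RHS](bigD1 i) //=; congr (_ * _).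
rewrite derivation_linear_form ?alpha_homog // [RHS]linear_formE ?alpha_homog //.
by apply: eq_bigr => j _; rewrite mxE.
Qed.

Lemma natK_neq0 : (0 < n)%N -> n%:R != 0 :> K.
Proof. by move=> n0; rewrite (proj1 (pcharf0P K) charK) -lt0n. Qed.

Lemma Q_neq0 : Q != 0.
Proof. by apply/prodf_neq0 => i _; apply: alpha_neq0. Qed.

Definition euler_Q : 'rV[S]_l := (n%:R^-1)%:MP *: euler K l.

Lemma dot_euler_Q : (0 < n)%N -> dot (gradient Q) euler_Q = Q.
Proof.
move=> n0; rewrite dotZ -derivation_dot derivation_euler mulrA -mpolyC_nat -mpolyCM.
by rewrite mulVf ?natK_neq0 // mpolyC1 mul1r.
Qed.

(** For [n > 0] in characteristic zero, Euler's formula puts Q in the ideal of its partial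
    derivatives. *)
Lemma jacobian_idealP f : (0 < n)%N ->
  jacobian_ideal alpha f <-> exists u, f = dot (gradient Q) u.
Proof.
move=> n0; split=> [[s [hs ->]]|[u ->]].
  elim: s hs => [|x s IH] hs; first by exists 0; rewrite big_nil dot0.
  have [|u eu] := IH; first by move=> y hy; apply: hs; rewrite inE hy orbT.
  rewrite big_cons eu; have [|->|[i ->]] := hs x; first by rewrite inE eqxx.
    by exists (x.1 *: euler_Q + u); rewrite dotD dotZ dot_euler_Q.
  exists (x.1 *: delta_mx 0 i + u); rewrite dotD dotZ; congr (_ * _ + _).
  rewrite /dot (bigD1 i) //= !mxE !eqxx mul1r big1 ?addr0 // => j ji.
  by rewrite mxE eqxx (negbTE ji) mul0r.
exists [seq (u 0 i, Q^`M(i)) | i <- enum 'I_l]; split.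
  by move=> x /mapP [i _ ->]; right; exists i.
by rewrite big_map big_enum /=; apply: eq_bigr => i _; rewrite mxE.
Qed.

Lemma free_arrangement0 : n = 0%N -> free_arrangement alpha.
Proof.
move=> n0; apply: (matrix_free_module (T := 1%:M)).
  by move=> c; rewrite mulmx1.
move=> d; split=> [_|_ j]; first by exists d; rewrite mulmx1.
by have := ltn_ord j; rewrite {2}n0.
Qed.

Section Coordinates.
Variables (n0 : (0 < n)%N) (g : 'M[K]_l) (gU : g \in unitmx).
Local Notation phi := (change_coords g).
Local Notation psi := (change_coords (invmx g)).

(** The change of coordinates acts on the entries only; the components still belong to the old axes.
    For invertible [g] this differs from the gradient of [phi Q] by an invertible constant matrix,
    so the ideal spanned is the same. *)
Definition grad_g : 'rV[S]_l := map_mx phi (gradient Q).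

Lemma grad_g_homog i : grad_g 0 i \is n.-1.-homog.
Proof.
by rewrite !mxE; apply: change_coords_homog; apply: mderiv_homog; apply: Q_homog.
Qed.

Lemma dot_phi u : dot grad_g (map_mx phi u) = phi (dot (gradient Q) u).
Proof. by rewrite /dot [phi _]rmorph_sum; apply: eq_bigr => i _; rewrite !mxE rmorphM. Qed.

Lemma phi_psi a b (A : 'M[S]_(a, b)) : map_mx phi (map_mx psi A) = A.
Proof. by apply/matrixP => i j; rewrite !mxE change_coordsVK. Qed.

Lemma psi_phi a b (A : 'M[S]_(a, b)) : map_mx psi (map_mx phi A) = A.
Proof. by apply/matrixP => i j; rewrite !mxE change_coordsK. Qed.

Lemma phi_inj : injective phi.
Proof. exact: can_inj (change_coordsK gU). Qed.

Lemma change_coords_idealP f :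
  change_coords_ideal g (jacobian_ideal alpha) f <-> exists u, f = dot grad_g u.
Proof.
split=> [[f' /(jacobian_idealP _ n0) [u ->] ->]|[u ->]].
  by exists (map_mx phi u); rewrite dot_phi.
exists (dot (gradient Q) (map_mx psi u)); last by rewrite -dot_phi phi_psi.
by apply/jacobian_idealP => //; exists (map_mx psi u).
Qed.

(** If [d] sends Q to [h * Q], then [d - h *: euler_Q] kills Q, so Euler and the syzygies span D(A).
    The sum is direct because Euler sends Q to n Q, which is nonzero. The basis of syzygies is found
    in the new coordinates and carried back. *)
Lemma lift_free : (forall k, (2 <= k <= l)%N -> syz_lift grad_g k) ->
  free_arrangement alpha.
Proof.
move=> lift; have [r [T [indT spanT]]] := syz_free grad_g_homog l_ge2 lift.
pose M : 'M[S]_(1 + r, l) := col_mx (euler K l) (map_mx psi T).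
have eN : n%:R * Q != 0.
  rewrite mulf_neq0 ?Q_neq0 // -mpolyC_nat mpolyC_eq0; exact: natK_neq0.
have T0 (c : 'rV_r) : dot (gradient Q) (c *m map_mx psi T) = 0.
  apply: phi_inj; rewrite -dot_phi map_mxM phi_psi rmorph0.
  by apply/spanT; exists (map_mx phi c).
have ME (c : 'rV_(1 + r)) : c *m M = lsubmx c 0 0 *: euler K l + rsubmx c *m map_mx psi T.
  by rewrite -{1}(hsubmxK c) mul_row_col [lsubmx c]mx11_scalar mul_scalar_mx -mx11_scalar.
apply: (matrix_free_module (T := M)) => [c|d].
  rewrite ME => h; have := dotD (gradient Q) (lsubmx c 0 0 *: euler K l) (rsubmx c *m map_mx psi T).
  rewrite h dot0 T0 addr0 dotZ -derivation_dot derivation_euler => /esym/eqP.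
  rewrite mulf_eq0 (negbTE eN) orbF => /eqP c0; rewrite c0 scale0r add0r in h.
  have c1 : rsubmx c = 0.
    apply: (can_inj (psi_phi (b := r))); rewrite /= map_mx0; apply: indT.
    by rewrite -(phi_psi T) -map_mxM h map_mx0.
  by rewrite -(hsubmxK c) [lsubmx c]mx11_scalar c0 c1 -scalemx1 scale0r row_mx0.
split=> [/log_derivationsP [h hd]|[c ->]]; last first.
  apply/log_derivationsP; exists (lsubmx c 0 0 * n%:R).
  by rewrite ME derivation_dot dotD T0 addr0 dotZ -derivation_dot derivation_euler mulrA.
have : dot grad_g (map_mx phi (d - h *: euler_Q)) = 0.
  by rewrite dot_phi dotB dotZ dot_euler_Q // -derivation_dot hd subrr rmorph0.
move/spanT => [c ec]; exists (row_mx ((h * (n%:R^-1)%:MP)%:M) (map_mx psi c)).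
rewrite /M mul_row_col mul_scalar_mx -map_mxM -ec psi_phi /euler_Q scalerA addrC subrK //.
Qed.

Lemma free_lift2 (N : nat) h1 h2 : free_arrangement alpha ->
  restr 2 (phi Q) != 0 -> restr 1 (dot grad_g h1) != 0 ->
  restr 2 (dot grad_g h2) = 'X_(Ordinal l_ge2) ^+ N -> syz_lift grad_g 2.
Proof.
move=> /free_module_matrix [T hT] Q0 e1 e2.
apply: (@matrix_syz_lift _ _ _ _ _ grad_g_homog l_ge2 (map_mx phi T) (phi Q)
  (map_mx phi euler_Q) h1 h2 N) => //.
- move=> c; have /log_derivationsP [h eh] : log_derivations alpha (map_mx psi c *m T).
    by apply/hT; exists (map_mx psi c).
  exists (phi h); rewrite -rmorphM /= -eh derivation_dot -dot_phi map_mxM phi_psi //.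
- move=> u h eu; have /hT [c ec] : log_derivations alpha (map_mx psi u).
    apply/log_derivationsP; exists (psi h); apply: phi_inj.
    by rewrite derivation_dot -dot_phi phi_psi eu rmorphM /= change_coordsVK.
  by exists (map_mx phi c); rewrite -map_mxM -ec phi_psi.
by rewrite dot_phi dot_euler_Q.
Qed.

End Coordinates.
End Arrangement.

(** * Evaluation on a plane *)

Section InfiniteField.
Variables (K : fieldType) (charK : [pchar K] =i pred0).

Lemma poly_nonroot (p : {poly K}) : p != 0 -> exists t, p.[t] != 0.
Proof.
move=> p0; pose rs := [seq i%:R : K | i <- iota 0 (size p)].
have urs : uniq rs.
  rewrite map_inj_uniq ?iota_uniq // => i j; wlog lt_ij : i j / (i <= j)%N.
    by move=> W; case: (leqP i j) => [/W|/ltnW /W h e] //; rewrite h.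
  move=> /eqP; rewrite eq_sym -subr_eq0 -natrB // (proj1 (pcharf0P K) charK) subn_eq0.
  by move=> le_ji; apply/eqP; rewrite eqn_leq lt_ij.
case: (boolP (all (root p) rs)) => [all_r|].
  have := max_poly_roots p0 all_r urs.
  by rewrite size_map size_iota ltnn.
by move/allPn => [t _ ht]; exists t.
Qed.

(** The vector is sought on the moment curve (1, t, t^2, ...), along which each row becomes a
    nonzero polynomial in t. *)
Lemma dot_nonzero (l : nat) (I : finType) (A : I -> 'rV[K]_l) :
  (forall i, A i != 0) -> exists y : 'cV[K]_l, forall i, (A i *m y) 0 0 != 0.
Proof.
move=> A0; pose p i := \poly_(j < l) (if insub j is Some k then A i 0 k else 0).
have pE i (j : 'I_l) : (p i)`_j = A i 0 j.
  by rewrite coef_poly ltn_ord insubT //= => hj; congr (A i _ _); apply: val_inj.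
have [|t ht] := @poly_nonroot (\prod_i p i).
  apply/prodf_neq0 => i _; apply: contraNneq (A0 i) => p0.
  by apply/eqP/matrixP => a j; rewrite ord1 -pE p0 coef0 mxE.
exists (\col_j t ^+ j) => i; rewrite horner_prod in ht.
move/prodf_neq0: ht => /(_ i isT); rewrite horner_poly mxE; congr (_ != _).
by apply: eq_bigr => j _; rewrite mxE insubT //= => hj; congr (A i _ _ * _); apply: val_inj.
Qed.

(** [r] is a polynomial witnessing [U g], times the determinant, both restricted to the line; the
    determinant is needed because points of [U] are invertible. *)
Lemma zariski_line l (U : 'M[K]_l -> Prop) g d : zariski_open_GL U -> U g ->
  exists2 r : {poly K}, r.[0] != 0 & forall t, r.[t] != 0 -> U (g + t *: d).
Proof.
move=> [P HU] /HU [gu [p Pp /eqP pg]].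
pose D : 'M[{poly K}]_l := map_mx polyC g + 'X *: map_mx polyC d.
have DE t : map_mx (horner_eval t) D = g + t *: d.
  by apply/matrixP => i j; rewrite !mxE /horner_eval hornerD hornerM hornerX !hornerC.
have detE t : (\det D).[t] = \det (g + t *: d).
  by rewrite -DE det_map_mx.
pose r := \sum_(m <- msupp p) (p@_m)%:P * \prod_k mxvec D 0 k ^+ m k.
have rE t : r.[t] = p.@[fun k => mxvec (g + t *: d) 0 k].
  rewrite /r horner_sum mevalE; apply: eq_bigr => m _.
  rewrite hornerM hornerC horner_prod; congr (_ * _); apply: eq_bigr => k _.
  rewrite horner_exp; congr (_ ^+ _); rewrite -DE -map_mxvec mxE //.
exists (r * \det D) => [|t].
  rewrite hornerM rE detE scale0r addr0 mulf_neq0 // -unitfE -unitmxE //.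
rewrite hornerM mulf_eq0 negb_or rE detE => /andP [h1 h2]; apply/HU.
split; first by rewrite unitmxE unitfE.
by exists p => //; apply/eqP.
Qed.

End InfiniteField.

Section PlaneEvaluation.
Variables (K : fieldType) (l : nat) (l_ge2 : (2 <= l)%N).
Local Notation S := {mpoly K[l]}.
Let i0 : 'I_l := Ordinal (ltnW l_ge2).
Let i1 : 'I_l := Ordinal l_ge2.

(** The point (a, b, 0, ..., 0). It is used as (1, t) to read orders of vanishing in t = x_2 / x_1,
    and as (t, 1) for the Bezout identity at x_2 = 1. *)
Definition plane_pt (a b : {poly K}) (i : 'I_l) : {poly K} := nth 0 [:: a; b] i.
Definition ev (a b : {poly K}) : S -> {poly K} := mmap polyC (plane_pt a b).
HB.instance Definition _ a b := GRing.RMorphism.copy (ev a b) (mmap polyC (plane_pt a b)).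

Lemma evC a b c : ev a b c%:MP = c%:P. Proof. by rewrite /ev mmapC. Qed.
Lemma evX a b i : ev a b 'X_i = plane_pt a b i.
Proof. by rewrite /ev mmapX mmap1U. Qed.
Lemma ev_scale a b c p : ev a b (c *: p) = c *: ev a b p.
Proof. by rewrite -mul_mpolyC rmorphM /= evC mul_polyC. Qed.

Lemma mon12_0 a b : mon12 l a b i0 = a. Proof. by rewrite mnmE. Qed.
Lemma mon12_1 a b : mon12 l a b i1 = b. Proof. by rewrite mnmE. Qed.
Lemma mon12_ge2 a b (i : 'I_l) : (2 <= i)%N -> mon12 l a b i = 0%N.
Proof. by rewrite mnmE; case: i => -[|[|i]] //= _ _; rewrite nth_nil. Qed.

Lemma low_mon12 a b : low 2 (mon12 l a b).
Proof. by apply/lowP => i; apply: mon12_ge2. Qed.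

Lemma mon12E m : low 2 m -> m = mon12 l (m i0) (m i1).
Proof.
move=> /lowP hm; apply/mnmP => i; case: (leqP 2 i) => hi.
  by rewrite hm // mon12_ge2.
case: i hi => -[|[|i]] hi // _.
  by rewrite (_ : Ordinal hi = i0) ?mon12_0 //; apply: val_inj.
by rewrite (_ : Ordinal hi = i1) ?mon12_1 //; apply: val_inj.
Qed.

Lemma mdeg_low m : low 2 m -> mdeg m = (m i0 + m i1)%N.
Proof.
move=> /lowP hm; rewrite mdegE (bigD1 i0) //= (bigD1 i1) //= big1 ?addn0 // => i.
case/andP => h0 h1; apply: hm; rewrite leqNgt ltnS leq_eqVlt ltnS leqn0 negb_or.
by apply/andP; split.
Qed.

Lemma mdeg_mon12 a b : mdeg (mon12 l a b) = (a + b)%N.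
Proof. by rewrite mdeg_low ?low_mon12 // mon12_0 mon12_1. Qed.

Lemma mon12_le a b a' b' :
  (mon12 l a b <= mon12 l a' b')%MM = ((a <= a') && (b <= b'))%N.
Proof.
apply/mnm_lepP/andP => [h|[h0 h1] i].
  by have := h i0; have := h i1; rewrite !mon12_0 !mon12_1.
by rewrite !mnmE; case: i => -[|[|i]] //= _; rewrite !nth_nil.
Qed.

Lemma evXm a b m : ev a b 'X_[m] = if low 2 m then a ^+ m i0 * b ^+ m i1 else 0.
Proof.
rewrite /ev mmapX /mmap1; case: (boolP (low 2 m)) => [/lowP hm|].
  rewrite (bigD1 i0) //= (bigD1 i1) //= big1 ?mulr1 // => i /andP [h0 h1].
  rewrite hm ?expr0 // leqNgt ltnS leq_eqVlt ltnS leqn0 negb_or.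
  by apply/andP; split.
rewrite negb_forall => /existsP [i]; rewrite negb_imply => /andP [hi hm].
rewrite (bigD1 i) //= {1}/plane_pt nth_default // expr0n (negbTE hm) mul0r //.
Qed.

Lemma ev_restr2 a b p : ev a b (restr 2 p) = ev a b p.
Proof.
move: p; apply: (mpoly_rmorph_eq (f := ev a b \o restr 2)) => [c|i] /=.
  by rewrite /restr comp_mpolyC.
rewrite restrX; case: ltnP => // hi; rewrite rmorph0 evX /plane_pt nth_default //.
Qed.

Lemma coef_ev d f j : f \is d.-homog ->
  (ev 1 'X f)`_j = if (j <= d)%N then f@_(mon12 l (d - j) j) else 0.
Proof.
move=> hf; rewrite {1}[f]mpolyE rmorph_sum coef_sum.
transitivity (\sum_(m <- msupp f) f@_m *
    ((j <= d)%N && (m == mon12 l (d - j) j))%:R).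
  rewrite !big_seq; apply: eq_bigr => m hm; rewrite /= ev_scale coefZ evXm.
  congr (_ * _); rewrite expr1n mul1r; have hd := msupp_homog hf hm.
  case: (boolP (low 2 m)) => hl; last first.
    rewrite coef0; case: eqP => [e|]; last by rewrite andbF.
    by rewrite e low_mon12 in hl.
  rewrite coefXn; congr ((nat_of_bool _)%:R); apply/eqP/andP => [->|[_ /eqP ->]]; last by rewrite mon12_1.
  rewrite -hd mdeg_low // leq_addl addnK; split=> //.
  by apply/eqP/mon12E.
case: leqP => hj /=; last by rewrite big1 // => m _; rewrite mulr0.
rewrite [in RHS](mpolyE f) linear_sum /=; apply: eq_bigr => m _.
by rewrite mcoeffZ mcoeffX.
Qed.

Lemma coef_ev' d f j : f \is d.-homog ->
  (ev 'X 1 f)`_j = if (j <= d)%N then f@_(mon12 l j (d - j)) else 0.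
Proof.
move=> hf; rewrite {1}[f]mpolyE rmorph_sum coef_sum.
transitivity (\sum_(m <- msupp f) f@_m *
    ((j <= d)%N && (m == mon12 l j (d - j)))%:R).
  rewrite !big_seq; apply: eq_bigr => m hm; rewrite /= ev_scale coefZ evXm.
  congr (_ * _); rewrite expr1n mulr1; have hd := msupp_homog hf hm.
  case: (boolP (low 2 m)) => hl; last first.
    rewrite coef0; case: eqP => [e|]; last by rewrite andbF.
    by rewrite e low_mon12 in hl.
  rewrite coefXn; congr ((nat_of_bool _)%:R); apply/eqP/andP => [->|[_ /eqP ->]]; last by rewrite mon12_0.
  rewrite -hd mdeg_low // leq_addr addKn; split=> //.
  by apply/eqP/mon12E.
case: leqP => hj /=; last by rewrite big1 // => m _; rewrite mulr0.
rewrite [in RHS](mpolyE f) linear_sum /=; apply: eq_bigr => m _.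
by rewrite mcoeffZ mcoeffX.
Qed.

End PlaneEvaluation.

(** * Generic coordinates *)

Section GenericCoordinates.
Variables (K : fieldType) (charK : [pchar K] =i pred0).
Variables (l : nat) (l_ge2 : (2 <= l)%N) (n : nat).
Variables (H : 'I_n -> {vspace 'rV[K]_l}) (arrH : central_arrangement H).
Variables (alpha : 'I_n -> {mpoly K[l]}) (defH : defining_forms H alpha).
Local Notation S := {mpoly K[l]}.
Let Q : S := defining_poly alpha.
Let i0 : 'I_l := Ordinal (ltnW l_ge2).
Let i1 : 'I_l := Ordinal l_ge2.
Local Notation ev := (@ev K l).

Definition form_row i : 'rV[K]_l := \row_j (alpha i)@_U_(j).
Definition form_coef (g : 'M[K]_l) i k : K := (form_row i *m g) 0 k.
Definition minor g i j : K :=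
  form_coef g i i0 * form_coef g j i1 - form_coef g i i1 * form_coef g j i0.

(* The forms restrict to pairwise non-proportional forms on the plane spanned
   by the first two new coordinates, neither axis of which is in a hyperplane. *)
Definition generic g := [/\ forall i, form_coef g i i0 != 0,
  forall i, form_coef g i i1 != 0 & forall i j, i != j -> minor g i j != 0].

Lemma form_rowE i : alpha i = \sum_j form_row i 0 j *: 'X_j.
Proof.
rewrite [LHS]linear_formE; last exact: alpha_homog defH i.
by apply: eq_bigr => j _; rewrite mxE.
Qed.

Lemma form_row_neq0 i : form_row i != 0.
Proof.
apply: contraNneq (alpha_neq0 l_ge2 arrH defH i) => e.
by rewrite form_rowE e big1 // => j _; rewrite mxE scale0r.
Qed.

Lemma form_row_indep i j a b : i != j -> b != 0 ->
  a *: form_row i - b *: form_row j != 0.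
Proof.
move=> ij b0; apply/eqP => e.
have /(alpha_not_dvd arrH defH) [] : j != i by rewrite eq_sym.
exists (b^-1 * a)%:MP; rewrite mul_mpolyC [RHS](congr1 _ (form_rowE i)) form_rowE.
rewrite scaler_sumr; apply: eq_bigr => k _; rewrite !scalerA; congr (_ *: _).
move/matrixP: e => /(_ 0 k); rewrite !mxE => /eqP; rewrite subr_eq0 => /eqP e.
by rewrite -mulrA e mulrA mulVf // mul1r.
Qed.

(** The first column [y] avoids all hyperplanes. The second column [z] avoids the zeros of the forms
    and of the combinations of pairs of forms whose values at [z] are the minors; these combinations
    are nonzero because the forms are pairwise non-proportional. *)
Lemma generic_exists : exists g, generic g.
Proof.
have [y hy] := dot_nonzero charK form_row_neq0.
pose a i : K := (form_row i *m y) 0 0.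
pose A (x : 'I_n * 'I_n) :=
  if x.1 == x.2 then form_row x.1 else a x.1 *: form_row x.2 - a x.2 *: form_row x.1.
have [|z hz] := @dot_nonzero _ charK _ _ A.
  move=> [i j]; rewrite /A /=; case: (eqVneq i j) => [_|ij]; first exact: form_row_neq0.
  by apply: form_row_indep; [rewrite eq_sym|apply: hy].
(* Only two columns are constrained; the others repeat [z], so [g] may be singular. Invertibility is
   supplied by [U] afterwards. *)
pose g : 'M[K]_l := \matrix_(i, j) if j == i0 then y i 0 else z i 0.
have g0 i : form_coef g i i0 = a i.
  by rewrite /form_coef /a !mxE; apply: eq_bigr => k _; rewrite !mxE eqxx.
have g1 i : form_coef g i i1 = (form_row i *m z) 0 0.
  by rewrite /form_coef !mxE; apply: eq_bigr => k _; rewrite !mxE.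
exists g; split=> [i|i|i j ij]; first by rewrite g0; apply: hy.
  by rewrite g1; have := hz (i, i); rewrite /A /= eqxx.
have := hz (i, j); rewrite /A /= (negbTE ij) /minor !g0 !g1 mulmxBl -!scalemxAl.
by move: (form_row i *m z) (form_row j *m z) => u v; rewrite !mxE [X in _ - X]mulrC.
Qed.

(** On the line from [g1] in [U] to the generic [g2], the polynomial for [U] is nonzero at t = 0 and
    the others are nonzero at t = 1. So their product is a nonzero polynomial and has a non-root. *)
Lemma generic_in_open U : zariski_open_GL U -> (exists g, U g) ->
  exists g, U g /\ generic g.
Proof.
move=> openU [g1 Ug1]; have [g2 [G0 G1 G2]] := generic_exists.
have [r r0 hr] := zariski_line (g2 - g1) openU Ug1.
pose c i k : {poly K} := (form_coef g1 i k)%:P + (form_coef (g2 - g1) i k)%:P * 'X.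
have cE i k t : (c i k).[t] = form_coef (g1 + t *: (g2 - g1)) i k.
  rewrite hornerD hornerM hornerX !hornerC /form_coef [form_row i *m (g1 + _)]mulmxDr -scalemxAr.
  by rewrite [RHS]mxE [X in _ = _ + X]mxE mulrC.
pose m i j := c i i0 * c j i1 - c i i1 * c j i0.
have mE i j t : (m i j).[t] = minor (g1 + t *: (g2 - g1)) i j.
  by rewrite hornerD hornerN !hornerM !cE.
have at1 : g1 + 1 *: (g2 - g1) = g2 by rewrite scale1r addrC subrK.
have nz (p : {poly K}) t : p.[t] != 0 -> p != 0.
  by apply: contraNneq => ->; rewrite horner0.
pose P := r * (\prod_i c i i0) * (\prod_i c i i1) * \prod_i \prod_(j | i != j) m i j.
have [|t] := poly_nonroot charK (p := P).
  rewrite !mulf_neq0 ?(nz _ _ r0) //.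
  - by apply/prodf_neq0 => i _; apply: (nz _ 1); rewrite cE at1.
  - by apply/prodf_neq0 => i _; apply: (nz _ 1); rewrite cE at1.
  apply/prodf_neq0 => i _; apply/prodf_neq0 => j ij.
  by apply: (nz _ 1); rewrite mE at1 G2.
rewrite /P !hornerM !mulf_eq0 !negb_or !horner_prod.
move=> /andP [/andP [/andP [h0 /prodf_neq0 h1] /prodf_neq0 h2] /prodf_neq0 h3].
exists (g1 + t *: (g2 - g1)); split; first exact: hr.
split=> [i|i|i j ij]; rewrite -?cE ?h1 ?h2 // -mE.
have := h3 i isT; rewrite horner_prod => /prodf_neq0; exact.
Qed.

Section Fixed.
Variables (n0 : (0 < n)%N) (g : 'M[K]_l) (gU : g \in unitmx) (gG : generic g).
Local Notation phi := (change_coords g).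
Local Notation grad := (grad_g alpha g).

Lemma phi_alpha i : phi (alpha i) = \sum_k form_coef g i k *: 'X_k.
Proof.
rewrite form_rowE linear_sum /=.
under eq_bigr => j _ do rewrite linearZ /= change_coordsX scaler_sumr.
rewrite exchange_big; apply: eq_bigr => k _; rewrite [form_coef _ _ _]mxE scaler_suml.
by apply: eq_bigr => j _; rewrite scalerA.
Qed.

Lemma ev_phi_alpha a b i :
  ev a b (phi (alpha i)) = form_coef g i i0 *: a + form_coef g i i1 *: b.
Proof.
rewrite phi_alpha rmorph_sum /= (bigD1 i0) //= (bigD1 i1) //= !ev_scale !evX.
rewrite big1 ?addr0 // => k /andP [k0 k1]; rewrite ev_scale evX /plane_pt nth_default ?scaler0 //.
by rewrite leqNgt ltnS leq_eqVlt ltnS leqn0 negb_or; apply/andP; split.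
Qed.

Lemma ev_phi_Q a b : ev a b (phi Q) = \prod_i ev a b (phi (alpha i)).
Proof. by rewrite /Q /defining_poly !rmorph_prod. Qed.

(** By the chain rule, its product with [grad] is the derivative of [phi Q] along the first new
    axis. *)
Definition col0_row : 'rV[S]_l := \row_k (g k i0)%:MP.

Lemma dot_col0 : dot grad col0_row =
  \sum_i form_coef g i i0 *: \prod_(j | j != i) phi (alpha j).
Proof.
have -> : col0_row = map_mx phi col0_row.
  by apply/matrixP => a b; rewrite !mxE change_coordsC.
rewrite dot_phi -derivation_dot derivation_prod linear_sum /=.
apply: eq_bigr => i _; rewrite rmorphM rmorph_prod /= -mul_mpolyC; congr (_ * _).
rewrite derivation_linear_form; last exact: alpha_homog defH i.
rewrite linear_sum /form_coef mxE rmorph_sum; apply: eq_bigr => k _.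
by rewrite /= !mxE linearZ /= change_coordsC -mul_mpolyC mpolyCM.
Qed.

Lemma ev_col0 a b : ev a b (dot grad col0_row) =
  \sum_i form_coef g i i0 *: \prod_(j | j != i) ev a b (phi (alpha j)).
Proof.
rewrite dot_col0 rmorph_sum; apply: eq_bigr => i _ /=.
by rewrite ev_scale rmorph_prod.
Qed.

Lemma dot_col0_homog : dot grad col0_row \is (n - 1).-homog.
Proof.
rewrite subn1 -[n.-1]add0n; apply: (dot_homog (grad_g_homog defH g)) => i.
by rewrite mxE; apply/dhomogP => m; rewrite msuppC; case: ifP => // _;
  rewrite mem_seq1 => /eqP ->; exact: mdeg0.
Qed.

Lemma ev_col0_0 : (ev 1 'X (dot grad col0_row)).[0] != 0.
Proof.
have [G0 _ _] := gG.
rewrite ev_col0 horner_sum (eq_bigr (fun i => \prod_j form_coef g j i0)).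
  by rewrite sumr_const card_ord -mulr_natl mulf_neq0 ?natK_neq0 //; apply/prodf_neq0.
move=> i _; rewrite hornerZ horner_prod [RHS](bigD1 i) //=; congr (_ * _).
by apply: eq_bigr => j _; rewrite ev_phi_alpha hornerD !hornerZ hornerX mulr0 addr0 hornerC mulr1.
Qed.

Lemma restr1_col0 : restr 1 (dot grad col0_row) != 0.
Proof.
have := ev_col0_0; rewrite horner_coef0 (coef_ev l_ge2 0 dot_col0_homog) leq0n subn0.
apply: contraNneq => e; have := congr1 (mcoeff (mon12 l (n - 1) 0)) e.
rewrite mcoeff_restr mcoeff0 ifT // => [->//|].
apply/lowP => -[[|i] hi] //= _; rewrite mnmE /=.
by case: i {hi} => //= i; rewrite nth_nil.
Qed.

(** At the root of the i-th linear factor only the i-th summand of the derivative survives, and its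
    factors are nonzero there because the minors are. *)
Lemma coprime_restriction :
  coprimep (ev 'X 1 (phi Q)) (ev 'X 1 (dot grad col0_row)).
Proof.
have [G0 _ G2] := gG.
rewrite ev_phi_Q; apply: (big_rec (fun p => coprimep p _)); first exact: coprime1p.
move=> i p _ hp; rewrite coprimepMl hp andbT ev_phi_alpha.
set b0 := form_coef g i i0; set b1 := form_coef g i i1; set x := - (b1 / b0).
have -> : b0 *: 'X + b1 *: 1 = b0 *: ('X - x%:P).
  rewrite scalerBr -[b0 *: x%:P]mul_polyC -polyCM /x mulrN mulrCA mulfV ?G0 // mulr1.
  by rewrite rmorphN opprK -[b1 *: 1]mul_polyC mulr1.
rewrite coprimepZl ?G0 // coprimep_sym coprimep_XsubC rootE ev_col0.
rewrite horner_sum (bigD1 i) //= [X in _ + X]big1 ?addr0 => [|j ji].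
  rewrite hornerZ mulf_neq0 ?G0 // horner_prod; apply/prodf_neq0 => j ji.
  rewrite ev_phi_alpha hornerD !hornerZ hornerX hornerC mulr1.
  have : minor g i j != 0 by rewrite G2 // eq_sym.
  apply: contraNneq; rewrite /minor -/b0 -/b1 /x mulrN => /eqP.
  rewrite addrC subr_eq0 => /eqP ->; rewrite mulrCA [b0 * _]mulrCA mulfV ?G0 //.
  by rewrite mulr1 mulrC subrr.
rewrite hornerZ (bigD1 i) 1?eq_sym //= hornerM ev_phi_alpha -/b0 -/b1.
rewrite hornerD !hornerZ hornerX hornerC mulr1 /x mulrN [b0 * _]mulrCA mulfV ?G0 // mulr1.
by rewrite addNr mul0r mulr0.
Qed.

(** The homogeneous components of an element of J lie in J. Multiplying each by the missing power of
    x_2 changes nothing at x_2 = 1. *)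
Lemma homogenize u : exists N v, dot grad v \is N.-homog /\
  ev 'X 1 (dot grad v) = ev 'X 1 (dot grad u).
Proof.
set F := dot grad u; exists (msize F).
have D d : exists v, dot grad v = pihomog mdeg d F.
  rewrite /F (pihomog_dot (grad_g_homog defH g)); case: ifP => _.
    by exists (pihomog_row (d - n.-1) u).
  by exists 0; rewrite dot0.
have [v hv] : exists v : nat -> 'rV[S]_l, forall d : 'I_(msize F), dot grad (v d) = pihomog mdeg d F.
  have [v hv] := fin_all_exists (fun d : 'I_(msize F) => D d).
  by exists (fun d => if insub d is Some j then v j else 0) => d; rewrite valK.
exists (\sum_(d < msize F) 'X_i1 ^+ (msize F - d) *: v d).
have E : dot grad (\sum_(d < msize F) 'X_i1 ^+ (msize F - d) *: v d) =
    \sum_(d < msize F) 'X_i1 ^+ (msize F - d) * pihomog mdeg d F.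
  by rewrite dot_sum; apply: eq_bigr => d _; rewrite dotZ hv.
rewrite E; split.
  apply: rpred_sum => d _.
  suff : 'X_i1 ^+ (msize F - d) * pihomog mdeg d F \is (msize F - d + d).-homog.
    by rewrite subnK // ltnW.
  apply: dhomogM; last exact: pihomogP.
  rewrite -{2}(mul1n (msize F - d)%N); apply: dhomogMn.
  by rewrite dhomogX; apply/eqP; exact: mdeg1.
rewrite [in RHS](pihomog_partitionE (leqnn (msize F))) !rmorph_sum; apply: eq_bigr => d _ /=.
by rewrite rmorphM rmorphXn /= evX /plane_pt /= expr1n mul1r.
Qed.

(** The Bezout identity between Q and its derivative gives an element of J equal to 1 at x_2 = 1 on
    the plane; made homogeneous of degree [N], it can only be x_2^N modulo a_2. *)
Lemma exists_Xn : exists N v, dot grad v \is N.-homog /\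
  restr 2 (dot grad v) = 'X_i1 ^+ N.
Proof.
have /Bezout_eq1_coprimepP [[a b] /= eab] := coprime_restriction.
pose lf (p : {poly K}) : S := \sum_(i < size p) p`_i *: 'X_i0 ^+ i.
have evlf p : ev 'X 1 (lf p) = p.
  rewrite -[RHS]coefK poly_def /lf rmorph_sum; apply: eq_bigr => i _ /=.
  by rewrite ev_scale rmorphXn /= evX /plane_pt.
pose u := lf a *: map_mx phi (euler_Q K l n) + lf b *: col0_row.
have eu : ev 'X 1 (dot grad u) = 1.
  rewrite dotD !dotZ dot_phi (dot_euler_Q charK defH n0) rmorphD !rmorphM /= !evlf.
  exact: eab.
have [N [v [hN ev1]]] := homogenize u; exists N, v; split=> //.
apply/mpolyP => m; rewrite mcoeff_restr mpolyXn mcoeffX.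
have em : (U_(i1) *+ N)%MM = mon12 l 0 N.
  apply/mnmP => i; rewrite mulmnE mnm1E mnmE -val_eqE /=.
  by case: i => -[|[|i]] hi //=; rewrite ?mul1n ?nth_nil.
rewrite em; case: (boolP (low 2 m)) => hl; last first.
  by case: eqP => // e; rewrite -e low_mon12 in hl.
case: (mdeg m =P N) => [hm|/eqP hm]; last first.
  rewrite (mcoeff_homog0 hN hm); case: eqP => // e.
  by rewrite -e (mdeg_mon12 l_ge2) eqxx in hm.
have := coef_ev' l_ge2 (m i0) hN; rewrite ev1 eu coef1 -hm (mdeg_low l_ge2 hl).
rewrite leq_addr addKn -(mon12E l_ge2 hl) => <-; congr ((nat_of_bool _)%:R).
apply/eqP/eqP => e; first by rewrite [RHS](mon12E l_ge2 hl) -/i0 e.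
by rewrite -e (mon12_0 l_ge2).
Qed.

Lemma restr2_phi_Q : restr 2 (phi Q) != 0.
Proof.
have [G0 _ _] := gG.
apply/eqP => e; have := ev_restr2 1 'X (phi Q); rewrite e rmorph0 ev_phi_Q.
move/(congr1 (horner^~ 0)); rewrite horner0 horner_prod => /esym/eqP.
apply/negP/prodf_neq0 => i _; rewrite ev_phi_alpha hornerD !hornerZ hornerC hornerX.
by rewrite mulr1 mulr0 addr0.
Qed.

Lemma generic_free_lift : free_arrangement alpha -> syz_lift grad 2.
Proof.
move=> hfree; have [N [v [_ hv]]] := exists_Xn.
exact: (free_lift2 charK arrH defH n0 gU hfree restr2_phi_Q restr1_col0 hv).
Qed.

End Fixed.
End GenericCoordinates.

(** * Orders of vanishing of binary forms *)

Section BinaryForms.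
Variables (K : fieldType) (charK : [pchar K] =i pred0).
Implicit Types (f v w p q : {poly K}) (s : seq {poly K}) (c : nat -> K) (d e k : nat).

Lemma coefM_top p q a b : (size p <= a.+1)%N -> (size q <= b.+1)%N ->
  (p * q)`_(a + b) = p`_a * q`_b.
Proof.
move=> hp hq; rewrite coefM.
have ha : (a < (a + b).+1)%N by rewrite ltnS leq_addr.
rewrite (bigD1 (Ordinal ha)) //= addKn big1 ?addr0 // => i ia.
case: (ltngtP i a) => hi; last by case/eqP: ia; apply: val_inj.
  by rewrite [q`__]nth_default ?mulr0 //; apply: leq_trans hq _; lia.
by rewrite [p`__]nth_default ?mul0r //; apply: leq_trans hp _.
Qed.

Definition order_ge k p := forall j, (j < k)%N -> p`_j = 0.
Definition has_order e p := p`_e != 0 /\ order_ge e p.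

Lemma order_geM p q a b : order_ge a p -> order_ge b q -> order_ge (a + b) (p * q).
Proof.
move=> hp hq j hj; rewrite coefM big1 // => i _.
case: (ltnP i a) => hi; first by rewrite hp // mul0r.
by rewrite hq ?mulr0 //; have := ltn_ord i; lia.
Qed.

Lemma coefM_bottom p q a b : order_ge a p -> order_ge b q ->
  (p * q)`_(a + b) = p`_a * q`_b.
Proof.
move=> hp hq; rewrite coefM.
have ha : (a < (a + b).+1)%N by rewrite ltnS leq_addr.
rewrite (bigD1 (Ordinal ha)) //= addKn big1 ?addr0 // => i ia.
case: (ltngtP i a) => hi; last by case/eqP: ia; apply: val_inj.
  by rewrite hp ?mul0r.
by rewrite hq ?mulr0 //; have := ltn_ord i; lia.
Qed.

Lemma has_orderM p q a b : has_order a p -> has_order b q -> has_order (a + b) (p * q).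
Proof.
move=> [pa ha] [qb hb]; split; last exact: order_geM.
by rewrite coefM_bottom // mulf_neq0.
Qed.

Lemma has_order_exists p : p != 0 -> exists2 e, has_order e p & (e < size p)%N.
Proof.
move=> p0; have [|e pe he] := @least_nat (fun e => p`_e != 0).
  by exists (size p).-1; rewrite -lead_coefE lead_coef_eq0.
exists e; first by split=> // j /he /negP; rewrite negbK => /eqP.
by rewrite ltnNge; apply: contra pe => /(nth_default 0) ->.
Qed.

Lemma has_order_uniq p a b : has_order a p -> has_order b p -> a = b.
Proof.
move=> [pa ha] [pb hb]; case: (ltngtP a b) => // lt.
  by rewrite hb // eqxx in pa.
by rewrite ha // eqxx in pb.
Qed.

Lemma order_ge_dvd k p : order_ge k p -> exists q, p = q * 'X^k.
Proof.
move=> hp; exists (drop_poly k p); rewrite -{1}(poly_take_drop k p).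
rewrite (_ : take_poly k p = 0) ?add0r //; apply/polyP => i.
by rewrite coef_take_poly coef0; case: ifP => // /hp.
Qed.

Lemma order_shift_dvd k p x : order_ge k (p \Po ('X + x%:P)) -> ('X - x%:P) ^+ k %| p.
Proof.
move=> /order_ge_dvd [q eq]; rewrite -(comp_polyXaddC_K p x) eq.
by rewrite rmorphM rmorphXn /= comp_polyX dvdp_mull.
Qed.

Definition pcomb c s : {poly K} := \sum_(i < size s) c i *: nth 0 s i.
Definition indep s := forall c, pcomb c s = 0 -> forall i, (i < size s)%N -> c i = 0.

Lemma pcomb_cons c v s : pcomb c (v :: s) = c 0%N *: v + pcomb (fun i => c i.+1) s.
Proof. by rewrite /pcomb big_ord_recl. Qed.

Lemma mulrn_inj (x : K) i j : x *+ i = x *+ j -> x != 0 -> i = j.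
Proof.
wlog le_ij : i j / (i <= j)%N.
  by move=> W; case: (leqP i j) => [/W|/ltnW /W h e x0] //; rewrite h.
move=> /esym/eqP; rewrite -subr_eq0 -mulrnBr // -mulr_natr mulf_eq0 orbC => /orP [] h x0.
  move: h; rewrite (proj1 (pcharf0P K) charK) subn_eq0 => le_ji.
  by apply/eqP; rewrite eqn_leq le_ij.
by rewrite h in x0.
Qed.

(** Comparing top coefficients after multiplication by X shows, in characteristic zero, that every
    nonzero solution has the degree of [v]. Subtracting the multiple of [v] that removes this
    coefficient from [f] therefore leaves 0. *)
Lemma wronskian_eq0 v f : v != 0 -> v * f^`() = v^`() * f -> exists a, f = a *: v.
Proof.
move=> v0 E.
have top h : h != 0 -> v * h^`() = v^`() * h -> (size v).-1 = (size h).-1.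
  move=> h0 Eh; set a := (size v).-1; set b := (size h).-1.
  have sz (p : {poly K}) : (size ('X * p^`())%R <= (size p).-1.+1)%N.
    apply/leq_sizeP => -[|j]; rewrite coefXM //= coef_deriv => hj.
    by rewrite nth_default ?mul0rn //; apply: leq_trans (leqSpred _) hj.
  have E1 : v * ('X * h^`()) = ('X * v^`()) * h by rewrite mulrCA Eh mulrA.
  have := congr1 (fun p : {poly K} => p`_(a + b)) E1.
  rewrite /= (@coefM_top v _ a b) ?sz ?leqSpred //.
  rewrite (@coefM_top _ h a b) ?sz ?leqSpred //.
  have cX (p : {poly K}) j : ('X * p^`())`_j = p`_j *+ j.
    by rewrite coefXM coef_deriv; case: j.
  rewrite !cX mulrnAr mulrnAl => /mulrn_inj inj; apply/esym/inj.
  by rewrite mulf_neq0 // -lead_coefE lead_coef_eq0.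
set a := (size v).-1 in top.
have va : v`_a != 0 by rewrite -lead_coefE lead_coef_eq0.
exists (f`_a / v`_a); apply/eqP; rewrite -subr_eq0; apply/eqP.
set h := f - _; case: (eqVneq h 0) => // h0.
have := top h h0; rewrite /h derivB derivZ mulrBr E mulrBr -!scalerAr [v * _]mulrC.
move=> /(_ erefl) ea; have : h`_a != 0 by rewrite ea -lead_coefE lead_coef_eq0.
by rewrite /h coefB coefZ divfK // subrr eqxx.
Qed.

(* The Wronskian argument: dividing by the first element and differentiating
   lowers both the length of the family and the order of vanishing. *)
Lemma no_inflection s : indep s -> exists2 b : {poly K}, b != 0 &
  forall x, b.[x] != 0 -> forall c, ('X - x%:P) ^+ size s %| pcomb c s -> pcomb c s = 0.
Proof.
have [k] := ubnP (size s); elim: k s => // k IH [|v s] hk ind.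
  by exists 1; rewrite ?oner_neq0 // => x _ c _; rewrite /pcomb big_ord0.
have v0 : v != 0.
  apply/eqP => v0; have /eqP : (1 : K) = 0; last by rewrite oner_eq0.
  apply: (ind (fun i => (i == 0%N)%:R) _ 0%N) => //.
  by rewrite pcomb_cons v0 scaler0 add0r /pcomb big1 // => i _; rewrite scale0r.
(* [D f] is v^2 (f / v)' without the fraction; in particular [D v = 0]. *)
pose D f := v * f^`() - v^`() * f.
pose ws := [seq D f | f <- s].
have Dcomb c : D (pcomb c s) = pcomb c ws.
  rewrite /D /pcomb size_map linear_sum !mulr_sumr -sumrB; apply: eq_bigr => i _.
  by rewrite (nth_map 0) // /= derivZ -!scalerAr scalerBr.
have indw : indep ws.
  move=> c; rewrite -Dcomb size_map => /eqP; rewrite subr_eq0 => /eqP E i hi.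
  have [a ea] := wronskian_eq0 v0 E.
  have := ind (fun j => if j is j'.+1 then c j' else - a) _ i.+1 hi; apply.
  by rewrite pcomb_cons ea scaleNr addNr.
have [|b b0 hb] := IH ws _ indw; first by rewrite size_map.
(* Roots of [v] are excluded as well: in the end only [c 0 *: v] remains, and its vanishing at [x]
   must force [c 0 = 0]. *)
exists (v * b); first by rewrite mulf_neq0.
move=> x; rewrite hornerM mulf_eq0 negb_or => /andP [vx bx] c /= hdvd.
set f := pcomb _ _ in hdvd *; pose f' := pcomb (fun i => c i.+1) s.
have ef : f = c 0%N *: v + f' by rewrite /f pcomb_cons.
have Df : D f = pcomb (fun i => c i.+1) ws.
  rewrite -Dcomb -/f' ef /D derivD derivZ !mulrDr -!scalerAr opprD addrACA.
  by rewrite [v * v^`()]mulrC subrr add0r.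
have dD : ('X - x%:P) ^+ size ws %| D f.
  rewrite size_map; case/dvdpP: hdvd => q ->; rewrite /D.
  apply: dvdp_sub; last by rewrite mulrA dvdp_mull // exprS dvdp_mull.
  rewrite derivM mulrDr deriv_exp derivXsubC mul1r /=; apply: dvdp_add.
    by rewrite exprS !mulrA dvdp_mull.
  by rewrite dvdp_mull // dvdp_mull // -mulr_natl dvdp_mull.
have w0 : pcomb (fun i => c i.+1) ws = 0 by apply: (hb x bx); rewrite -Df.
have c0 i : (i < size s)%N -> c i.+1 = 0 by move=> hi; apply: (indw _ w0); rewrite size_map.
have f'0 : f' = 0 by rewrite /f' /pcomb big1 // => i _; rewrite c0 // scale0r.
rewrite ef f'0 addr0 in hdvd *; have : root (c 0%N *: v) x.
  by rewrite -dvdp_XsubCl; apply: dvdp_trans hdvd; rewrite exprS dvdp_mulr.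
by rewrite rootE hornerZ mulf_eq0 (negbTE vx) orbF => /eqP ->; rewrite scale0r.
Qed.

(** * Orders at a general point: initial segments and their growth *)

Section Orders.
Variables (W : nat -> {poly K} -> Prop) (R : nat -> nat -> Prop) (b : {poly K}).
Hypothesis W_lin : forall d a f h, W d f -> W d h -> W d (a *: f + h).
Hypothesis W0 : forall d, W d 0.
Hypothesis W_size : forall d f, W d f -> (size f <= d.+1)%N.
Hypothesis b0 : b.[0] != 0.
Hypothesis W_order : forall d e x, b.[x] != 0 ->
  R d e <-> exists2 f, W d f & has_order e (f \Po ('X + x%:P)).

Lemma W_order0 d e : R d e <-> exists2 f, W d f & has_order e f.
Proof.
split=> [/(W_order d e b0) [f hf he]|[f hf he]].
  by exists f => //; move: he; rewrite addr0 comp_polyXr.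
by apply/(W_order d e b0); exists f => //; rewrite addr0 comp_polyXr.
Qed.

Lemma R_le d e : R d e -> (e < d.+1)%N.
Proof.
move=> /W_order0 [f /W_size hf [he _]]; rewrite ltnNge; apply: contra he => hd.
by rewrite nth_default // (leq_trans hf).
Qed.

Lemma classical_filter (P : nat -> Prop) N :
  exists s : seq nat, uniq s /\ forall e, e \in s <-> (e < N)%N /\ P e.
Proof.
elim: N => [|N [s [us hs]]]; first by exists [::]; split=> // e; split=> [|[]].
case: (classic (P N)) => hN.
  exists (N :: s); split=> [|e]; first by rewrite /= us andbT; apply/negP => /hs [] ; rewrite ltnn.
  rewrite inE ltnS leq_eqVlt; split.
    by case/orP => [/eqP -> |/hs [-> ?]]; rewrite ?eqxx ?orbT.
  by case=> /orP [->|lt] // he; apply/orP; right; apply/hs.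
exists s; split=> // e; split=> [/hs [lt he]|[]]; first by rewrite ltnS ltnW.
by rewrite ltnS leq_eqVlt => /orP [/eqP -> //|lt he]; apply/hs.
Qed.

(** Elements realizing the different orders at 0 form a basis of W_d, so their number k is its
    dimension. At a point outside the roots of [b] and of the Wronskian bound no nonzero element
    vanishes to order k, yet the set of orders there is again [R d]; k distinct numbers below k fill
    the interval. *)
Lemma orders_segment d : exists k, forall e, R d e <-> (e < k)%N.
Proof.
have [es [ues hes]] := classical_filter (R d) d.+1.
have Res e : e \in es <-> R d e.
  by rewrite hes; split=> [[]|h] //; split=> //; apply: R_le h.
have [F hF] : exists F : nat -> {poly K}, forall e, e \in es -> W d (F e) /\ has_order e (F e).
  have : forall x : seq_sub es, exists f, W d f /\ has_order (val x) f.
    by move=> x; have /Res /W_order0 [f h1 h2] := valP x; exists f.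
  case/fin_all_exists => F hF; exists (fun e => if insub e is Some x then F x else 0).
  by move=> e he; rewrite insubT; apply: hF.
pose vs := [seq F e | e <- es].
have nthF i : (i < size es)%N -> nth 0 vs i = F (nth 0%N es i).
  by move=> hi; rewrite (nth_map 0%N).
(* The orders are distinct, so the term of least order in a relation cannot cancel. *)
have ind : indep vs.
  move=> c hc i; rewrite size_map => hi; apply/eqP/negPn/negP => ci.
  have [j [hj cj] jmin] : exists2 j, (j < size es)%N /\ c j != 0 &
      forall j', (j' < size es)%N -> c j' != 0 -> (nth 0%N es j <= nth 0%N es j')%N.
    have [|m [j [hj cj em]] mmin] := @least_nat (fun m => exists j, [/\ (j < size es)%N, c j != 0 & nth 0%N es j = m]).
      by exists (nth 0%N es i), i.
    exists j => // j' hj' cj'; rewrite em leqNgt; apply/negP => lt.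
    by apply: (mmin _ lt); exists j'.
  move/(congr1 (fun p : {poly K} => p`_(nth 0%N es j))): hc.
  rewrite /pcomb size_map coef_sum coef0 (bigD1 (Ordinal hj)) //= big1 ?addr0.
    rewrite coefZ nthF // => /eqP; rewrite mulf_eq0 (negbTE cj) /= => /eqP h.
    by have [_ [ne _]] := hF _ (mem_nth 0%N hj); rewrite h eqxx in ne.
  move=> j' hj'; rewrite coefZ nthF //.
  case: (eqVneq (c j') 0) => [->|cj']; first by rewrite mul0r.
  have [_ [_ ->]] := hF _ (mem_nth 0%N (ltn_ord j')); rewrite ?mulr0 //.
  rewrite ltn_neqAle jmin // andbT nth_uniq // eq_sym.
  by apply: contra hj' => /eqP e; apply/eqP/val_inj.
have Wcomb c : W d (pcomb c vs).
  rewrite /pcomb; apply: (big_ind (W d)) => [|f h hf hh|i _] //.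
    by rewrite -[f]scale1r; apply: W_lin.
  rewrite -[_ *: _]addr0; apply: W_lin => //.
  have hi : (i < size es)%N by rewrite -(size_map F es); apply: ltn_ord.
  by rewrite nthF //; have [] := hF _ (mem_nth 0%N hi).
have span f : W d f -> exists c, f = pcomb c vs.
  move=> hf; suff H m j : (j + m)%N = d.+1 -> forall f, W d f -> order_ge j f ->
      exists c, f = pcomb c vs by apply: (H d.+1 0%N).
  elim: m j => [|m IH] j hjm {}f {}hf hj.
    exists (fun=> 0); rewrite /pcomb big1 => [|i _]; last by rewrite scale0r.
    apply/polyP => i; rewrite coef0; case: (ltnP i d.+1) => hi.
      by rewrite hj // -(addn0 j) hjm.
    by rewrite nth_default // (leq_trans (W_size hf)).
  case: (eqVneq f`_j 0) => [fj|fj].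
    apply: (IH j.+1) => //; first by rewrite -hjm addnS addSn.
    by move=> i; rewrite ltnS leq_eqVlt => /orP [/eqP -> //|/hj].
  have Rj : R d j by apply/W_order0; exists f.
  have /Res hje := Rj; have [hFj [Fj Fj']] := hF j hje.
  pose a := f`_j / (F j)`_j.
  have [|||c ec] := IH j.+1 _ (- a *: F j + f).
  - by rewrite -hjm addnS addSn.
  - exact: W_lin.
  - move=> i; rewrite coefD coefZ ltnS leq_eqVlt => /orP [/eqP ->|hi].
      by rewrite mulNr divfK // addNr.
    by rewrite Fj' // mulr0 hj // addr0.
  exists (fun i => (if i == index j es then a else 0) + c i).
  rewrite /pcomb; under eq_bigr do rewrite scalerDl.
  rewrite big_split /= -/(pcomb c vs) -ec.
  have hi : (index j es < size vs)%N by rewrite size_map index_mem.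
  rewrite (bigD1 (Ordinal hi)) //= eqxx big1 ?addr0.
    by rewrite nthF ?index_mem // nth_index // scaleNr addNKr.
  by move=> i ii; rewrite ifF ?scale0r //; apply/negbTE; apply: contra ii => /eqP e; apply/eqP/val_inj.
have [b' b'0 hb'] := no_inflection ind.
have [|x] := @poly_nonroot _ charK (b * b').
  by rewrite mulf_neq0 //; apply: contraNneq b0 => ->; rewrite horner0.
rewrite hornerM mulf_eq0 negb_or => /andP [bx b'x].
have lt_k e : R d e -> (e < size es)%N.
  move=> /(W_order d e bx) [f hf [he hlow]]; rewrite ltnNge; apply/negP => le_ke.
  have [c ec] := span f hf; have f0 : f = 0.
    rewrite ec; apply: (hb' x b'x); rewrite -ec size_map; apply: order_shift_dvd.
    by move=> j hj; apply: hlow; apply: leq_trans le_ke.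
  by rewrite f0 comp_poly0 coef0 eqxx in he.
exists (size es) => e; split; first exact: lt_k.
have sub : {subset es <= iota 0 (size es)}.
  by move=> e' /Res /lt_k; rewrite mem_iota.
have [_ eq_es] := uniq_min_size ues sub (eq_leq (size_iota _ _)).
by move=> lt; apply/Res; rewrite eq_es mem_iota.
Qed.

Variable d0 : nat.
Hypothesis W_up : forall d f, W d f -> W d.+1 f.
Hypothesis W_upX : forall d f, W d f -> W d.+1 ('X * f).
Hypothesis W_gen : forall d f, (d0 <= d)%N -> W d.+1 f ->
  exists f1 f2, [/\ W d f1, W d f2 & f = f1 + 'X * f2].

Lemma reduce_orders d k f : (forall e, (e < k)%N -> R d e) ->
  exists2 v, W d v & order_ge k (f - v).
Proof.
elim: k => [|k IH] hk; first by exists 0; rewrite ?subr0.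
have [v hv ho] := IH (fun e he => hk e (leqW he)).
have /W_order0 [h Wh [h1 h2]] := hk k (ltnSn k).
exists (((f - v)`_k / h`_k) *: h + v); first exact: W_lin.
move=> j; rewrite ltnS leq_eqVlt opprD addrCA addrC coefB coefZ.
case/orP => [/eqP ->|hj]; first by rewrite divfK // subrr.
by rewrite (h2 j hj) mulr0 subr0 ho.
Qed.

(** Let [f0] in W_d have the largest order. One new order in degree d + 1 means that W_(d+1) is W_d
    plus the multiples of X [f0]. As [W_gen] generates the later degrees, W_(d+m) consists of
    elements [v + p * f0] with [v] in W_d and [p] of degree at most m. *)
Lemma crystallization d k : (d0 <= d)%N -> (0 < k)%N ->
  (forall e, R d e <-> (e < k)%N) -> (forall e, R d.+1 e <-> (e < k.+1)%N) ->
  forall m e, R (d + m) e -> (e < k + m)%N.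
Proof.
move=> hd; case: k => // k _ hk hk1.
have /W_order0 [f0 Wf0 of0] : R d k by apply/hk.
have vanish d' k' f : W d' f -> (forall e, R d' e <-> (e < k')%N) -> order_ge k' f -> f = 0.
  move=> hf hR ho; apply/eqP/negPn/negP => f_neq0.
  have [e he _] := has_order_exists f_neq0.
  have : R d' e by apply/W_order0; exists f.
  by move/hR => lt; have := ho e lt; case: he => /eqP.
have step w : W d.+1 w -> exists2 v, W d v & exists a, w = v + a *: ('X * f0).
  move=> hw; have [v hv ho] := reduce_orders w (fun e => proj2 (hk e)).
  exists v => //; pose a := (w - v)`_k.+1 / f0`_k; exists a.
  apply/eqP; rewrite addrC -subr_eq -subr_eq0; apply/eqP.
  apply: (vanish d.+1 k.+2) => //.
    rewrite addrC -scaleNr; apply: W_lin; first exact: W_upX.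
    by rewrite addrC -scaleN1r; apply: W_lin => //; apply: W_up.
  have [f0k f0l] := of0; move=> j; rewrite ltnS leq_eqVlt coefB coefZ coefXM.
  case/orP => [/eqP ->|hj] /=; first by rewrite divfK // subrr.
  case: j hj => [|j] hj /=; first by rewrite mulr0 subr0 ho.
  by rewrite (f0l j) // mulr0 subr0 ho.
have key m w : W (d + m)%N w -> exists2 v, W d v & exists2 p : {poly K}, (size p <= m.+1)%N & w = v + p * f0.
  elim: m w => [|m IH] w; rewrite ?addn0 ?addnS => hw.
    by exists w => //; exists 0; rewrite ?size_poly0 // mul0r addr0.
  have [|w1 [w2 [hw1 hw2 ->]]] := W_gen _ hw; first by rewrite (leq_trans hd) ?leq_addr.
  have [v1 hv1 [p1 s1 ->]] := IH _ hw1; have [v2 hv2 [p2 s2 ->]] := IH _ hw2.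
  have [v3 hv3 [a e3]] := step _ (W_upX hv2).
  exists (v1 + v3); first by rewrite -[v1]scale1r; apply: W_lin.
  exists (p1 + 'X * p2 + a *: 'X); last first.
    rewrite mulrDr e3 !mulrDl -scalerAl ['X * (p2 * f0)]mulrA -!addrA; congr (_ + _).
    by rewrite [RHS]addrCA; congr (_ + (_ + _)); apply: addrC.
  apply/leq_sizeP => j hj; rewrite !coefD coefZ coefX coefXM.
  have -> : p1`_j = 0 by apply/nth_default/(leq_trans s1)/ltnW.
  case: j hj => // j hj /=; have -> : p2`_j = 0 by apply/nth_default/(leq_trans s2).
  by case: j hj => //= j _; rewrite mulr0 !addr0.
move=> m e /W_order0 [w hw [we wl]]; have [v hv [p sp ew]] := key m w hw.
rewrite ltnNge; apply/negP => le_e.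
(* The constant term of [p] is moved into [v], so that [p' * f0] vanishes beyond every order
   available in W_d. Then so does [v'], which is therefore 0, and the order of [w] is that of [p']
   plus that of [f0]. *)
pose p' := p - (p`_0)%:P; pose v' := v + p`_0 *: f0.
have ew' : w = v' + p' * f0 by rewrite /v' /p' mulrBl mul_polyC ew -addrA [_ + (_ - _)]addrC subrK.
have p'0 : order_ge 1 p' by case=> // _; rewrite coefB coefC subrr.
have v'0 : v' = 0.
  apply: (vanish d k.+1) => //; first by rewrite /v' addrC; apply: W_lin.
  move=> j hj; have := wl j; rewrite ew' coefD.
  rewrite (order_geM p'0 of0.2) // addr0; apply.
  by apply: leq_trans le_e; apply: leq_trans hj _; rewrite leq_addr.
have p'neq0 : p' != 0.
  by apply/eqP => p0; move: we; rewrite ew' v'0 p0 mul0r addr0 coef0 eqxx.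
have [c oc lc] := has_order_exists p'neq0.
have := has_orderM oc of0; rewrite -(add0r (p' * f0)) -v'0 -ew' => ow.
have ec := has_order_uniq ow (conj we wl).
have : (c < m.+1)%N.
  apply: leq_trans lc _; apply/leq_sizeP => j hj; rewrite coefB coefC.
  by case: j hj => // j hj; rewrite /= subr0; apply/nth_default/(leq_trans sp).
by rewrite ltnS => cm; move: le_e; rewrite -ec; lia.
Qed.

End Orders.

End BinaryForms.

(** * The generic initial ideal *)

Section IdealSpan.
Variables (A : comNzRingType) (G : A -> Prop).

Lemma ideal_span_gen f : G f -> ideal_span G f.
Proof.
move=> hf; exists [:: (1, f)]; rewrite big_seq1 mul1r; split=> // x.
by rewrite mem_seq1 => /eqP ->.
Qed.

Lemma ideal_spanD f h : ideal_span G f -> ideal_span G h -> ideal_span G (f + h).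
Proof.
move=> [s [hs ->]] [r [hr ->]]; exists (s ++ r); rewrite big_cat; split=> // x.
by rewrite mem_cat => /orP [/hs|/hr].
Qed.

Lemma ideal_spanM a f : ideal_span G f -> ideal_span G (a * f).
Proof.
move=> [s [hs ->]]; exists [seq (a * x.1, x.2) | x <- s]; split.
  by move=> _ /mapP [x /hs hx ->].
by rewrite big_map mulr_sumr; apply: eq_bigr => x _; rewrite mulrA.
Qed.

Lemma ideal_span0 : ideal_span G 0.
Proof. by exists [::]; rewrite big_nil. Qed.

Lemma ideal_span_min (P : A -> Prop) : P 0 -> (forall f h, P f -> P h -> P (f + h)) ->
  (forall a f, G f -> P (a * f)) -> forall f, ideal_span G f -> P f.
Proof.
move=> P0 PD PM f [s [hs ->]]; rewrite big_seq.
by apply: big_ind => // x /hs; apply: PM.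
Qed.

End IdealSpan.

(** * Leading monomials read as orders of vanishing *)

Section PlaneOrder.
Variables (K : fieldType) (l : nat) (l_ge2 : (2 <= l)%N).
Local Notation S := {mpoly K[l]}.
Let i0 : 'I_l := Ordinal (ltnW l_ge2).
Let i1 : 'I_l := Ordinal l_ge2.

Lemma drl_mon12 d j e : (j < e)%N -> (e <= d)%N ->
  degrevlex_lt (mon12 l (d - e) e) (mon12 l (d - j) j).
Proof.
move=> je ed; apply/drlP; right; split.
  by rewrite !(mdeg_mon12 l_ge2) !subnK // ltnW // (leq_trans je).
exists i1; first by rewrite !(mon12_1 l_ge2).
by move=> i; rewrite /= => hi; rewrite !mon12_ge2.
Qed.

(** In a fixed degree, monomials in x_1 and x_2 decrease as the exponent of x_2 grows, and all other
    monomials lie below them. So the lowest power of t in the restriction marks the leading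
    monomial. *)
Lemma leading_monomial_order (f : S) d e : f \is d.-homog -> (e <= d)%N ->
  leading_monomial f (mon12 l (d - e) e) <-> has_order e (ev 1 'X f).
Proof.
move=> hf ed; rewrite leading_monomialP /has_order (coef_ev l_ge2 e hf) ed.
split=> -[h1 h2]; split=> //.
  move=> j je; rewrite (coef_ev l_ge2 j hf); case: leqP => // jd.
  by apply: h2; apply: drl_mon12.
move=> m hm; case: (mdeg m =P d) => [dm|/eqP]; last exact: (mcoeff_homog0 hf).
case: (boolP (low 2 m)) => hl; last first.
  have := @drl_low l 2 (mon12 l (d - e) e) m; rewrite (mdeg_mon12 l_ge2) subnK // dm.
  move=> /(_ erefl (low_mon12 _ _ _) hl) lt.
  by have := drl_trans hm lt; rewrite drl_irr.
have em := mon12E l_ge2 hl; have dm' := mdeg_low l_ge2 hl.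
have ed' : m (Ordinal (ltnW l_ge2)) = (d - m i1)%N by rewrite -dm dm' addnK.
have le1 : (m i1 <= d)%N by rewrite -dm dm' leq_addl.
rewrite em ed'; have := coef_ev l_ge2 (m i1) hf; rewrite le1 => <-; apply: h2.
case: (ltngtP (m i1) e) => // [lt|eq]; move: hm; rewrite em ed' -/i1.
  by move=> hm; have := drl_trans hm (drl_mon12 lt le1); rewrite drl_irr.
by rewrite eq drl_irr.
Qed.

(** The matrix sends x_2 to x_2 + x x_1 and fixes the other variables, which translates t = x_2 /
    x_1 by [x]. *)
Lemma ev_shear x (f : S) :
  ev 1 'X (change_coords (1%:M + x *: delta_mx i1 i0) f) = (ev 1 'X f) \Po ('X + x%:P).
Proof.
move: f; apply: (mpoly_rmorph_eq (f := ev 1 'X \o change_coords (1%:M + x *: delta_mx i1 i0))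
  (h := comp_poly ('X + x%:P) \o @ev K l 1 'X)) => [c|i] /=.
  by rewrite change_coordsC !evC comp_polyC.
rewrite change_coordsX.
have -> : \sum_j (1%:M + x *: delta_mx i1 i0) i j *: 'X_j =
    'X_i + (if i == i1 then x else 0) *: 'X_i0 :> S.
  under eq_bigr => j _ do rewrite !mxE scalerDl.
  rewrite big_split /=; congr (_ + _).
    rewrite (bigD1 i) //= eqxx scale1r big1 ?addr0 // => j ji.
    by rewrite eq_sym (negbTE ji) scale0r.
  rewrite (bigD1 i0) //= eqxx andbT big1 ?addr0 => [|j ji].
    by case: eqP => _; rewrite ?mulr1 ?mulr0.
  by rewrite (negbTE ji) andbF mulr0 scale0r.
rewrite rmorphD /= ev_scale !evX /plane_pt /=.
case: eqP => [->|/eqP hi] /=; first by rewrite comp_polyX -mul_polyC mulr1.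
rewrite scale0r addr0; case: i hi => -[|[|i]] hi //=; first by rewrite comp_polyC.
by rewrite nth_nil comp_poly0.
Qed.

End PlaneOrder.

Lemma mnm_le_mdeg l (m m' : 'X_{1..l}) : (m' <= m)%MM -> (mdeg m <= mdeg m')%N -> m' = m.
Proof.
move=> h hd; rewrite -(submK h); apply/esym; rewrite -[RHS]add0m; congr (_ + _)%MM.
apply/eqP; rewrite -mdeg_eq0 -leqn0 -(leq_add2r (mdeg m')) -mdegD submK //.
Qed.

(** * The generic initial ideal of the Jacobian ideal *)

Section Main.
Variables (K : fieldType) (charK : [pchar K] =i pred0).
Variables (l : nat) (l_ge2 : (2 <= l)%N) (n : nat).
Variables (H : 'I_n -> {vspace 'rV[K]_l}) (arrH : central_arrangement H).
Variables (alpha : 'I_n -> {mpoly K[l]}) (defH : defining_forms H alpha).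
Variables (R : {mpoly K[l]} -> Prop) (U : 'M[K]_l -> Prop).
Hypothesis openU : zariski_open_GL U.
Hypothesis rginU : forall g, U g -> forall f,
  R f <-> initial_ideal (change_coords_ideal g (jacobian_ideal alpha)) f.
Local Notation S := {mpoly K[l]}.
Let i0 : 'I_l := Ordinal (ltnW l_ge2).
Let i1 : 'I_l := Ordinal l_ge2.
Local Notation mon a b := (mon12 l a b).

Lemma U_unit g : U g -> g \in unitmx.
Proof. by case: openU => P hP /hP []. Qed.

Lemma rgin_ideal0 g : U g -> n = 0%N -> forall f, R f.
Proof.
move=> Ug n0 f; apply/(rginU Ug); exists [:: (f, 1)]; rewrite big_seq1 mulr1; split=> //.
move=> x; rewrite mem_seq1 => /eqP -> /=; exists 1, 0%MM; split.
- exists 1; last by rewrite rmorph1.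
  apply: ideal_span_gen; left; rewrite /defining_poly big1 // => i _.
  by have := ltn_ord i; rewrite {2}n0.
- by apply/leading_monomialP; rewrite mcoeff1 eqxx oner_neq0; split=> // m hm;
  rewrite mcoeff1; case: eqP hm => // ->; rewrite drl_irr.
by rewrite mcoeff1 eqxx scale1r mpolyX0.
Qed.

Variables (g : 'M[K]_l) (Ug : U g) (n0 : (0 < n)%N).
Let gU := U_unit Ug.
Local Notation grad := (grad_g alpha g).
Let gradH := grad_g_homog defH g.

Lemma rgin_lead h m : U h -> R 'X_[m] <-> lead_mon (grad_g alpha h) m.
Proof.
move=> Uh; rewrite (rginU Uh) initial_idealX.
  split=> [[f /(change_coords_idealP charK defH n0 (U_unit Uh)) [u ->] hm]|[u hm]].
    by exists u.
  exists (dot (grad_g alpha h) u) => //.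
  by apply/(change_coords_idealP charK defH n0 (U_unit Uh)); exists u.
move=> a f /(change_coords_idealP charK defH n0 (U_unit Uh)) [u ->].
apply/(change_coords_idealP charK defH n0 (U_unit Uh)); exists (a *: u).
by rewrite dotZ.
Qed.

Lemma rgin_mul a f : R f -> R (a * f).
Proof. by move/(rginU Ug) => h; apply/(rginU Ug); apply: ideal_spanM. Qed.

Lemma rginX_le m m' : (m <= m')%MM -> R 'X_[m] -> R 'X_[m'].
Proof. by move=> h /(rgin_mul 'X_[m' - m]); rewrite -mpolyXD submK. Qed.

Lemma rgin_mdeg m : R 'X_[m] -> (n.-1 <= mdeg m)%N.
Proof. by move/(rgin_lead m Ug)/(lead_mon_homog gradH) => []. Qed.

Lemma rgin_min_mon m : R 'X_[m] -> exists2 m0, (m0 <= m)%MM & min_mon_gen R m0.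
Proof.
move=> hm; have [|d [m0 [le0 R0 d0]] dmin] := @least_nat (fun d => exists m0,
    [/\ (m0 <= m)%MM, R 'X_[m0] & mdeg m0 = d]).
  by exists (mdeg m), m; rewrite lepm_refl.
exists m0 => //; split=> // m' R' le'; apply: mnm_le_mdeg => //.
rewrite leqNgt; apply/negP => lt; rewrite d0 in lt; apply: (dmin _ lt).
by exists m'; split=> //; apply: lepm_trans le' le0.
Qed.

Lemma rgin_low_free :
  (forall m, R 'X_[m] -> exists m0, [/\ (m0 <= m)%MM, low 2 m0 & R 'X_[m0]]) ->
  free_arrangement alpha.
Proof.
move=> low_gens; apply: (lift_free charK l_ge2 arrH defH n0 gU) => k /andP [k2 kl].
apply: (low_lead_syz_lift (k0 := 2) gradH) => // m /(rgin_lead m Ug) /low_gens.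
by case=> m0 [h1 h2 h3]; exists m0; split=> //; apply/(rgin_lead m0 Ug).
Qed.

Hypothesis gG : generic l_ge2 alpha g.

Lemma rgin_order_homog u d e : dot grad u \is d.-homog -> (e <= d)%N ->
  has_order e (ev 1 'X (dot grad u)) -> R 'X_[mon (d - e) e].
Proof.
move=> hu ed ho; apply/(rgin_lead _ Ug); exists u.
exact/(leading_monomial_order l_ge2 hu ed).
Qed.

Lemma rgin_x1 : R 'X_[mon (n - 1) 0].
Proof.
have h := dot_col0_homog l_ge2 defH g.
rewrite -(subn0 (n - 1)%N); apply: (rgin_order_homog h) => //; split=> //.
by rewrite -horner_coef0; apply: ev_col0_0.
Qed.

Lemma rgin_x2 : exists N, R 'X_[mon 0 N].
Proof.
have [N [v [hv ev_v]]] := exists_Xn charK defH n0 gG.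
exists N; rewrite -(subnn N); apply: (rgin_order_homog hv) => //.
rewrite -ev_restr2 ev_v rmorphXn /= evX /plane_pt /=.
by split=> [|j jN]; rewrite coefXn ?eqxx ?oner_neq0 // ltn_eqF.
Qed.

(** The space W_d of the overview; [plane_mon] is the set of orders attached to it. *)
Definition plane_comp d (f : {poly K}) :=
  exists2 u, dot grad u \is d.-homog & f = ev 1 'X (dot grad u).
Definition plane_mon d e := (e <= d)%N /\ R 'X_[mon (d - e) e].

Lemma plane_comp_lin d a f h : plane_comp d f -> plane_comp d h -> plane_comp d (a *: f + h).
Proof.
move=> [u hu ->] [v hv ->]; exists (a%:MP *: u + v); rewrite dotD dotZ mul_mpolyC.
  by apply: rpredD => //; apply: rpredZ.
by rewrite rmorphD /= ev_scale.
Qed.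

Lemma plane_comp0 d : plane_comp d 0.
Proof. by exists 0; rewrite dot0 ?rmorph0 ?dhomog0. Qed.

Lemma plane_comp_size d f : plane_comp d f -> (size f <= d.+1)%N.
Proof.
move=> [u hu ->]; apply/leq_sizeP => j hj; rewrite (coef_ev l_ge2 j hu).
by rewrite leqNgt hj.
Qed.

Lemma dhomogXM d (i : 'I_l) (p : S) : p \is d.-homog -> 'X_i * p \is d.+1.-homog.
Proof.
move=> hp; rewrite -add1n; apply: dhomogM => //.
by rewrite dhomogX; apply/eqP; exact: mdeg1.
Qed.

Lemma plane_comp_up d f : plane_comp d f -> plane_comp d.+1 f.
Proof.
move=> [u hu ->]; exists ('X_i0 *: u); rewrite dotZ; first exact: dhomogXM.
by rewrite rmorphM /= evX /plane_pt /= mul1r.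
Qed.

Lemma plane_comp_upX d f : plane_comp d f -> plane_comp d.+1 ('X * f).
Proof.
move=> [u hu ->]; exists ('X_i1 *: u); rewrite dotZ; first exact: dhomogXM.
by rewrite rmorphM /= evX /plane_pt /=.
Qed.

(** An element of J of degree above [n.-1] is [dot grad u] with the entries of [u] of positive
    degree, so modulo a_2 the row [u] is x_1 [q] + x_2 [q']. *)
Lemma plane_comp_gen d f : (n.-1 <= d)%N -> plane_comp d.+1 f ->
  exists f1 f2, [/\ plane_comp d f1, plane_comp d f2 & f = f1 + 'X * f2].
Proof.
move=> nd [u0 hu0 ->]; pose u := pihomog_row (d - n.-1).+1 u0.
have hu : homog_row (d - n.-1).+1 u by apply: pihomog_row_homog.
have -> : dot grad u0 = dot grad u.
  have := pihomog_dot gradH d.+1 u0.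
  by rewrite (pihomog_dE hu0) (leq_trans nd) // subSn.
have r0 : restr_row 0 u = 0.
  apply/matrixP => i j; rewrite [LHS]mxE [RHS]mxE ord1 restr0E (mcoeff_homog0 (hu j)) ?mpolyC0 //.
  by rewrite mdeg0.
pose q := quo_row (ltnW l_ge2) u; have eq := restr_quo_row (ltnW l_ge2) r0.
have hq : homog_row (d - n.-1) q by apply: (quo_row_homog (ltnW l_ge2) r0 hu).
have r1 : restr_row 1 (u - 'X_i0 *: q) = 0 by rewrite restr_rowB eq subrr.
have hu1 : homog_row (d - n.-1).+1 (u - 'X_i0 *: q).
  by apply: homog_rowB => // i; rewrite mxE; apply: dhomogXM.
pose q' := quo_row l_ge2 (u - 'X_i0 *: q); have eq' := restr_quo_row l_ge2 r1.
have hq' : homog_row (d - n.-1) q' by apply: (quo_row_homog l_ge2 r1 hu1).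
rewrite -/i0 -/i1 -/q -/q' in eq eq'; clearbody q q'.
have E : restr_row 2 u = restr_row 2 ('X_i0 *: q + 'X_i1 *: q').
  by rewrite restr_rowD -eq' -restr_rowD addrC subrK.
have homq v : homog_row (d - n.-1) v -> plane_comp d (ev 1 'X (dot grad v)).
  by move=> hv; exists v => //; rewrite -(subnK nd); apply: (dot_homog gradH).
exists (ev 1 'X (dot grad q)), (ev 1 'X (dot grad q')); split; [exact: homq|exact: homq|].
have eE := restr_dot grad E.
rewrite -(ev_restr2 1 'X (dot grad u)) eE ev_restr2 dotD !dotZ.
by rewrite rmorphD !rmorphM /= !evX /plane_pt /= mul1r.
Qed.

(** The sheared matrices g (1 + x E_21) form a line through [g], hence lie in [U] for almost all
    [x], and [R] is the same initial ideal for each of them. Leading monomials after the shear are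
    orders at t = x before it. *)
Lemma plane_order : exists2 b : {poly K}, b.[0] != 0 & forall d e x, b.[x] != 0 ->
  plane_mon d e <-> exists2 f, plane_comp d f & has_order e (f \Po ('X + x%:P)).
Proof.
have [b b0 hb] := zariski_line (g *m delta_mx i1 i0) openU Ug.
exists b => // d e x /hb; set h := g + _ => Uh.
pose s : 'M[K]_l := 1%:M + x *: delta_mx i1 i0.
have eh : h = g *m s by rewrite /h /s mulmxDr mulmx1 -scalemxAr.
have sU : s \in unitmx.
  by have := U_unit Uh; rewrite eh unitmx_mul => /andP [].
have shear u : dot (grad_g alpha h) (map_mx (change_coords s) u) = change_coords s (dot grad u).
  rewrite /dot [RHS]rmorph_sum; apply: eq_bigr => i _.
  by rewrite !mxE rmorphM /= change_coords_comp eh.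
have homs (p : S) : change_coords s p \is d.-homog -> p \is d.-homog.
  by move/(change_coords_homog (invmx s)); rewrite change_coordsK.
split=> [[ed /(rgin_lead _ Uh) hm]|[f [u hu ->] ho]].
  have [hd [u hu lm]] := lead_mon_homog (grad_g_homog defH h) hm.
  rewrite (mdeg_mon12 l_ge2) subnK // in hd hu.
  have hd' := dot_homog (grad_g_homog defH h) hu; rewrite subnK // in hd'.
  have [v eu] : exists v, dot (grad_g alpha h) u = change_coords s (dot grad v).
    by exists (map_mx (change_coords (invmx s)) u); rewrite -shear phi_psi.
  rewrite eu in hd' lm; have hv := homs _ hd'.
  exists (ev 1 'X (dot grad v)); first by exists v.
  by rewrite -(ev_shear l_ge2); apply/(leading_monomial_order l_ge2 hd' ed).
rewrite -(ev_shear l_ge2) -shear in ho.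
have hs : dot (grad_g alpha h) (map_mx (change_coords s) u) \is d.-homog.
  by rewrite shear; apply: change_coords_homog.
have ed : (e <= d)%N.
  by case: ho => [+ _]; rewrite (coef_ev l_ge2 e hs); case: leqP => //; rewrite eqxx.
split=> //; apply/(rgin_lead _ Uh); exists (map_mx (change_coords s) u).
exact/(leading_monomial_order l_ge2 hs ed).
Qed.

Lemma plane_segment d : exists k, forall e, plane_mon d e <-> (e < k)%N.
Proof.
have [b b0 hb] := plane_order.
exact: (orders_segment charK plane_comp_lin plane_comp0 plane_comp_size b0 hb).
Qed.

Lemma plane_crystal d k : (n.-1 <= d)%N -> (0 < k)%N ->
  (forall e, plane_mon d e <-> (e < k)%N) ->
  (forall e, plane_mon d.+1 e <-> (e < k.+1)%N) ->
  forall m e, plane_mon (d + m) e -> (e < k + m)%N.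
Proof.
have [b b0 hb] := plane_order.
exact: (crystallization plane_comp_lin plane_comp0 b0 hb plane_comp_up
  plane_comp_upX plane_comp_gen).
Qed.

Lemma rgin_exponents : exists lambda : nat -> nat, forall i, (i < n)%N ->
  R 'X_[mon (n - 1 - i) (lambda i)] /\
  forall b, R 'X_[mon (n - 1 - i) b] -> (lambda i <= b)%N.
Proof.
have [N hN] := rgin_x2.
have : forall i : 'I_n, exists b, R 'X_[mon (n - 1 - i) b] /\
    forall b', R 'X_[mon (n - 1 - i) b'] -> (b <= b')%N.
  move=> i; have [|b hb bmin] := @least_nat (fun b => R 'X_[mon (n - 1 - i) b]).
    by exists N; apply: rginX_le hN; rewrite (mon12_le l_ge2) leqnn.
  by exists b; split=> // b' hb'; rewrite leqNgt; apply/negP => /bmin; apply.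
case/fin_all_exists => L hL; exists (fun i => if insub i is Some j then L j else 0%N).
by move=> i hi; rewrite insubT; apply: (hL (Sub i hi)).
Qed.

Variable lambda : nat -> nat.
Hypothesis lambdaP : forall i, (i < n)%N ->
  R 'X_[mon (n - 1 - i) (lambda i)] /\
  forall b, R 'X_[mon (n - 1 - i) b] -> (lambda i <= b)%N.

Lemma lambda_gt0 i : (0 < i < n)%N -> (0 < lambda i)%N.
Proof.
move=> /andP [i_gt0 hi]; rewrite lt0n; apply/eqP => e.
have [/rgin_mdeg + _] := lambdaP hi; rewrite e (mdeg_mon12 l_ge2); lia.
Qed.

(** In the degree of x_1^(n-1-(i+1)) x_2^(lambda (i+1)) the orders fill an interval from 0, so the
    order below it occurs too. It belongs to the monomial x_1^(n-1-i) x_2^(lambda (i+1) - 1). *)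
Lemma lambda_lt i : (i.+1 < n)%N -> (lambda i < lambda i.+1)%N.
Proof.
move=> hi; have pos : (0 < lambda i.+1)%N by apply: lambda_gt0.
have [h1 _] := lambdaP hi; have [_ h2] := lambdaP (ltnW hi).
have [k hk] := plane_segment (n - 1 - i.+1 + lambda i.+1).
have : plane_mon (n - 1 - i.+1 + lambda i.+1) (lambda i.+1).
  by split; [exact: leq_addl|rewrite addnK].
move/hk => lt; have /hk [_] : ((lambda i.+1).-1 < k)%N by lia.
rewrite (_ : _ - _ = n - 1 - i)%N; last by lia.
by move/h2; lia.
Qed.

Lemma lambda_mono i j : (i < j < n)%N -> (lambda i < lambda j)%N.
Proof.
case/andP; elim: j => // j IH; rewrite ltnS leq_eqVlt => /orP [/eqP ->|lt] hj.
  exact: lambda_lt.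
by apply: ltn_trans (lambda_lt hj); apply: IH => //; apply: ltnW.
Qed.

(** With a gap of 3 or more, the number of orders in degree [d] is lambda i + 1 and it grows by
    exactly 1 in degree d + 1. Growth by at most 1 per degree from then on keeps the order lambda
    (i+1) out of the degree where the definition of lambda (i+1) puts it. *)
Lemma lambda_gap i : (i.+1 < n)%N -> (lambda i.+1 <= lambda i + 2)%N.
Proof.
move=> hi; rewrite leqNgt; apply/negP => gap.
have [h1 h1'] := lambdaP (ltnW hi); have [h2 h2'] := lambdaP hi.
pose d := (n - 1 - i + lambda i)%N.
have seg d' k : plane_mon d' k -> ~ plane_mon d' k.+1 -> forall e, plane_mon d' e <-> (e < k.+1)%N.
  have [r hr] := plane_segment d' => /hr lt hn; suff -> : k.+1 = r by [].
  by apply/eqP; rewrite eqn_leq lt leqNgt; apply/negP => /hr.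
have s1 : forall e, plane_mon d e <-> (e < (lambda i).+1)%N.
  apply: seg; first by split; [exact: leq_addl|rewrite addnK].
  case=> le_d; rewrite (_ : _ - _ = n - 1 - i.+1)%N; last by rewrite /d; lia.
  by move/h2'; lia.
have s2 : forall e, plane_mon d.+1 e <-> (e < (lambda i).+2)%N.
  apply: seg.
    split; first by rewrite ltnS leq_addl.
    rewrite subSS addnK; apply: rginX_le h1; rewrite (mon12_le l_ge2) leqnn leqnSn //.
  case=> le_d; rewrite (_ : _ - _ = n - 1 - i.+1)%N; last by rewrite /d; lia.
  by move/h2'; lia.
have nd : (n.-1 <= d)%N by have := rgin_mdeg h1; rewrite (mdeg_mon12 l_ge2).
have := plane_crystal nd (ltn0Sn _) s1 s2 (m := lambda i.+1 - (lambda i).+1) (e := lambda i.+1).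
rewrite subnKC; last by lia.
rewrite ltnn => C; suff : false by []; apply: C; split; first by rewrite /d; lia.
by rewrite (_ : _ - _ = n - 1 - i.+1)%N //; rewrite /d; lia.
Qed.

(** * The staircase as the set of minimal generators *)

Definition staircase m := m = mon (n - 1) 0 \/
  exists2 i : nat, (1 <= i <= n - 1)%N & m = mon (n - 1 - i) (lambda i).

Lemma staircase_rgin m : staircase m -> R 'X_[m].
Proof.
case=> [->|[i /andP [i1' i2'] ->]]; first exact: rgin_x1.
by have [|] := lambdaP (i := i); first by lia.
Qed.

Lemma low_staircase m : low 2 m -> R 'X_[m] -> exists2 m0, (m0 <= m)%MM & staircase m0.
Proof.
move=> /(mon12E l_ge2) ->; set a := m _; set b := m _ => hR.
case: (leqP (n - 1) a) => ha.
  by exists (mon (n - 1) 0); [rewrite (mon12_le l_ge2) ha|left].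
have [|_ h] := lambdaP (i := n - 1 - a); first by lia.
rewrite subKn in h; last by lia.
exists (mon a (lambda (n - 1 - a))); first by rewrite (mon12_le l_ge2) leqnn h.
by right; exists (n - 1 - a)%N; [lia|rewrite subKn // ltnW].
Qed.

Lemma staircase_min m : staircase m -> min_mon_gen R m.
Proof.
move=> hm; split; first exact: staircase_rgin.
case: hm => [->|[i hi ->]] m' Rm' le'.
  apply: mnm_le_mdeg => //; rewrite (mdeg_mon12 l_ge2) addn0.
  by have := rgin_mdeg Rm'; lia.
have lm' : low 2 m'.
  apply/lowP => j hj; have /mnm_lepP /(_ j) := le'.
  by rewrite mon12_ge2 // leqn0 => /eqP.
move: le' Rm'; rewrite (mon12E l_ge2 lm') (mon12_le l_ge2) => /andP [].
set a := m' _; set b := m' _ => ha hb Rm'.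
have [|_ h] := lambdaP (i := n - 1 - a); first by lia.
rewrite subKn in h; last by lia.
have {}h := h _ Rm'; have ea : a = (n - 1 - i)%N.
  apply/eqP; rewrite eqn_leq ha leqNgt; apply/negP => lt.
  have : (lambda i < lambda (n - 1 - a))%N by apply: lambda_mono; lia.
  by lia.
have ei : (n - 1 - a)%N = i by rewrite ea; lia.
by rewrite ei in h; rewrite ea; congr (mon12 l _ _); lia.
Qed.

Hypothesis alpha_free : free_arrangement alpha.

Lemma free_low_gens m : R 'X_[m] -> exists m0, [/\ (m0 <= m)%MM, low 2 m0 & R 'X_[m0]].
Proof.
have lift2 := generic_free_lift charK arrH defH n0 gU gG alpha_free.
move/(rgin_lead m Ug) => hm.
have [|m0 [h1 h2 h3]] := lead_mon_low gradH (k0 := 2) _ hm.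
  by move=> k /andP [k2 kl]; apply: (syz_lift_ge k2 kl).
by exists m0; split=> //; apply/(rgin_lead m0 Ug).
Qed.

Lemma min_staircase m : min_mon_gen R m <-> staircase m.
Proof.
split; last exact: staircase_min.
move=> [Rm hmin]; have [m0 [h1 h2 h3]] := free_low_gens Rm.
have [m1 h4 h5] := low_staircase h2 h3.
have := hmin m1 (staircase_rgin h5) (lepm_trans h4 h1).
by move=> <-.
Qed.

Lemma staircase_generates : minimally_generated_by R staircase.
Proof.
split; last exact: min_staircase.
move=> f; split=> [/(rginU Ug)|].
  apply: ideal_span_min => [|f1 f2|a t [f0 [m [hf0 hm ->]]]].
  - exact: ideal_span0.
  - exact: ideal_spanD.
  have Rm : R 'X_[m].
    apply/(rgin_lead m Ug).
    have [u eu] := (proj1 (change_coords_idealP charK defH n0 gU f0) hf0).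
    by exists u; rewrite -eu.
  have [m0 [h1 h2 h3]] := free_low_gens Rm.
  have [m1 h4 h5] := low_staircase h2 h3.
  rewrite -(submK (lepm_trans h4 h1)) mpolyXD scalerAl mulrA.
  by apply: ideal_spanM; apply: ideal_span_gen; exists m1.
apply: ideal_span_min => [|f1 f2 /(rginU Ug) h1 /(rginU Ug) h2|a t [m hm ->]].
- by apply/(rginU Ug); apply: ideal_span0.
- by apply/(rginU Ug); apply: ideal_spanD.
by apply: rgin_mul; apply: staircase_rgin.
Qed.

End Main.

Theorem theorem5p4 (K : fieldType) (charK : [pchar K] =i pred0)
  (l : nat) (l_ge2 : (2 <= l)%N) (n : nat)
  (H : 'I_n -> {vspace 'rV[K]_l}) (arrH : central_arrangement H)
  (alpha : 'I_n -> {mpoly K[l]}) (defH : defining_forms H alpha)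
  (R : {mpoly K[l]} -> Prop) (rginR : is_rgin (jacobian_ideal alpha) R) :
  (free_arrangement alpha <->
     (forall f, R f) \/
     [/\ min_mon_gen R (mon12 l (n - 1) 0),
         exists2 k : nat, (0 < k)%N & min_mon_gen R (mon12 l 0 k) &
         forall m, min_mon_gen R m ->
           forall i : 'I_l, (2 <= i)%N -> ~~ (U_(i) <= m)%MM])
  /\
  (free_arrangement alpha ->
     (forall f, R f) \/
     exists lambda : nat -> nat,
       [/\ forall i, (1 <= i <= n - 1)%N -> (1 <= lambda i)%N,
           forall i, (1 <= i <= n - 2)%N -> (lambda i < lambda i.+1)%N,
           forall i, (1 <= i <= n - 2)%N ->
             (lambda i.+1 - lambda i = 1 \/ lambda i.+1 - lambda i = 2)%N &
           minimally_generated_by R (fun m =>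
             m = mon12 l (n - 1) 0 \/
             exists2 i : nat, (1 <= i <= n - 1)%N &
               m = mon12 l (n - 1 - i) (lambda i))]).
Proof.
case: rginR => U [openU exU rginU].
have [g [Ug gG]] := generic_in_open charK l_ge2 arrH defH openU exU.
have R1_all : R 'X_[0] -> forall f, R f.
  by rewrite mpolyX0 => h f; rewrite -[f]mulr1; apply: (rgin_mul rginU Ug).
case: (posnP n) => [n0|n_gt0].
  have R_all := rgin_ideal0 rginU Ug n0.
  split; last by left.
  by split=> _; [left|apply: free_arrangement0].
(* For n = 1 the monomial x_1^(n-1) is 1, so R = S; freeness then follows from the criterion on
   generators in x_1 and x_2, applied with the monomial 1. *)
case: (leqP n 1) => [n_le1|n_gt1].
  have R_all : forall f, R f.
    apply: R1_all; have := rgin_x1 charK defH openU rginU Ug n_gt0 gG.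
    have -> : mon12 l (n - 1) 0 = 0%MM.
      apply/eqP; rewrite -mdeg_eq0 (mdeg_mon12 l_ge2); lia.
    by [].
  split; last by left.
  split=> _; first by left.
  apply: (rgin_low_free charK l_ge2 arrH defH openU rginU Ug n_gt0) => m _.
  exists 0%MM; split; [by apply/mnm_lepP => i; rewrite mnm0E| |exact: R_all].
  by apply/lowP => i _; rewrite mnm0E.
have [lambda lambdaP] := rgin_exponents charK defH openU rginU Ug n_gt0 gG.
have free_stair hfree m := min_staircase charK arrH defH openU rginU Ug n_gt0 gG lambdaP hfree m.
split; last first.
  move=> hfree; right; exists lambda; split=> [i hi|i hi|i hi|].
  - by apply: (lambda_gt0 charK l_ge2 defH openU rginU Ug n_gt0 lambdaP); lia.
  - by apply: (lambda_lt charK l_ge2 defH openU rginU Ug n_gt0 lambdaP); lia.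
  - have hi1 : (i.+1 < n)%N by lia.
    have := lambda_lt charK l_ge2 defH openU rginU Ug n_gt0 lambdaP hi1.
    have := lambda_gap charK l_ge2 defH openU rginU Ug n_gt0 lambdaP hi1.
    lia.
  exact: (staircase_generates charK arrH defH openU rginU Ug n_gt0 gG lambdaP hfree).
split=> [hfree|h].
  right; split.
  - by apply/(free_stair hfree); left.
  - exists (lambda (n - 1)%N).
      by apply: (lambda_gt0 charK l_ge2 defH openU rginU Ug n_gt0 lambdaP); lia.
    by apply/(free_stair hfree); right; exists (n - 1)%N; rewrite ?subnn //; lia.
  move=> m /(free_stair hfree) hm i hi; rewrite lep1mP negbK.
  by case: hm => [->|[j _ ->]]; rewrite mon12_ge2.
apply: (rgin_low_free charK l_ge2 arrH defH openU rginU Ug n_gt0) => m Rm.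
case: h => [R_all|[_ _ h]].
  exists 0%MM; split; [by apply/mnm_lepP => i; rewrite mnm0E| |exact: R_all].
  by apply/lowP => i _; rewrite mnm0E.
(* Each monomial of R is a multiple of a minimal one, which by assumption involves only x_1 and
   x_2. *)
have [m0 le0 min0] := rgin_min_mon Rm; exists m0; split=> //; last by case: min0.
apply/lowP => i hi; apply/eqP; have := h m0 min0 i hi.
by rewrite lep1mP negbK.
Qed.
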